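(* Let $\Gamma$ be a finitely generated linear group and let $X$ be a finite generating set of $\Gamma$. Then the following are equivalent: (a) $\mathrm{F}_{\Gamma,X}(n) \preceq (\log n)^r$ for some $r$; (b) $\Gamma$ is virtually nilpotent.
   Context: A group is linear if it is isomorphic to a subgroup of $\mathrm{GL}(d,K)$ for some $d$ and some field $K$. For a group $\Gamma$ with finite generating set $X$, $\|\cdot\|_X$ denotes word length with respect to $X$. $\mathrm{F}_{\Gamma,X}(n)$ is the smallest positive integer $N$ such that for every nontrivial $\gamma\in\Gamma$ with $\|\gamma\|_X\le n$ there is a normal subgroup of $\Gamma$ of finite index at most $N$ not containing $\gamma$ (and $\mathrm{F}_{\Gamma,X}(n)=\infty$ if there is no such integer). For functions $f_1,f_2$ on the positive integers with values in $[0,\infty]$, $f_1\preceq f_2$ means that there is a constant $C$ (a positive integer) such that $f_1(n)\le C f_2(Cn)$ for all $n\geq 1$; this includes the requirement that the right-hand side is defined. *)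

(* Defs.v *)
From HB Require Import structures.
From mathcomp Require Import all_boot all_order all_algebra.
From mathcomp Require Import all_classical all_reals all_analysis.

Set Implicit Arguments.
Unset Strict Implicit.
Unset Printing Implicit Defensive.

Import Order.TTheory GRing.Theory Num.Theory.

Local Open Scope classical_set_scope.
Local Open Scope ring_scope.

Definition is_linear (G : groupType) : Prop :=
  exists (d : nat) (K : fieldType) (f : G -> 'M[K]_d),
    [/\ injective f,
        forall x, f x \in unitmx &
        forall x y, f (x * y)%g = f x *m f y].

Definition is_subgroup (G : groupType) (H : set G) : Prop :=
  [/\ H 1%g,
      forall x y, H x -> H y -> H (x * y)%g &
      forall x, H x -> H x^-1%g].

Definition is_normal_subgroup (G : groupType) (H : set G) : Prop :=
  is_subgroup H /\ forall x y, H x -> H (x ^ y)%g.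

Definition generated (G : groupType) (A : set G) : set G :=
  smallest (@is_subgroup G) A.

Definition lcosets (G : groupType) (H : set G) : set (set G) :=
  [set [set (x * h)%g | h in H] | x in setT].

Definition index_at_most (G : groupType) (H : set G) (N : nat) : Prop :=
  (lcosets H #<= `I_N)%card.

Definition finite_index (G : groupType) (H : set G) : Prop :=
  finite_set (lcosets H).

(* [lower_central H 0] is [H] and [lower_central H i.+1] is the commutator
   subgroup [lower_central H i, H]. *)
Fixpoint lower_central (G : groupType) (H : set G) (i : nat) : set G :=
  if i is j.+1 then
    generated [set [~ x, y]%g | x in lower_central H j & y in H]
  else H.

Definition is_nilpotent (G : groupType) (H : set G) : Prop :=
  exists c : nat, lower_central H c = [set 1%g].

Definition virtually_nilpotent (G : groupType) : Prop :=
  exists H : set G, [/\ is_subgroup H, finite_index H & is_nilpotent H].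

Section ResidualFiniteness.
Variable R : realType.

(* Least element of a set of naturals, +oo if the set is empty. *)
Definition least (A : set nat) : \bar R :=
  ereal_inf [set n%:R%:E | n in A].

Definition is_word (G : groupType) (X : set G) (w : seq G) : Prop :=
  forall x, x \in w -> X x \/ X x^-1%g.

Definition word_length (G : groupType) (X : set G) (g : G) : \bar R :=
  least [set size w | w in
    [set w : seq G | is_word X w /\ (\prod_(x <- w) x)%g = g]].

Definition residual_growth (G : groupType) (X : set G) (n : nat) : \bar R :=
  least [set N : nat | (0 < N)%N /\
    forall g : G, g <> 1%g -> (word_length X g <= n%:R%:E)%E ->
      exists H : set G,
        [/\ is_normal_subgroup H, index_at_most H N & ~ H g]].

(* The right-hand function may be undefined ([None]) at some integers. *)
Definition preceq (f1 : nat -> \bar R) (f2 : nat -> option (\bar R)) : Prop :=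
  exists C : nat, (0 < C)%N /\
    forall n : nat, (0 < n)%N ->
      exists2 y, f2 (C * n)%N = Some y & (f1 n <= C%:R%:E * y)%E.

(* n |-> (log n)^r is undefined where log n = 0 and r is negative; [powR]
   would return 0 there. *)
Definition log_pow (r : R) (n : nat) : option (\bar R) :=
  if (ln (n%:R : R) == 0) && (r < 0) then None
  else Some ((ln (n%:R : R)) `^ r)%:E.

End ResidualFiniteness.

(* Main.v *)
(* If the group is virtually nilpotent, take a normal nilpotent subgroup H of finite index and a
   sequence of generators a_1, ..., a_h refining a central series. Polynomial distortion shows
   that a nontrivial g of length n lying in H is a_j^e z with z in the next term and |e| polynomial
   in n, so some m = O(log n) does not divide e. The subgroup generated by the powers x^(m^c) of
   the elements of H consists of m-th powers, hence essentially misses g; it is normal of index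
   polynomial in m.

   Conversely, call the growth slow if for every a there is a Q such that all nontrivial elements
   of length at most (Q+2)^a survive in a quotient of order at most Q. To refute slowness it is
   enough to write down one nontrivial element of length polynomial in Q that dies in all quotients
   of order at most Q.
   - Over a finite index subgroup acting irreducibly, with irreducibility stable under finite index
     and field extension, by nonscalar matrices, suitable commutators of nonscalar elements are
     nonscalar. Among Qk+1 conjugates of one element that are distinct modulo scalars, two agree
     in any quotient of order at most Q, so a tree of commutators of the leaves a_i^-1 a_j works.
     Hence, by induction on the degree, some subgroup of finite index is triangular over an
     extension field.
   - If, in a triangular group, all characters occurring on the unipotent filtration are of finite
     order, the group is virtually nilpotent. Otherwise let psi(y) = l be of infinite order for the
     last such factor; replacing y by a power, l satisfies no nontrivial relation with coefficients
     in {-1, 0, 1} (Kronecker). By pigeonhole there are two sets S, S' of exponents below Q^4 with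
     equally many elements, modulo every m <= Q, in every residue class modulo every k <= Q. The
     products of the x^(y^t) over S and over S' are then congruent modulo the next filtration step
     in every quotient of order at most Q, and iterated commutators of their quotient with y give
     the required element. *)

Require Import Defs.
From mathcomp Require Import all_boot all_order all_algebra all_field.
From mathcomp Require Import all_classical all_reals all_analysis.
From mathcomp Require Import zify ring lra.

Set Implicit Arguments.
Unset Strict Implicit.
Unset Printing Implicit Defensive.

Local Open Scope classical_set_scope.

(** * Subgroups, word length and index *)

Section Subgroups.
Local Open Scope group_scope.
Variable G : groupType.
Implicit Types (H K N A X : set G) (g h x y : G).

Lemma subgroup1 H : is_subgroup H -> H 1. Proof. by case. Qed.
Lemma subgroupM H x y : is_subgroup H -> H x -> H y -> H (x * y).
Proof. by case=> _ M _; apply: M. Qed.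
Lemma subgroupV H x : is_subgroup H -> H x -> H x^-1.
Proof. by case=> _ _; apply. Qed.
Lemma subgroupX H x n : is_subgroup H -> H x -> H (x ^+ n).
Proof.
move=> sH Hx; elim: n => [|n IH]; first exact: subgroup1.
by rewrite expgS; apply: subgroupM.
Qed.
Lemma subgroupJ H x y : is_subgroup H -> H x -> H y -> H (x ^ y).
Proof. by move=> sH Hx Hy; do !apply: subgroupM => //; apply: subgroupV. Qed.
Lemma subgroupR H x y : is_subgroup H -> H x -> H y -> H [~ x, y].
Proof. by move=> sH Hx Hy; apply: subgroupM (subgroupV _ _) (subgroupJ _ _ _). Qed.
Lemma subgroup_prod H (I : eqType) (s : seq I) (F : I -> G) :
  is_subgroup H -> (forall i, i \in s -> H (F i)) -> H (\prod_(i <- s) F i).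
Proof.
move=> sH sF; rewrite big_seq; apply: (big_ind H) => //.
- exact: subgroup1.
- by move=> x y; apply: subgroupM.
Qed.

Lemma is_subgroupI H K : is_subgroup H -> is_subgroup K -> is_subgroup (H `&` K).
Proof.
move=> sH sK; split; first by split; exact: subgroup1.
- by move=> x y [Hx Kx] [Hy Ky]; split; apply: subgroupM.
- by move=> x [Hx Kx]; split; apply: subgroupV.
Qed.

Lemma is_subgroupT : is_subgroup [set: G]. Proof. by []. Qed.

Lemma is_subgroup1 : is_subgroup [set 1 : G].
Proof. by split=> //= [x y -> ->|x ->]; rewrite ?mulg1 ?invg1. Qed.

Lemma sub_generated A : A `<=` generated A.
Proof. exact: sub_smallest. Qed.

Lemma generated_min A H : is_subgroup H -> A `<=` H -> generated A `<=` H.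
Proof. exact: smallest_sub. Qed.

Lemma is_subgroup_generated A : is_subgroup (generated A).
Proof.
split=> [H [sH AH]|x y gx gy H [sH AH]|x gx H [sH AH]].
- exact: subgroup1.
- by apply: subgroupM => //; [apply: gx|apply: gy].
- by apply: subgroupV => //; apply: gx.
Qed.

Lemma generatedS A B : A `<=` B -> generated A `<=` generated B.
Proof.
move=> AB; apply: generated_min; first exact: is_subgroup_generated.
by apply: (subset_trans AB); exact: sub_generated.
Qed.

Lemma generatedJ A N x : is_subgroup N -> (forall a, A a -> N (a ^ x)) ->
  forall a, generated A a -> N (a ^ x).
Proof.
move=> sN AN a; apply: (@generated_min A [set a | N (a ^ x)]) => //.
split=> /= [|u v Nu Nv|u Nu]; rewrite ?conj1g ?conjMg ?conjVg.
- exact: subgroup1.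
- exact: subgroupM.
- exact: subgroupV.
Qed.

(** Word length at most [n] as a plain predicate with a witness word, which keeps most of the
    development free of extended reals; [word_length_le] is the bridge. *)
Definition lenle X n g :=
  exists w : seq G, [/\ is_word X w, size w <= n & \prod_(x <- w) x = g].

Lemma lenleW X m n g : m <= n -> lenle X m g -> lenle X n g.
Proof. by move=> mn [w [Xw wm <-]]; exists w; split=> //; apply: leq_trans mn. Qed.

Lemma lenle1 X n : lenle X n 1.
Proof. by exists [::]; rewrite big_nil. Qed.

Lemma lenleM X m n g h : lenle X m g -> lenle X n h -> lenle X (m + n) (g * h).
Proof.
move=> [w [Xw wm <-]] [w' [Xw' wn <-]]; exists (w ++ w'); split.
- by move=> x; rewrite mem_cat => /orP[/Xw|/Xw'].
- by rewrite size_cat leq_add.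
- by rewrite big_cat.
Qed.

Lemma lenleV X n g : lenle X n g -> lenle X n g^-1.
Proof.
move=> [w [Xw wn <-]]; exists [seq x^-1 | x <- rev w]; split.
- move=> x /mapP[y]; rewrite mem_rev => /Xw Xy ->; rewrite invgK.
  by case: Xy; [right|left].
- by rewrite size_map size_rev.
- elim: w {Xw wn} => [|a w IH]; first by rewrite !big_nil invg1.
  by rewrite rev_cons map_rcons -cats1 big_cat /= IH big_seq1 big_cons invgM.
Qed.

Lemma lenle_gen X g : X g -> lenle X 1 g.
Proof.
move=> Xg; exists [:: g]; split=> //; last by rewrite big_seq1.
by move=> x; rewrite inE => /eqP->; left.
Qed.

Lemma lenleX X n k g : lenle X n g -> lenle X (k * n) (g ^+ k).
Proof.
move=> ng; elim: k => [|k IH]; first exact: lenle1.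
by rewrite expgS mulSn; apply: lenleM.
Qed.

Lemma lenleJ X m n g h : lenle X m g -> lenle X n h -> lenle X (m + n.*2) (g ^ h).
Proof.
move=> lg lh; apply: (@lenleW _ (n + (m + n))); first by lia.
by apply: lenleM (lenleM lg lh); apply: lenleV.
Qed.

Lemma lenleR X m n g h : lenle X m g -> lenle X n h ->
  lenle X (m.*2 + n.*2) [~ g, h].
Proof.
move=> lg lh; apply: (@lenleW _ (m + (m + n.*2))); first by lia.
by apply: lenleM (lenleJ lg lh); apply: lenleV.
Qed.

Lemma lenle_prod X m (I : eqType) (s : seq I) (F : I -> G) :
  (forall i, i \in s -> lenle X m (F i)) ->
  lenle X (size s * m) (\prod_(i <- s) F i).
Proof.
elim: s => [|a s IH] Hs; first by rewrite big_nil; exact: lenle1.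
rewrite big_cons /= mulSn; apply: lenleM; first by apply: Hs; rewrite mem_head.
by apply: IH => i si; apply: Hs; rewrite inE si orbT.
Qed.

Lemma lenle_generated X n g : lenle X n g -> generated X g.
Proof.
have sG := is_subgroup_generated X.
move=> [w [Xw _ <-]]; apply: subgroup_prod => // x /Xw[Xx|Xx].
- exact: sub_generated.
- by rewrite -[x]invgK; exact: (subgroupV sG (sub_generated Xx)).
Qed.

Lemma generated_lenle X g : generated X g -> exists n, lenle X n g.
Proof.
apply: (@generated_min X [set g | exists n, lenle X n g]).
  split=> /= [|x y [m lx] [n ly]|x [n lx]].
  - by exists 0%N; exact: lenle1.
  - by exists (m + n)%N; exact: lenleM.
  - by exists n; exact: lenleV.
by move=> x Xx; exists 1%N; exact: lenle_gen.
Qed.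

Lemma lenle_unif (s : seq G) X : (forall x, x \in s -> generated X x) ->
  exists k, forall x, x \in s -> lenle X k x.
Proof.
elim: s => [|a s IH] sX; first by exists 0%N.
have [|k Hk] := IH; first by move=> x xs; apply: sX; rewrite inE xs orbT.
have [m Hm] := generated_lenle (sX a (mem_head _ _)).
exists (maxn m k) => x; rewrite inE => /orP[/eqP->|/Hk].
- by apply: lenleW Hm; rewrite leq_maxl.
- by apply: lenleW; rewrite leq_maxr.
Qed.

Definition covers H (r : seq G) := forall g, exists2 t, t \in r & H (t^-1 * g).

Lemma lcosetE H x y : is_subgroup H ->
  [set (x * h) | h in H] = [set (y * h) | h in H] <-> H (x^-1 * y).
Proof.
move=> sH; split=> [E|Hxy].
  have: [set (x * h) | h in H] y.
    by rewrite E; exists 1; [exact: subgroup1|rewrite mulg1].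
  by case=> h Hh <-; rewrite mulKg.
apply/seteqP; split=> z [h Hh <-].
- exists (y^-1 * x * h); last by rewrite !mulgA mulgV mul1g.
  by apply: subgroupM => //; rewrite -(invgK x) -invgM; apply: subgroupV.
- by exists (x^-1 * y * h); [apply: subgroupM|rewrite !mulgA mulgV mul1g].
Qed.

Lemma covers_index H r : is_subgroup H -> covers H r -> index_at_most H (size r).
Proof.
move=> sH cov; rewrite /index_at_most.
apply: (@card_le_trans _ _ _ ((fun i => [set (nth 1 r i * h) | h in H]) @` `I_(size r))).
  apply: subset_card_le => C [x _ <-]; have [t tr Ht] := cov x.
  exists (index t r); first by rewrite /= index_mem.
  by rewrite nth_index //; apply/lcosetE.
exact: card_image_le.
Qed.

Lemma index_covers H n : is_subgroup H -> index_at_most H n ->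
  exists2 r, covers H r & size r <= n.
Proof.
move=> sH /pcard_leP[f].
pose P i x := lcosets H [set (x * h) | h in H] /\
   f [set (x * h) | h in H] = i.
pose c i := xget 1 (P i).
exists [seq c i | i <- iota 0 n]; last by rewrite size_map size_iota.
move=> g.
have Lg : lcosets H [set (g * h) | h in H] by exists g.
have fn : `I_n (f [set (g * h) | h in H]) by exact: (@funS _ _ _ _ f _ Lg).
exists (c (f [set (g * h) | h in H])).
  by apply: map_f; rewrite mem_iota.
have [L E] : P (f [set (g * h) | h in H]) (c (f [set (g * h) | h in H])).
  by apply: xgetPex; exists g.
by apply/lcosetE => //; apply: (@inj _ _ _ f) E; exact/mem_set.
Qed.

Lemma index_at_mostW H m n : m <= n -> index_at_most H m -> index_at_most H n.
Proof.
move=> mn /card_le_trans; apply; apply: subset_card_le => i /=.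
by move=> im; apply: leq_trans mn.
Qed.

Lemma finite_index_at_most H : finite_index H <-> exists n, index_at_most H n.
Proof.
split.
- move=> [n Hn]; exists n; rewrite /index_at_most.
  by move: Hn; rewrite card_eq_le => /andP[].
- by case=> n Hn; apply: card_le_finite Hn _; exact: finite_II.
Qed.

Lemma finite_index_covers H : is_subgroup H -> finite_index H <-> exists r, covers H r.
Proof.
move=> sH; rewrite finite_index_at_most; split.
- by case=> n /(index_covers sH)[r cr _]; exists r.
- by case=> r /(covers_index sH); exists (size r).
Qed.

Lemma finite_indexT : finite_index [set: G].
Proof. by apply/finite_index_covers => //; exists [:: 1] => g; exists 1; rewrite ?inE. Qed.

Lemma finite_indexS H K : is_subgroup H -> is_subgroup K -> H `<=` K ->
  finite_index H -> finite_index K.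
Proof.
move=> sH sK HK; rewrite !finite_index_covers // => -[r cr].
by exists r => g; have [t tr /HK] := cr g; exists t.
Qed.

(** A fibre of [F] inside [H] lies in one left coset of [S], so one product of representatives for
    each coset of [H] and each value of [F] covers the group. Stabilizers get their finite index in
    this way from an invariant with finitely many values. *)
Lemma finite_index_fiber (T : eqType) (F : G -> T) (vals : seq T) H S :
  is_subgroup H -> finite_index H -> is_subgroup S ->
  (forall g, H g -> F g \in vals) ->
  (forall g h, H g -> H h -> F g = F h -> S (g^-1 * h)) ->
  finite_index S.
Proof.
move=> sH fH sS Fv FS; apply/finite_index_covers => //.
have [r cr] := (finite_index_covers sH).1 fH.
pose c v := xget 1 [set h | H h /\ F h = v].
exists [seq t * c v | t <- r, v <- vals] => g.
have [t tr Htg] := cr g.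
exists (t * c (F (t^-1 * g))); first by apply/allpairsP; exists (t, F (t^-1 * g)); split=> //=; apply: Fv.
have [Hc Ec] : [set h | H h /\ F h = F (t^-1 * g)] (c (F (t^-1 * g))).
  by apply: xgetPex; exists (t^-1 * g).
by rewrite invgM -mulgA; apply: FS.
Qed.

Lemma index_at_mostI H K m n : is_subgroup H -> is_subgroup K ->
  index_at_most H m -> index_at_most K n -> index_at_most (H `&` K) (m * n).
Proof.
move=> sH sK /(index_covers sH)[r cr rm] /(index_covers sK)[r' cr' rn].
pose c t t' := xget 1 [set g | H (t^-1 * g) /\ K (t'^-1 * g)].
apply: (@index_at_mostW _ (size [seq c t t' | t <- r, t' <- r'])).
  by rewrite size_allpairs leq_mul.
apply: covers_index; first exact: is_subgroupI.
move=> g; have [t tr Ht] := cr g; have [t' tr' Kt'] := cr' g.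
exists (c t t'); first exact: allpairs_f.
have [Hc Kc] : [set g | H (t^-1 * g) /\ K (t'^-1 * g)] (c t t') by apply: xgetPex; exists g.
split.
- by rewrite -[g](mulVKg t) mulgA -[(c t t')^-1 * t]invgK invgM invgK; apply: subgroupM (subgroupV _ _) _.
- by rewrite -[g](mulVKg t') mulgA -[(c t t')^-1 * t']invgK invgM invgK; apply: subgroupM (subgroupV _ _) _.
Qed.

Lemma finite_indexI H K : is_subgroup H -> is_subgroup K ->
  finite_index H -> finite_index K -> finite_index (H `&` K).
Proof.
move=> sH sK /finite_index_at_most[m Hm] /finite_index_at_most[n Kn].
by apply/finite_index_at_most; exists (m * n)%N; exact: index_at_mostI.
Qed.

Lemma index_pigeonhole H n (f : nat -> G) : is_subgroup H -> index_at_most H n ->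
  exists i j, [/\ i < j, j <= n & H ((f i)^-1 * f j)].
Proof.
move=> sH /(index_covers sH)[r cr rn].
pose c (i : 'I_n.+1) := xget 1 [set t | t \in r /\ H (t^-1 * f i)].
have cP i : c i \in r /\ H ((c i)^-1 * f i).
  by apply: (@xgetPex _ _ [set t | t \in r /\ H (t^-1 * f i)]); have [t tr Ht] := cr (f i); exists t.
have /injectivePn[i [j ij E]] : ~~ injectiveb c.
  apply/negP=> /injectiveP cI.
  have : size [seq c i | i <- enum 'I_n.+1] <= size r.
    apply: uniq_leq_size; first by rewrite map_inj_uniq ?enum_uniq.
    by move=> x /mapP[i _ ->]; case: (cP i).
  by rewrite size_map size_enum_ord => /leq_trans/(_ rn); rewrite ltnn.
wlog lij : i j ij E / i < j.
  move=> W; case: (ltngtP i j) => [lij|lji|/val_inj/eqP]; first exact: W E lij.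
    by apply: (W j i) => //; rewrite eq_sym.
  by rewrite (negPf ij).
exists i, j; split=> //; first by rewrite -ltnS.
have [_ Hi] := cP i; have [_ Hj] := cP j.
rewrite -[f j](mulVKg (c j)) mulgA; apply: subgroupM => //.
by rewrite -E; have := subgroupV sH Hi; rewrite invgM invgK.
Qed.

Lemma infinite_index_ball X S k : generated X = setT -> is_subgroup S -> ~ finite_index S ->
  exists f : nat -> G, (forall i, i <= k -> lenle X k (f i)) /\
    forall i j, i < j -> j <= k -> ~ S ((f i)^-1 * f j).
Proof.
move=> genX sS infS; elim: k => [|k [f [fX fS]]].
  by exists (fun=> 1); split=> [i _|i j]; [exact: lenle1|lia].
case: (pselect (exists2 g, lenle X k.+1 g & forall i, i <= k -> ~ S ((f i)^-1 * g))).
  case=> g gX gS; exists (fun i => if i <= k then f i else g); split=> [i ik|i j ij jk].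
    by case: ifP => // ik'; apply: lenleW (fX _ ik').
  rewrite (_ : i <= k); last by lia.
  by case: ifP => jk'; [exact: fS|apply: gS; lia].
move=> no; exfalso; apply: infS; apply/finite_index_covers => //.
pose C := [set g | exists2 i, i <= k & S ((f i)^-1 * g)].
have near g : lenle X k.+1 g -> C g.
  move=> gX; apply: contrapT => nC; apply: no; exists g => // i ik Si.
  by apply: nC; exists i.
have CX x g : lenle X 1 x -> C g -> C (x * g).
  move=> lx [i ik Si]; have [j jk Sj] := near _ (lenleM lx (fX i ik)).
  by exists j => //; rewrite -[g](mulVKg (f i)) !mulgA -mulgA -(mulgA _ x); apply: subgroupM.
exists [seq f i | i <- iota 0 k.+1] => g.
suff [i ik Si] : C g by exists (f i) => //; apply: map_f; rewrite mem_iota.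
have /generated_lenle[n [w [Xw _ <-]]] : generated X g by rewrite genX.
elim: w Xw {n g} => [|x w IH] Xw; first by rewrite big_nil; apply: near; exact: lenle1.
rewrite big_cons; apply: CX.
  exists [:: x]; split=> //; last by rewrite big_seq1.
  by move=> y; rewrite inE => /eqP->; apply: Xw; rewrite mem_head.
by apply: IH => y yw; apply: Xw; rewrite inE yw orbT.
Qed.

End Subgroups.

(** * Distortion and powers in nilpotent groups *)

Section Nilpotent.
Local Open Scope group_scope.
Variable G : groupType.
Implicit Types (H K N A X : set G) (g h x y a : G) (s : seq G).

(** Schreier rewriting turns each letter [x] of a word into a single generator
    [(rr q)^-1 * (x * rr p)], so passing to a subgroup of finite index does not lengthen words. *)
Lemma schreier X H : finite_set X -> is_subgroup H -> finite_index H ->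
  exists Y : seq G, (forall y, y \in Y -> H y) /\
    forall n g, H g -> lenle X n g -> lenle [set` Y] n g.
Proof.
move=> /finite_seqP[xs ->] sH /(finite_index_covers sH)[r cr].
(* The representative is 1 on [H], so that [(rr g)^-1 * g] is [g] itself for the elements of
   interest. *)
pose rr g := if `[< H g >] then 1 else xget 1 [set t | t \in r /\ H (t^-1 * g)].
have rrP g : rr g \in 1 :: r /\ H ((rr g)^-1 * g).
  rewrite /rr; case: asboolP => Hg; first by rewrite mem_head invg1 mul1g.
  have [tr Ht] : [set t | t \in r /\ H (t^-1 * g)] (xget 1 [set t | t \in r /\ H (t^-1 * g)]).
    by apply: xgetPex; have [t tr Ht] := cr g; exists t.
  by rewrite inE tr orbT.
have rr1 g : H g -> rr g = 1 by rewrite /rr; case: asboolP.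
pose Z := [seq ab.1^-1 * (x * ab.2) | ab <- [seq (a, b) | a <- 1 :: r, b <- 1 :: r],
   x <- xs ++ [seq x^-1 | x <- xs]].
exists [seq z <- Z | `[< H z >]]; split.
  by move=> y; rewrite mem_filter => /andP[/asboolP].
move=> n g Hg [w [Xw wn Eg]].
suff : lenle [set` [seq z <- Z | `[< H z >]]] (size w) ((rr g)^-1 * g).
  by rewrite rr1 // invg1 mul1g; apply: lenleW.
rewrite -{}Eg {wn Hg g}; elim: w Xw => [|x w IH] Xw.
  by rewrite big_nil rr1 ?invg1 ?mulg1; [exact: lenle1|exact: subgroup1].
set p := \prod_(i <- w) i in IH.
rewrite big_cons -/p; set q := x * p.
have -> : (rr q)^-1 * q = ((rr q)^-1 * (x * rr p)) * ((rr p)^-1 * p).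
  by rewrite /q !mulgA mulgK.
rewrite /= -add1n; apply: lenleM; last first.
  by apply: IH => z zw; apply: Xw; rewrite inE zw orbT.
apply: lenle_gen; rewrite /= mem_filter; apply/andP; split.
  apply/asboolP; have -> : (rr q)^-1 * (x * rr p) = ((rr q)^-1 * q) * ((rr p)^-1 * p)^-1.
    by rewrite /q invgM invgK !mulgA mulgK.
  by apply: subgroupM => //; [case: (rrP q)|apply: subgroupV => //; case: (rrP p)].
have pr : (rr q, rr p) \in [seq (a, b) | a <- 1 :: r, b <- 1 :: r].
  by apply: allpairs_f; [case: (rrP q)|case: (rrP p)].
apply/allpairsP; exists ((rr q, rr p), x); split=> //.
rewrite mem_cat; case: (Xw x (mem_head _ _)) => /= xs_x; first by rewrite xs_x.
by apply/orP; right; rewrite -[x]invgK map_f.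
Qed.

(** The intersection of the conjugates of [H] given by the representatives is already normal,
    because [y * t] is some representative times an element of [H]. The entry 1 puts the
    intersection inside [H]. *)
Lemma normal_core H : is_subgroup H -> finite_index H ->
  exists K, [/\ is_normal_subgroup K, K `<=` H & finite_index K].
Proof.
move=> sH fH; have [r cr] := (finite_index_covers sH).1 fH.
pose Ks s := [set x | forall t, t \in s -> H (x ^ t)].
have sK s : is_subgroup (Ks s).
  split=> [t _|x y Kx Ky t ts|x Kx t ts]; rewrite ?conj1g ?conjMg ?conjVg.
  - exact: subgroup1.
  - by apply: subgroupM; [|apply: Kx|apply: Ky].
  - by apply: subgroupV; [|apply: Kx].
have fK s : finite_index (Ks s).
  elim: s => [|t s IH]; first by apply: (finite_indexS (is_subgroupT G) (sK [::]) _ (@finite_indexT G)).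
  have s1 : is_subgroup [set x | H (x ^ t)].
    split=> [|x y|x] /=; rewrite ?conj1g ?conjMg ?conjVg.
    - exact: subgroup1.
    - exact: subgroupM.
    - exact: subgroupV.
  apply: (@finite_indexS _ (Ks s `&` [set x | H (x ^ t)])) => //.
  - exact: is_subgroupI.
  - by move=> x [Kx /= Ht] u; rewrite inE => /orP[/eqP->|/Kx].
  apply: finite_indexI => //; apply/finite_index_covers => //.
  exists [seq u ^ t^-1 | u <- r] => g; have [u ur Hu] := cr (g ^ t).
  exists (u ^ t^-1); first exact: map_f.
  by rewrite /= conjMg conjVg -conjgM mulVg conjg1.
exists (Ks (1 :: r)); split=> //.
- split=> // x y Kx t _; have [u ur Hu] := cr (y * t).
  rewrite -conjgM -[y * t](mulVKg u) conjgM; apply: subgroupJ => //.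
  by apply: Kx; rewrite inE ur orbT.
- by move=> x Kx; rewrite -[x]conjg1; apply: Kx; rewrite mem_head.
Qed.

Lemma lower_centralS H K i : H `<=` K -> lower_central H i `<=` lower_central K i.
Proof.
move=> HK; elim: i => [//|i IH] /=.
by apply: generatedS => z [x Hx [y Hy <-]]; exists x; [exact: IH|exists y => //; exact: HK].
Qed.

Lemma is_nilpotentS H K : is_subgroup H -> H `<=` K -> is_nilpotent K -> is_nilpotent H.
Proof.
move=> sH HK [c Ec]; exists c; apply/seteqP; split.
  by rewrite -Ec; exact: lower_centralS.
move=> _ ->; case: c Ec => [|c] _ /=; first exact: subgroup1.
exact: subgroup1 (is_subgroup_generated _).
Qed.

Lemma is_subgroup_lower_central H i : is_subgroup H -> is_subgroup (lower_central H i).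
Proof. by case: i => [|i] //= _; exact: is_subgroup_generated. Qed.

Lemma lower_central_sub H i : is_subgroup H -> lower_central H i `<=` H.
Proof.
move=> sH; elim: i => [//|i IH] /=; apply: generated_min => // _ [x Hx [y Hy <-]].
by apply: subgroupR => //; apply: IH.
Qed.

Lemma lower_centralR H i x y : lower_central H i x -> H y -> lower_central H i.+1 [~ x, y].
Proof. by move=> Hx Hy; apply: sub_generated; exists x => //; exists y. Qed.

Lemma lower_centralJ H i x y : is_subgroup H -> lower_central H i x -> H y ->
  lower_central H i (x ^ y).
Proof.
move=> sH Lx Hy; elim: i x Lx => [|i IH] x Lx /=; first exact: subgroupJ.
apply: generatedJ Lx; first exact: is_subgroup_generated.
move=> _ [u Hu [v Hv <-]]; rewrite conjRg; apply: sub_generated.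
by exists (u ^ y); [exact: IH|exists (v ^ y) => //; exact: subgroupJ].
Qed.

Lemma lower_central_desc H i : is_subgroup H -> lower_central H i.+1 `<=` lower_central H i.
Proof.
move=> sH; have sL := is_subgroup_lower_central i sH.
apply: generated_min => // _ [x Hx [y Hy <-]].
by apply: subgroupM => //; [apply: subgroupV|apply: lower_centralJ].
Qed.

Definition zpow x (e : int) := match e with Posz n => x ^+ n | Negz n => x ^- n.+1 end.

Lemma zpowS x e : zpow x (e + 1)%R = zpow x e * x.
Proof.
case: e => n; first by rewrite -PoszD addn1 /= expgSr.
rewrite NegzE -addn1 PoszD GRing.opprD GRing.subrK.
case: n => [|n] /=; first by rewrite mulVg.
by rewrite addn0 [in RHS]expgS invgM mulgVK.
Qed.
Lemma zpowP x e : zpow x (e - 1)%R = zpow x e * x^-1.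
Proof. by rewrite -{2}[e](GRing.subrK 1%R) zpowS mulgK. Qed.
Lemma zpowD x e f : zpow x (e + f)%R = zpow x e * zpow x f.
Proof.
elim/int_ind: f => [|n IH|n IH].
- by rewrite GRing.addr0 mulg1.
- by rewrite -addn1 PoszD GRing.addrA !zpowS IH mulgA.
- by rewrite -addn1 PoszD GRing.opprD GRing.addrA !zpowP IH mulgA.
Qed.
Lemma zpowN x e : zpow x (- e)%R = (zpow x e)^-1.
Proof.
apply/eqP; rewrite -mulg_eq1 -zpowD GRing.addNr //.
Qed.
Lemma zpowXn x e n : zpow x e ^+ n = zpow x (e * n%:Z)%R.
Proof.
elim: n => [|n IH]; first by rewrite GRing.mulr0.
by rewrite expgSr IH -addn1 PoszD GRing.mulrDr GRing.mulr1 zpowD.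
Qed.
Lemma zpow_nat x n e : zpow (x ^+ n) e = zpow x (n%:Z * e)%R.
Proof.
case: e => k; first by rewrite -PoszM /= expgnA.
by rewrite NegzE zpowN /= -expgnA GRing.mulrN zpowN -PoszM.
Qed.
Lemma subgroup_zpow H x e : is_subgroup H -> H x -> H (zpow x e).
Proof. by move=> sH Hx; case: e => n /=; [|apply: subgroupV => //]; apply: subgroupX. Qed.
Lemma lenle_substJ X Y k y n g : (forall x, X x -> lenle Y k (x ^ y)) ->
  lenle X n g -> lenle Y (n * k) (g ^ y).
Proof.
move=> XY [w [Xw wn <-]]; rewrite conjg_prod; apply: (@lenleW _ _ (size w * k)).
  by rewrite leq_mul.
apply: lenle_prod => x /Xw[/XY//|/XY/lenleV]; by rewrite conjVg invgK.
Qed.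

(* Locked, so that [gen s g] is not seen as the product type it unfolds to. *)
Definition gen s : set G := locked (generated [set` s]).
Notation len s := (lenle [set` s]).

Lemma genE s : gen s = generated [set` s]. Proof. by rewrite /gen -lock. Qed.

Lemma is_subgroup_gen s : is_subgroup (gen s).
Proof. by rewrite genE; exact: is_subgroup_generated. Qed.

Lemma mem_gen s x : x \in s -> gen s x.
Proof. by rewrite genE => xs; exact: sub_generated. Qed.

Lemma gen_min H s : is_subgroup H -> (forall x, x \in s -> H x) -> gen s `<=` H.
Proof. by rewrite genE => sH sHs; exact: generated_min. Qed.

Lemma genJ s H x : is_subgroup H -> (forall a, a \in s -> H (a ^ x)) ->
  forall a, gen s a -> H (a ^ x).
Proof. by rewrite genE => sH sHs a; exact: generatedJ. Qed.

Lemma gen_nil x : gen [::] x -> x = 1.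
Proof. by move=> gx; apply: (gen_min (is_subgroup1 G) _ gx). Qed.

Lemma gen_len s g : gen s g -> exists n, len s n g.
Proof. by rewrite genE; exact: generated_lenle. Qed.

Lemma len_gen s n g : len s n g -> gen s g.
Proof. by rewrite genE; exact: lenle_generated. Qed.

(** * Central sequences and polynomial distortion *)

Fixpoint cseq H s : Prop := if s is a :: s' then
  [/\ H a, forall x, H x -> gen s' [~ a, x] & cseq H s'] else True.

Lemma gen_cons a s g : gen s g -> gen (a :: s) g.
Proof.
apply: gen_min; first exact: is_subgroup_gen.
by move=> x xs; apply: mem_gen; rewrite inE xs orbT.
Qed.

Lemma gen_head a s : gen (a :: s) a.
Proof. by apply: mem_gen; rewrite mem_head. Qed.

Lemma len_cons a s n g : len s n g -> len (a :: s) n g.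
Proof.
move=> [w [sw wn E]]; exists w; split=> // x /sw[] /= xs; [left|right];
by rewrite inE xs orbT.
Qed.

Lemma cseqJ H s x g : is_subgroup H -> cseq H s -> H x -> gen s g -> gen s (g ^ x).
Proof.
move=> sH; elim: s g => [|a s IH] g cs Hx; apply: genJ => //;
  do ?exact: is_subgroup_gen; move=> b.
case: cs => Ha comm cs; have sG := is_subgroup_gen (a :: s).
rewrite inE => /orP[/eqP->|bs].
  rewrite -[a ^ x](mulVKg a) -(commgEl a x).
  by apply: (subgroupM sG (gen_head a s)); apply/gen_cons/comm.
by apply: gen_cons; apply: IH => //; apply: mem_gen.
Qed.

Lemma leq_exp2rW m n c : m <= n -> m ^ c <= n ^ c.
Proof. by case: c => // c; rewrite leq_exp2r. Qed.

Lemma expn_ge n c : c.+1 <= (n + 2) ^ c.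
Proof. by apply: leq_trans (ltn_expl c (isT : 1 < 2)) _; rewrite leq_exp2rW // addn2. Qed.

(** [a ^ (x ^+ k.+1)] is [a ^ (x ^+ k)] times [[~ a, x] ^ (x ^+ k)]. The second factor has
    polynomial length by induction along the sequence, and the summation over the exponents only
    raises the degree. *)
Lemma conj_growth H s x : is_subgroup H -> cseq H s -> H x ->
  exists C, forall k b, b \in s -> len s ((k + 2) ^ C) (b ^ (x ^+ k)).
Proof.
move=> sH; elim: s => [|a s IH] cs Hx; first by exists 0%N.
case: cs => Ha comm cs; have [C HC] := IH cs Hx.
have [l Hl] := gen_len (comm x Hx).
have step k : len s (l * (k + 2) ^ C) ([~ a, x] ^ (x ^+ k)).
  by apply: lenle_substJ Hl => b; apply: HC.
have ha k : len (a :: s) (1 + k * (l * (k + 2) ^ C)) (a ^ (x ^+ k)).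
  elim: k => [|k IHk]; first by rewrite conjg1; apply: lenle_gen; rewrite /= mem_head.
  rewrite expgS conjgM -[a ^ x](mulVKg a) -(commgEl a x) conjMg mulSn addnCA addnC.
  apply: lenleM; last first.
    apply: lenleW (len_cons _ (step k)); rewrite leq_mul // leq_exp2rW; lia.
  by apply: lenleW IHk; rewrite leq_add2l leq_mul // leq_mul // leq_exp2rW; lia.
exists (C + l + 1) => k b; rewrite inE => /orP[/eqP->|bs]; last first.
  by apply: lenleW (len_cons _ (HC k b bs)); rewrite leq_exp2l; lia.
apply: lenleW (ha k); rewrite !expnD expn1.
have E := expn_ge k l; have P : 0 < (k + 2) ^ C by rewrite expn_gt0 addn2.
nia.
Qed.

Lemma leq_poly_add (n a b : nat) : (n + 2) ^ a + (n + 2) ^ b <= (n + 2) ^ (a + b + 1).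
Proof.
rewrite !expnD expn1.
have pa : 0 < (n + 2) ^ a by rewrite expn_gt0 addn2.
have pb : 0 < (n + 2) ^ b by rewrite expn_gt0 addn2.
nia.
Qed.

Lemma leq_poly_comp (n a b : nat) : ((n + 2) ^ a + 2) ^ b <= (n + 2) ^ ((a + 2) * b).
Proof.
rewrite expnM; apply: leq_exp2rW; rewrite expnD.
have pa : 0 < (n + 2) ^ a by rewrite expn_gt0 addn2.
nia.
Qed.

(** All occurrences of [a] are moved to the left. A letter of [s] that is passed by [zpow a e], with
    [|e| <= n], is replaced by a conjugate, which is polynomially long by [conj_growth]. *)
Lemma collect H a s : is_subgroup H -> cseq H (a :: s) ->
  exists C, forall n g, len (a :: s) n g ->
    exists e z, [/\ g = zpow a e * z, `|e| <= n & len s ((n + 2) ^ C) z].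
Proof.
move=> sH [Ha comm cs].
have [C1 H1] := conj_growth sH cs Ha.
have [C2 H2] := conj_growth sH cs (subgroupV sH Ha).
have hc (N : nat) b e : b \in s -> `|e| <= N -> len s ((N + 2) ^ (C1 + C2)) (b ^ zpow a e).
  case: e => k bs /= kN.
    apply: lenleW (H1 k b bs); apply: leq_trans (leq_exp2rW C1 (_ : _ <= N + 2)) _; first by lia.
    by rewrite leq_exp2l; lia.
  rewrite -expVgn; apply: lenleW (H2 _ b bs).
  apply: leq_trans (leq_exp2rW C2 (_ : _ <= N + 2)) _; first by lia.
  by rewrite leq_exp2l; lia.
exists (C1 + C2 + 1) => n g [w [Xw wn <-]].
suff [e [z [-> en lz]]] : exists e z, [/\ \prod_(x <- w) x = zpow a e * z, `|e| <= size w
    & len s (size w * (n + 2) ^ (C1 + C2)) z].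
  exists e, z; split=> //; first exact: leq_trans wn.
  apply: lenleW lz; rewrite [X in (_ <= X)%N]expnD mulnC leq_mul //; lia.
elim: w Xw wn => [|x w IH] Xw wn.
  by exists 0%R, 1; rewrite big_nil mulg1; split=> //; exact: lenle1.
have [||e [z [E ew lz]]] := IH.
- by move=> y yw; apply: Xw; rewrite inE yw orbT.
- exact: ltnW.
rewrite big_cons E /= mulSn.
have xcase : x = a \/ x = a^-1 \/ (x \in s \/ x^-1 \in s).
  case: (Xw x (mem_head _ _)) => /=; rewrite inE => /orP[/eqP|]; auto.
  by move=> xa; right; left; rewrite -xa invgK.
have lz' : len s ((n + 2) ^ (C1 + C2) + size w * (n + 2) ^ (C1 + C2)) z.
  by apply: lenleW lz; exact: leq_addl.
case: xcase => [->|[->|xs]].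
- exists (1 + e)%R, z; split=> //; last by lia.
  by rewrite zpowD mulgA.
- exists (-1 + e)%R, z; split=> //; last by lia.
  by rewrite zpowD mulgA.
exists e, (x ^ zpow a e * z); split.
- by rewrite mulgA (conjgC x) -!mulgA.
- by apply: ltnW.
apply: lenleM => //.
have en : `|e| <= n by apply: leq_trans ew (ltnW wn).
case: xs => xs; first exact: hc.
by rewrite -[x]invgK conjVg; apply: lenleV; exact: hc.
Qed.

Lemma gen_split H a s g : is_subgroup H -> cseq H (a :: s) -> gen (a :: s) g ->
  exists e z, g = zpow a e * z /\ gen s z.
Proof.
move=> sH cs /gen_len[n lg]; have [C HC] := collect sH cs.
by have [e [z [-> _ /len_gen gz]]] := HC _ _ lg; exists e, z.
Qed.

Lemma gen_zpow_abs s a e : gen s (zpow a e) -> gen s (a ^+ `|e|).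
Proof.
case: e => k //= gk; have := subgroupV (is_subgroup_gen s) gk; rewrite invgK //.
Qed.

Lemma order_mod s a : (forall m, gen s (a ^+ m) -> m = 0%N) \/
  exists q, [/\ 0 < q, gen s (a ^+ q) & forall m, gen s (a ^+ m) -> q %| m].
Proof.
have sS := is_subgroup_gen s.
case: (pselect (exists q, (0 < q) && `[< gen s (a ^+ q) >])) => [ex|nex]; last first.
  by left=> m gm; case: m gm => // m gm; case: nex; exists m.+1; apply/asboolP.
right; case: (ex_minnP ex) => q /andP[q0 /asboolP gq] qmin; exists q; split=> // m gm.
rewrite /dvdn; case: (posnP (m %% q)) => [/eqP//|mq].
have /qmin : (0 < m %% q) && `[< gen s (a ^+ (m %% q)) >]; last by rewrite leqNgt ltn_mod q0.
rewrite mq /=; apply/asboolP.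
have -> : a ^+ (m %% q) = (a ^+ q ^+ (m %/ q))^-1 * a ^+ m.
  by rewrite [X in _ = _ * (a ^+ X)](divn_eq m q) expgnDr [in RHS]mulnC expgnA mulKg.
by apply: subgroupM => //; apply: subgroupV => //; apply: subgroupX.
Qed.

(** Such an exponent [m] is 0 or a multiple of the order [q] of [a] modulo [gen s], and [a ^+ q] is
    one fixed element. *)
Lemma pow_len s a : exists l, forall m, gen s (a ^+ m) -> len s (m * l) (a ^+ m).
Proof.
case: (order_mod s a) => [z|[q [q0 gq dq]]].
  by exists 0%N => m /z->; exact: lenle1.
have [l Hl] := gen_len gq; exists l => m /dq/dvdnP[k ->].
have := lenleX k Hl; rewrite -expgnA (mulnC q); apply: lenleW; nia.
Qed.

Lemma gen_cat s1 s2 g : gen s2 g -> gen (s1 ++ s2) g.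
Proof. by elim: s1 => //= a s1 IH /IH; exact: gen_cons. Qed.

Lemma cseq_cat H s1 s2 : cseq H (s1 ++ s2) -> cseq H s2.
Proof. by elim: s1 => //= a s1 IH [_ _]. Qed.

(** Generators are removed one at a time: after collection, the power of [a] lies in the subgroup of
    the remaining generators because [g] and [z] do, and [pow_len] bounds its length there linearly
    in the exponent. *)
Lemma distortion H s1 s2 : is_subgroup H -> cseq H (s1 ++ s2) ->
  exists C, forall n g, gen s2 g -> len (s1 ++ s2) n g -> len s2 ((n + 2) ^ C) g.
Proof.
move=> sH; elim: s1 => [|a s1 IH] cs.
  by exists 1%N => n g _; apply: lenleW; rewrite expn1 leq_addr.
have [C' HC'] := IH (let: And3 _ _ h := cs in h).
have [C HC] := collect sH cs.
have [l Hl] := pow_len (s1 ++ s2) a.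
exists ((C + l.+1 + 1 + 2) * C')%N => n g g2 /HC[e [z [E en lz]]].
have sS := is_subgroup_gen (s1 ++ s2).
have ge : gen (s1 ++ s2) (zpow a e).
  have -> : zpow a e = g * z^-1 by rewrite E mulgK.
  apply: subgroupM => //; first exact: gen_cat.
  by apply: subgroupV => //; exact: len_gen lz.
have le : len (s1 ++ s2) (n * l) (zpow a e).
  have := Hl _ (gen_zpow_abs ge); case: e en ge {E} => k /= kn _ h.
    by apply: lenleW h; rewrite leq_mul.
  by apply: lenleV; apply: lenleW h; rewrite leq_mul.
have lg : len (s1 ++ s2) ((n + 2) ^ (C + l.+1 + 1)) g.
  rewrite E; apply: lenleW (lenleM le lz).
  apply: leq_trans (leq_poly_add _ _ _); rewrite addnC leq_add2l expnS leq_mul ?leq_addr //.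
  by apply: leq_trans (expn_ge n l).
by apply: lenleW (HC' _ _ g2 lg); exact: leq_poly_comp.
Qed.

Lemma pow_mod N x z k : is_subgroup N -> (forall n, N n -> N (n ^ x)) -> N z ->
  exists2 z', N z' & (x * z) ^+ k = x ^+ k * z'.
Proof.
move=> sN Nx Nz; elim: k => [|k [z' Nz' IH]].
  by exists 1; [exact: subgroup1|rewrite mulg1].
exists (z' ^ x * z); first by apply: subgroupM => //; apply: Nx.
by rewrite !expgSr IH !mulgA; congr (_ * _); rewrite -!mulgA -(conjgC z' x).
Qed.

(** [T] is the product of the finite orders of the elements of [s1], each taken modulo the suffix
    behind it. An element of infinite order contributes nothing: the [k]-th power having exponent 0
    at this element forces exponent 0 already for [g ^+ T]. *)
Lemma torsion_exp H s1 s2 : is_subgroup H -> cseq H (s1 ++ s2) ->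
  (forall x, H x -> gen (s1 ++ s2) x) ->
  exists2 T, 0 < T & forall g k, H g -> 0 < k -> gen s2 (g ^+ k) -> gen s2 (g ^+ T).
Proof.
move=> sH; elim/last_ind: s1 s2 => [|s1 a IH] s2 cs Hs.
  by exists 1%N => // g k /Hs.
rewrite cat_rcons in cs Hs; have [T T0 HT] := IH _ cs Hs.
have c2 := cseq_cat cs; have [Ha comm c2'] := c2.
have sS := is_subgroup_gen s2.
have split_pow g e z k : gen s2 z -> g = zpow a e * z -> 
    exists2 z', gen s2 z' & g ^+ k = zpow a (e * k%:Z)%R * z'.
  move=> gz ->; rewrite -zpowXn; apply: pow_mod => // n gn.
  by apply: cseqJ c2' _ gn => //; exact: subgroup_zpow.
case: (order_mod s2 a) => [z0|[q [q0 gq _]]].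
  exists T => // g k Hg k0 gk; have gT := HT g k Hg k0 (gen_cons _ gk).
  have [e [z [E gz]]] := gen_split sH c2 gT.
  have [z' gz' E'] := split_pow _ _ _ k gz E.
  have : gen s2 (zpow a (e * k%:Z)%R).
    have -> : zpow a (e * k%:Z)%R = (g ^+ k) ^+ T * z'^-1.
      by rewrite -expgnA mulnC expgnA E' mulgK.
    by apply: subgroupM; [|apply: subgroupX|apply: subgroupV].
  move=> /gen_zpow_abs/z0 ek; have e0 : e = 0%R by lia.
  by rewrite E e0 mul1g.
exists (T * q)%N; first by rewrite muln_gt0 T0.
move=> g k Hg k0 gk; have gT := HT g k Hg k0 (gen_cons _ gk).
have [e [z [E gz]]] := gen_split sH c2 gT.
have [z' gz' E'] := split_pow _ _ _ q gz E.
rewrite expgnA E'; apply: subgroupM => //.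
by rewrite GRing.mulrC -zpow_nat; apply: subgroup_zpow.
Qed.

(** The representatives are the ordered products of powers with exponents below [m]. Reducing an
    exponent modulo [m] splits off a power of an [m]-th power, and its conjugates stay in [P]. *)
Lemma cover_pow H P s m : is_subgroup H -> is_subgroup P -> cseq H s -> 0 < m ->
  (forall x, H x -> P (x ^+ m)) -> (forall p x, P p -> H x -> P (p ^ x)) ->
  exists r : seq G, [/\ size r = (m ^ size s)%N, forall t, t \in r -> H t &
    forall g, gen s g -> exists2 t, t \in r & P (t^-1 * g)].
Proof.
move=> sH sP cs m0 Pm PJ; elim: s cs => [|a s IH] cs.
  exists [:: 1]; split=> // [t|g]; first by rewrite inE => /eqP->; exact: subgroup1.
  by move=> /gen_nil->; exists 1; rewrite ?inE // mulg1 invg1; exact: subgroup1.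
have [Ha comm cs'] := cs; have [r [sr Hr cr]] := IH cs'.
exists [seq a ^+ i * t | i <- iota 0 m, t <- r]; split.
- by rewrite size_allpairs size_iota sr /= expnS.
- move=> _ /allpairsP[[i t] [_ tr ->]] /=; apply: subgroupM; [|apply: subgroupX|apply: Hr] => //.
move=> g /(gen_split sH cs)[e [z [-> gz]]]; have [t tr Ptz] := cr z gz.
have [i [q [im Ee]]] : exists i q, i < m /\ e = (i%:Z + m%:Z * q)%R.
  exists `|(e %% m%:Z)%Z|%N, (e %/ m%:Z)%Z; have mz : (m%:Z != 0)%R by lia.
  have h1 := modz_ge0 e mz; have h2 := ltz_mod e mz.
  by split; [lia|rewrite {1}(divz_eq e m%:Z) gez0_abs // GRing.addrC GRing.mulrC].
exists (a ^+ i * t); first by apply/allpairsP; exists (i, t); rewrite mem_iota.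
have -> : (a ^+ i * t)^-1 * (zpow a e * z) = zpow (a ^+ m) q ^ t * (t^-1 * z).
  by rewrite Ee zpowD -zpow_nat /= /conjg invgM !gnorm.
apply: subgroupM => //; apply: PJ; last exact: Hr.
by apply: subgroup_zpow => //; apply: Pm.
Qed.

Lemma commgMr_eq x y z : [~ x, y * z] = [~ x, z] * [~ x, y] ^ z.
Proof. by rewrite /commg /conjg !gnorm. Qed.

Lemma commgV_eq x y : [~ x, y^-1] = ([~ x, y] ^ y^-1)^-1.
Proof. by rewrite /commg /conjg !gnorm. Qed.

Lemma subgroup_comm H N a : is_subgroup H -> is_subgroup N ->
  (forall n x, N n -> H x -> N (n ^ x)) ->
  is_subgroup [set x | H x /\ N [~ a, x]].
Proof.
move=> sH sN NJ; split=> [|x y [Hx Nx] [Hy Ny]|x [Hx Nx]] /=.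
- by rewrite commg1; split; exact: subgroup1.
- rewrite commgMr_eq; split; first exact: subgroupM.
  by apply: subgroupM => //; apply: NJ.
- rewrite commgV_eq; split; first exact: subgroupV.
  by apply: subgroupV => //; apply: NJ => //; apply: subgroupV.
Qed.

(** [Y] is followed by its commutators with [Y], these by their commutators with [Y], and so on
    until the lower central series ends. Commutators with generators are enough, since the elements
    centralizing [a] modulo a normal subgroup form a subgroup. *)
Lemma nilpotent_cseq H (Y : seq G) : is_subgroup H -> is_nilpotent H ->
  (forall y, y \in Y -> H y) -> (forall x, H x -> gen Y x) ->
  exists s, cseq H (Y ++ s).
Proof.
move=> sH [c Lc] HY YH.
suff main k i (C : seq G) : (i + k = c)%N -> (forall a, a \in C -> lower_central H i a) ->
    exists s, cseq H (C ++ s) by apply: (main c 0%N).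
elim: k i C => [|k IH] i C.
  rewrite addn0 => ->; rewrite Lc => HC; exists [::]; rewrite cats0.
  elim: C HC => //= a C IH HC; have -> : a = 1 by apply: HC; rewrite mem_head.
  split; [exact: subgroup1| |by apply: IH => b bC; apply: HC; rewrite inE bC orbT].
  by move=> x _; rewrite comm1g; exact: subgroup1 (is_subgroup_gen _).
rewrite addnS -addSn => ik HC.
have [|s' cs'] := IH i.+1 [seq [~ a, y] | a <- C, y <- Y] ik.
  by move=> _ /allpairsP[[a y] /= [aC yY ->]]; apply: lower_centralR; [exact: HC|exact: HY].
set s := _ ++ s' in cs'; exists s.
have comm a y : a \in C -> y \in Y -> gen s [~ a, y].
  move=> aC yY; apply: mem_gen; rewrite mem_cat; apply/orP; left.
  by apply/allpairsP; exists (a, y).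
have {}cs' : cseq H s by [].
clearbody s; elim: C HC comm {IH} => [//|a C IH] HC comm.
have {}IH : cseq H (C ++ s).
  apply: IH => // [b bC|b y bC yY]; [apply: HC|apply: comm => //]; by rewrite inE bC orbT.
have sS := is_subgroup_gen (C ++ s).
have Ha : H a by apply: (@lower_central_sub _ i) => //; apply: HC; rewrite mem_head.
split=> // x Hx.
suff [] : [set x | H x /\ gen (C ++ s) [~ a, x]] x by [].
apply: (@gen_min _ Y) (YH _ Hx).
  by apply: subgroup_comm => // n z gn Hz; apply: cseqJ IH _ gn.
move=> y yY; split; first exact: HY.
by apply: gen_cat; apply: comm => //; rewrite mem_head.
Qed.

(** * Subgroups generated by powers *)

Lemma expg_mod_central N K x w m : is_subgroup N -> is_subgroup K ->
  (forall k y, K k -> N y -> K (k ^ y)) -> N x -> N w ->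
  (forall y, N y -> K [~ w, y]) ->
  exists2 k, K k & x ^+ m * w ^+ m = (x * w) ^+ m * k.
Proof.
move=> sN sK KJ Nx Nw Kw; elim: m => [|m [k Kk IH]].
  by exists 1; [exact: subgroup1|].
exists ([~ (x * w) ^+ m, w] * k ^ w).
  apply: subgroupM; [by []| |exact: KJ].
  rewrite -invgR; apply: subgroupV => //; apply: Kw; apply: subgroupX => //; exact: subgroupM.
have -> : x ^+ m.+1 * w ^+ m.+1 = x * (x ^+ m * w ^+ m) * w.
  by rewrite expgS expgSr !mulgA.
rewrite IH expgS; set u := _ ^+ m; rewrite /commg /conjg !gnorm //.
Qed.

(** Induction through the subgroup [M] generated by the [m]-th powers. The error term left over by
    [M] lies in [lower_central M i], whose elements are [m]-th powers from [lower_central N i]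
    modulo the next term; such a power is central modulo that term and merges with [y ^+ m]. *)
Lemma power_lower_central N i m h : is_subgroup N ->
  generated [set x ^+ (m ^ i) | x in N] h ->
  exists y z, [/\ N y, lower_central N i z & h = y ^+ m * z].
Proof.
elim: i N h => [|i IH] N h sN gh.
  exists 1, h; rewrite expg1n mul1g; split=> //; first exact: subgroup1.
  by apply: generated_min gh => // _ [x Nx <-].
pose M := generated [set x ^+ m | x in N].
have sM : is_subgroup M by exact: is_subgroup_generated.
have MN : M `<=` N by apply: generated_min => // _ [x Nx <-]; exact: subgroupX.
have {gh} : generated [set x ^+ (m ^ i) | x in M] h.
  apply: generatedS gh => _ [x Nx <-]; rewrite expnS expgnA; exists (x ^+ m) => //.
  by apply: sub_generated; exists x.
move=> /(IH M h sM)[y [z [My Lz ->]]] {IH h}.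
set L := lower_central N i; set K := lower_central N i.+1.
have sL : is_subgroup L by exact: is_subgroup_lower_central.
have sK : is_subgroup K by exact: is_subgroup_lower_central.
have LN : L `<=` N by exact: lower_central_sub.
have KL : K `<=` L by exact: lower_central_desc.
have KJ k x : K k -> N x -> K (k ^ x) by exact: lower_centralJ.
have KR w x : L w -> N x -> K [~ w, x] by exact: lower_centralR.
pose W := [set z | exists w v, [/\ L w, K v & z = w ^+ m * v]].
have sW : is_subgroup W.
  split=> [|_ _ [w [v [Lw Kv ->]]] [w' [v' [Lw' Kv' ->]]]|_ [w [v [Lw Kv ->]]]].
  - by exists 1, 1; rewrite expg1n mul1g; split=> //; exact: subgroup1.
  - have [|||k Kk E] := @expg_mod_central N K w w' m sN sK KJ.
    + exact: LN.
    + exact: LN.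
    + by move=> x; exact: KR.
    exists (w * w'), (k * v ^ (w' ^+ m) * v'); split; first exact: subgroupM.
      apply: (subgroupM sK _ Kv'); apply: (subgroupM sK Kk); apply: KJ => //.
      by apply: LN; exact: subgroupX.
    by rewrite !mulgA -E /conjg !gnorm.
  - exists w^-1, (v^-1 ^ (w ^- m)); split; first exact: subgroupV.
      apply: KJ; first exact: (subgroupV sK).
      by apply: LN; apply: subgroupV => //; exact: subgroupX.
    by rewrite expVgn /conjg !gnorm.
have KW v : K v -> W v.
  by move=> Kv; exists 1, v; rewrite expg1n mul1g; split=> //; exact: subgroup1.
have [w [v [Lw Kv ->]]] : W z.
  case Ei : i Lz => [|j].
    apply: generated_min => // _ [x Nx <-]; exists x, 1; rewrite mulg1; split=> //.
      by rewrite /L Ei.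
    exact: subgroup1.
  apply: generated_min => // _ [p Mp [b Mb <-]].
  have Np : lower_central N j p by exact: lower_centralS Mp.
  have LR x : N x -> L [~ p, x] by rewrite /L Ei; exact: lower_centralR.
  (* Commutation with [p] is multiplicative modulo [K], so it is enough to treat the generators
     [x ^+ m] of [M], where [[~ p, x ^+ m]] agrees with [[~ p, x] ^+ m] modulo [K]. *)
  suff [] : [set b | N b /\ W [~ p, b]] b by [].
  have WR b' t : N b' -> N t -> W [~ p, b'] -> W ([~ p, b'] ^ t).
    move=> Nb Nt Wb; rewrite -[_ ^ t](mulVKg [~ p, b']) -(commgEl _ t).
    by apply: (subgroupM sW Wb); apply: KW; apply: KR (LR _ Nb) Nt.
  apply: generated_min Mb.
    split=> [|x t [Nx Wx] [Nt Wt]|x [Nx Wx]] /=.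
    - by rewrite commg1; split; exact: subgroup1.
    - by rewrite commgMr_eq; split; [exact: subgroupM|apply: subgroupM => //; exact: WR].
    - rewrite commgV_eq; split; first exact: subgroupV.
      by apply: subgroupV => //; apply: WR => //; exact: subgroupV.
  move=> _ [x Nx <-]; split; first exact: subgroupX.
  suff [v Kv ->] : exists2 v, K v & [~ p, x ^+ m] = [~ p, x] ^+ m * v.
    by exists [~ p, x], v; split=> //; exact: LR.
  have Lpx := LR _ Nx.
  elim: (m) => [|k [v Kv E]]; first by exists 1; rewrite ?commg1 ?mulg1 //; exact: subgroup1.
  exists (v ^ [~ p, x] * [~ [~ p, x], x ^+ k]).
    apply: (subgroupM sK); first by apply: KJ => //; exact: LN.
    by apply: KR => //; exact: subgroupX.
  rewrite [x ^+ k.+1]expgS commgMr_eq E [in RHS]expgSr.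
  by set c := [~ p, x]; rewrite /commg /conjg !gnorm.
have [|||k Kk E] := @expg_mod_central N K y w m sN sK KJ.
- exact: MN.
- exact: LN.
- by move=> x; exact: KR.
exists (y * w), (k * v); split.
- by apply: subgroupM => //; [exact: MN|exact: LN].
- exact: (subgroupM sK Kk Kv).
- by rewrite !mulgA E.
Qed.
End Nilpotent.

(** * Quotients detecting elements of virtually nilpotent groups *)

Lemma expn2_le_central_bin m : 2 ^ m <= 'C(m.*2, m).
Proof.
elim: m => [//|m IH]; rewrite doubleS binS.
have -> : 'C(m.*2.+1, m.+1) = 'C(m.*2.+1, m) by rewrite -bin_sub; [congr 'C(_, _)|]; lia.
have : 'C(m.*2, m) <= 'C(m.*2.+1, m) by case: (m) => [//|k]; rewrite binS leq_addr.
rewrite expnS; lia.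
Qed.

(* If [e] is divisible by [1, ..., n], then [e] times any entry of the first [n] rows of
   Leibniz' harmonic triangle is an integer. *)
Lemma leibniz_triangle_dvdn e n k : (forall m, 0 < m <= n.+1 -> m %| e) -> k <= n ->
  n.+1 * 'C(n, k) %| e.
Proof.
elim: k n => [|k IH] n He kn; first by rewrite bin0 muln1; apply: He; rewrite ltnS leqnn.
case: n kn He => [//|n] kn He.
have /dvdnP[A EA] := IH n.+1 He (ltnW kn).
have /dvdnP[B EB] : n.+1 * 'C(n, k) %| e.
  by apply: IH => // m /andP[m0 mn]; apply: He; rewrite m0 (leq_trans mn).
have E1 := mul_bin_left n.+1 k.
have E2 : n.+1 * 'C(n, k) = (n.+1 - k) * 'C(n.+1, k).
  by have := mul_bin_diag n.+1 k; rewrite -E1 /= => ->.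
have c0 : 0 < 'C(n.+1, k) by rewrite bin_gt0 ltnW.
rewrite E2 in EB; set d := n.+1 - k in E1 E2 EB; set c := 'C(n.+1, k) in EA EB E1 E2 c0.
have d0 : 0 < d by rewrite /d; lia.
have AB : A * n.+2 = B * d by apply/eqP; rewrite -(eqn_pmul2r c0); apply/eqP; lia.
apply/dvdnP; exists (B - A); apply/eqP; rewrite -(eqn_pmul2r (ltn0Sn k)); apply/eqP.
have -> : (B - A) * (n.+2 * 'C(n.+1, k.+1)) * k.+1 = (B - A) * n.+2 * (k.+1 * 'C(n.+1, k.+1)) by nia.
rewrite E1 !mulnBl AB EB.
have -> : k.+1 = n.+2 - d by rewrite /d; lia.
nia.
Qed.

(** If all of 1, ..., 2M + 1 divided [e], so would 2M + 1 times the central binomial coefficient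
    ['C(M.*2, M)], which is at least [2 ^ M]. *)
Lemma small_nondivisor e M : 0 < e -> e < 2 ^ M -> exists m, [/\ 0 < m, m <= M.*2.+1 & ~~ (m %| e)].
Proof.
move=> e0 eM; apply: contrapT => no.
have dv m : 0 < m <= M.*2.+1 -> m %| e.
  by move=> /andP[m0 mM]; apply: contrapT => /negP nd; apply: no; exists m.
have := leibniz_triangle_dvdn dv (_ : M <= M.*2); rewrite -addnn leq_addr => /(_ isT).
move=> /(dvdn_leq e0); have := expn2_le_central_bin M; rewrite -addnn; nia.
Qed.

Section FastGrowth.
Local Open Scope group_scope.
Variable G : groupType.
Implicit Types (H K N A X : set G) (g h x y a : G) (s : seq G).

(** An element of this subgroup is a power [y ^+ (T * m)] by [power_lower_central]. The factor [T]
    forces [y ^+ T] into [gen (b :: s2)]; if [f] is its exponent at [b], comparison modulo [gen s2]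
    puts [zpow b (e - f * m)] into [gen s2], which is excluded. *)
Lemma verbal_detects K s1 b s2 c T m e z :
  is_subgroup K -> cseq K (s1 ++ b :: s2) -> lower_central K c = [set 1] ->
  (forall g k, K g -> 0 < k -> gen (b :: s2) (g ^+ k) -> gen (b :: s2) (g ^+ T)) ->
  0 < T -> 0 < m -> gen s2 z ->
  (forall f, ~ gen s2 (zpow b (e - f * m%:Z)%R)) ->
  ~ generated [set x ^+ ((T * m) ^ c) | x in K] (zpow b e * z).
Proof.
move=> sK cs Kc HT T0 m0 gz nob gP.
have [y [w [Ky Lw E]]] := power_lower_central sK gP.
have {Lw} w1 : w = 1 by move: Lw; rewrite Kc.
rewrite {}w1 mulg1 in E.
have cs2 := cseq_cat cs; have [Kb _ cs2'] := cs2.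
have s2S := is_subgroup_gen s2.
have yT : gen (b :: s2) (y ^+ T).
  apply: (HT _ (T * m)%N) => //; first by rewrite muln_gt0 T0.
  rewrite -E; apply: subgroupM; [exact: is_subgroup_gen| |exact: gen_cons].
  by apply: subgroup_zpow; [exact: is_subgroup_gen|exact: gen_head].
have [f [v [Ew gw]]] := gen_split sK cs2 yT.
have [|w' gw' E'] := @pow_mod _ (gen s2) (zpow b f) v m s2S _ gw.
  by move=> n gn; apply: cseqJ cs2' _ gn => //; exact: subgroup_zpow.
apply: (nob f).
have -> : zpow b (e - f * m%:Z)%R = w' * z^-1.
  rewrite GRing.addrC zpowD zpowN -zpowXn.
  have -> : zpow b e = y ^+ (T * m) * z^-1 by rewrite -E mulgK.
  by rewrite expgnA Ew E' !mulgA mulVg mul1g.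
by apply: subgroupM => //; exact: subgroupV.
Qed.

Lemma verbal_normal K k : is_normal_subgroup K ->
  is_normal_subgroup (generated [set x ^+ k | x in K]).
Proof.
move=> [sK nK]; split; first exact: is_subgroup_generated.
move=> x y; apply: generatedJ; first exact: is_subgroup_generated.
move=> _ [u Ku <-]; rewrite conjXg; apply: sub_generated; exists (u ^ y) => //.
exact: nK.
Qed.

Lemma verbal_index K s k r : is_normal_subgroup K -> cseq K s -> (forall x, K x -> gen s x) ->
  0 < k -> covers K r ->
  index_at_most (generated [set x ^+ k | x in K]) (size r * k ^ size s).
Proof.
move=> nK cs Ks k0 cr; have [sK _] := nK.
have [sP nP] := verbal_normal k nK.
have [|p x Pp _|r' [sr' Kr' cr']] := @cover_pow _ K _ s k sK sP cs k0.
- by move=> x Kx; apply: sub_generated; exists x.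
- exact: nP.
rewrite -sr' -(size_allpairs (fun t u => t * u)); apply: covers_index => // g.
have [t tr Kt] := cr g; have [u ur Pu] := cr' _ (Ks _ Kt).
exists (t * u); first by apply/allpairsP; exists (t, u).
by rewrite invgM -mulgA.
Qed.

Definition detects g n := exists H, [/\ is_normal_subgroup H, index_at_most H n & ~ H g].

Lemma detectsW g m n : m <= n -> detects g m -> detects g n.
Proof. by move=> mn [H [nH /(index_at_mostW mn) iH Hg]]; exists H. Qed.

(** The element is examined at the last suffix [b :: s2] whose subgroup still contains it; there its
    exponent at [b] is visible modulo a suitable [m]. *)
Lemma nilpotent_detects K s r : is_normal_subgroup K -> is_nilpotent K -> covers K r ->
  cseq K s -> (forall x, K x -> gen s x) ->
  exists a : nat, forall M g, gen s g -> g <> 1 -> lenle [set` s] (2 ^ M) g -> detects g ((M + 2) ^ a).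
Proof.
move=> nK [c Kc] cr cs Ks; have [sK _] := nK.
suff main s1 s2 : s = s1 ++ s2 -> exists a : nat, forall M g, gen s2 g -> g <> 1 ->
    lenle [set` s] (2 ^ M) g -> detects g ((M + 2) ^ a) by exact: (main [::]).
elim: s2 s1 => [|b s2 IH] s1 Es.
  by exists 0%N => M g /gen_nil.
have [|a1 H1] := IH (rcons s1 b); first by rewrite cat_rcons.
rewrite Es in cs Ks.
have [C HC] := distortion sK cs.
have cs2 := cseq_cat cs.
have [C' HC'] := collect sK cs2.
have [T T0 HT] := torsion_exp sK cs Ks.
(* If [b] has infinite order modulo [gen s2], the distortion bound makes [e] at most exponential in
   [M], and [m] is a nondivisor of [e] of size linear in [M]. Otherwise [m] is the order of [b],
   which does not depend on [g]. *)
have [D HD] : exists D, forall M g, gen (b :: s2) g -> ~ gen s2 g ->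
    lenle [set` s] (2 ^ M) g ->
    exists e z m, [/\ g = zpow b e * z, gen s2 z, 0 < m <= (M + 2) * D &
      forall f, ~ gen s2 (zpow b (e - f * m%:Z)%R)].
  have dist M g : gen (b :: s2) g -> lenle [set` s] (2 ^ M) g ->
      exists e z, [/\ g = zpow b e * z, gen s2 z & `|e| < 2 ^ ((M + 2) * C).+1].
    rewrite Es => gg /(HC _ _ gg)/HC'[e [z [E eB /len_gen gz]]]; exists e, z; split=> //.
    apply: leq_ltn_trans eB _; rewrite expnS mulSn mul1n -addn1 leq_add ?expn_gt0 //.
    rewrite expnM leq_exp2rW // expnD; have := expn_gt0 2 M; lia.
  case: (order_mod s2 b) => [ninf|[q [q0 gq _]]].
    exists (C + C + 3)%N => M g gg ng lg.
    have [e [z [E gz eB]]] := dist M g gg lg.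
    have e0 : 0 < `|e|.
      rewrite lt0n; apply/eqP=> /eqP; rewrite absz_eq0 => /eqP e0.
      by apply: ng; rewrite E e0 mul1g.
    have [m [m0 mB nd]] := small_nondivisor e0 eB.
    exists e, z, m; split=> //; first by rewrite m0 /=; lia.
    move=> f /gen_zpow_abs/ninf/eqP; rewrite absz_eq0 GRing.subr_eq0 => /eqP ef.
    by move: nd; rewrite ef abszM dvdn_mull.
  exists q => M g gg ng lg; have [e [z [E gz eB]]] := dist M g gg lg.
  exists e, z, q; split=> //; first by rewrite q0 /=; nia.
  have s2S := is_subgroup_gen s2.
  move=> f gf; apply: ng; rewrite E; apply: subgroupM => //.
  rewrite -[e](GRing.subrK (f * q%:Z)%R) zpowD; apply: subgroupM => //.
  by rewrite GRing.mulrC -zpow_nat; exact: subgroup_zpow.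
(* The summand [a1] serves elements of [gen s2]. For the others the index is at most [size r] times
   [T * m] to the power [c * size s], and [T * m] is at most [(M + 2) ^ (T + (1 + D))]. *)
exists (a1 + (size r + (T + (1 + D)) * c * size s))%N => M g gg g1 lg.
case: (pselect (gen s2 g)) => [gs2|ngs2].
  by apply: detectsW (H1 _ _ gs2 g1 lg); rewrite leq_exp2l ?leq_addr //; lia.
have [e [z [m [E gz /andP[m0 mB] nob]]]] := HD _ _ gg ngs2 lg.
exists (generated [set x ^+ ((T * m) ^ c) | x in K]); split.
- exact: verbal_normal.
- apply: index_at_mostW (verbal_index nK cs Ks _ cr); last by rewrite expn_gt0 muln_gt0 T0 m0.
  rewrite -Es expnD -[leqLHS]mul1n leq_mul ?expn_gt0 ?addn2 // -addn2.
  rewrite expnD leq_mul; [by []|exact/ltnW/expn_ge|].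
  rewrite expnM expnM; apply: leq_exp2rW; apply: leq_exp2rW.
  rewrite expnD leq_mul; [by []|exact/ltnW/expn_ge|].
  rewrite expnD expn1; apply: leq_trans mB _; rewrite leq_mul //; exact/ltnW/expn_ge.
- by rewrite E; exact: (verbal_detects sK cs Kc HT T0 m0 gz nob).
Qed.

(** Elements outside the normal nilpotent subgroup [K] are detected by [K] itself. Inside [K] the
    Schreier generators keep the length bound and extend to a central sequence. *)
Lemma virtually_nilpotent_detects X : finite_set X -> generated X = setT ->
  virtually_nilpotent G ->
  exists a : nat, forall M g, g <> 1 -> lenle X (2 ^ M) g -> detects g ((M + 2) ^ a).
Proof.
move=> finX genX [H [sH fH nH]].
have [K [nK KH fK]] := normal_core sH fH; have [sK _] := nK.
have nilK := is_nilpotentS sK KH nH.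
have [r cr] := (finite_index_covers sK).1 fK.
have [Y [KY lenY]] := schreier finX sK fK.
have KgY x : K x -> gen Y x.
  move=> Kx; have [n ln] : exists n, lenle X n x by apply: generated_lenle; rewrite genX.
  exact: len_gen (lenY _ _ Kx ln).
have [s cs] := nilpotent_cseq sK nilK KY KgY.
have Ks x : K x -> gen (Y ++ s) x.
  move/KgY; apply: gen_min; first exact: is_subgroup_gen.
  by move=> y yY; apply: mem_gen; rewrite mem_cat yY.
have [a Ha] := nilpotent_detects nK nilK cr cs Ks.
exists (a + size r)%N => M g g1 lg.
case: (pselect (K g)) => [Kg|nKg].
  apply: detectsW (Ha M g (Ks _ Kg) g1 _); first by rewrite leq_exp2l ?leq_addr //; lia.
  have [w [Yw wn E]] := lenY _ _ Kg lg; exists w; split=> // x /Yw[] /= xY; [left|right];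
  by rewrite mem_cat xY.
exists K; split=> //; apply: index_at_mostW (covers_index sK cr).
by apply: leq_trans (ltnW (expn_ge M _)) _; rewrite leq_exp2l ?leq_addl //; lia.
Qed.
End FastGrowth.

(** * Residual growth bounded by powers of the logarithm *)

Lemma exp2_dominates c k : exists2 u, 0 < u & c * u ^ k <= 2 ^ u.
Proof.
pose w := c + k + 1; exists (2 ^ (4 * w)); first by rewrite expn_gt0.
rewrite -expnM; apply: leq_trans (leq_mul (ltnW (ltn_expl c (isT : 1 < 2))) (leqnn _)) _.
rewrite -expnD leq_exp2l //.
apply: (@leq_trans (4 * (w * w))); first by rewrite /w; nia.
have w1 : 0 < w by rewrite /w addn1.
have ww : w <= 2 ^ w by apply/ltnW/ltn_expl.
have -> : 4 * w = w + w + w + w by lia.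
have w2 : 2 <= 2 ^ w by rewrite -{1}(expn1 2) leq_exp2l.
rewrite !(expnD 2 _ w); set z := 2 ^ w in ww w2 *.
have h1 : w * w <= z * z by rewrite leq_mul.
have h2 : 4 <= z * z by rewrite (@leq_mul 2 2).
by apply: leq_trans (leq_mul h2 h1) _; rewrite !mulnA.
Qed.

Section RealGrowth.
Import Order.TTheory GRing.Theory Num.Theory.
Local Open Scope ring_scope.
Variables (R : realType) (G : groupType).
Implicit Types (X : set G) (g : G).

Lemma word_length_le X g n : (word_length R X g <= n%:R%:E)%E <-> lenle X n g.
Proof.
split=> [h|[w [Xw wn Eg]]].
  apply: contrapT => nl; suff : (n.+1%:R%:E <= n%:R%:E :> \bar R)%E.
    by rewrite lee_fin ler_nat ltnn.
  apply: le_trans h; apply: le_ereal_inf_tmp => _ [m [w [Xw Eg] <-] <-].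
  rewrite lee_fin ler_nat ltnNge; apply/negP => wn; apply: nl.
  by exists w.
apply: ge_ereal_inf; exists (size w)%:R%:E; last by rewrite lee_fin ler_nat.
by exists (size w) => //; exists w.
Qed.

Lemma residual_growth_le X n N : (0 < N)%N ->
  (residual_growth R X n <= N%:R%:E)%E <->
  forall g, g <> 1%g -> lenle X n g -> detects g N.
Proof.
move=> N0; split=> [h|dN].
  apply: contrapT => nd; suff : (N.+1%:R%:E <= N%:R%:E :> \bar R)%E.
    by rewrite lee_fin ler_nat ltnn.
  apply: le_trans h; apply: le_ereal_inf_tmp => _ [m [m0 dm] <-].
  rewrite lee_fin ler_nat ltnNge; apply/negP => mN; apply: nd => g g1 lg.
  by apply: detectsW mN _; apply: dm => //; apply/word_length_le.
apply: ge_ereal_inf; exists N%:R%:E => //; exists N => //; split=> // g g1.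
by move/word_length_le; exact: dN.
Qed.

(** Both bounds are [ln (1 + x) <= x], at [x = 1] and at [x = - 2^-1]. *)
Lemma ln2_bounds : 2^-1 <= ln 2 :> R /\ ln 2 <= 1 :> R.
Proof.
split; last by have := @le_ln1Dx R 1; rewrite (_ : 1 + 1 = 2) //; apply; lra.
have := @le_ln1Dx R (- 2^-1).
rewrite (_ : 1 + - 2^-1 = 2^-1 :> R); last by lra.
by rewrite lnV ?posrE // lerNl opprK; apply; lra.
Qed.

Lemma detects_preceq X :
  (exists a : nat, forall M g, g <> 1%g -> lenle X (2 ^ M) g -> detects g ((M + 2) ^ a)) ->
  exists r : R, preceq (residual_growth R X) (log_pow r).
Proof.
(* With [k = trunc_log 2 n], the factor 8 inside the logarithm gives [k + 3 <= 2 * ln (8 * n)]; the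
   factor [2 ^ a] outside absorbs the [a]-th power of this 2. *)
move=> [a Ha]; exists a%:R; exists (8 * 2 ^ a)%N; split; first by rewrite muln_gt0 expn_gt0.
move=> n n0; exists ((ln ((8 * 2 ^ a * n)%N%:R : R)) `^ a%:R)%:E.
  by rewrite /log_pow ltNge ler0n andbF.
have /andP[kn nk] := trunc_log_bounds (isT : (1 < 2)%N) n0.
set k := trunc_log 2 n in kn nk.
have [l1 l2] := ln2_bounds.
have p0 : 0 < n%:R :> R by rewrite ltr0n.
have lnk : k%:R <= 2 * ln (n%:R : R).
  have : ln ((2 ^ k)%:R : R) <= ln (n%:R : R).
    by rewrite ler_ln ?posrE ?ltr0n ?expn_gt0 // ler_nat.
  rewrite natrX lnXn // -(mulr_natr (ln _)).
  by have : 0 <= k%:R :> R by []; nra.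
have ln8 : (k + 3)%:R <= 2 * ln ((8 * 2 ^ a * n)%N%:R : R).
  apply: (@le_trans _ _ (2 * ln ((2 ^ 3 * n)%N%:R : R))); last first.
    rewrite ler_pM2l // ler_ln ?posrE ?ltr0n ?muln_gt0 ?expn_gt0 //= ler_nat leq_mul //.
    by rewrite leq_pmulr // expn_gt0.
  rewrite natrM natrX lnM ?posrE ?exprn_gt0 // lnXn // -(mulr_natr (ln _)) natrD; nra.
have : (residual_growth R X n <= ((k.+1 + 2) ^ a)%N%:R%:E)%E.
  apply/residual_growth_le; first by rewrite expn_gt0 addn2.
  by move=> g g1 lg; apply: Ha => //; apply: lenleW lg; exact: ltnW.
move=> /le_trans; apply; rewrite -EFinM lee_fin.
set L := ln _ in ln8 *.
have L0 : 0 <= L by have : 0 <= (k + 3)%:R :> R by []; lra.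
rewrite powR_mulrn // natrX.
apply: (@le_trans _ _ ((2 * L) ^+ a)).
  by rewrite lerXn2r ?nnegrE // ?mulr_ge0 // addSn -addnS.
rewrite exprMn ler_wpM2r ?exprn_ge0 // -natrX ler_nat leq_pmull //.
Qed.

Definition slow X := forall a : nat, exists2 Q, (0 < Q)%N &
  forall g, g <> 1%g -> lenle X ((Q + 2) ^ a) g -> detects g Q.

(** With [Q = 2 ^ u] the logarithm of a constant times a fixed power of [Q + 2] is linear in [u].
    The assumed bound is therefore polynomial in [u], and is at most [2 ^ u] for a suitable [u]. *)
Lemma preceq_slow X : (exists r : R, preceq (residual_growth R X) (log_pow r)) -> slow X.
Proof.
move=> [r [C [C0 HC]]] a.
(* The real exponent [r] may be negative. The logarithm [L] below is at least 1, so its [r]-th power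
   is at most its [k]-th; the margin 2 in the exponent [a + 2] of [n] secures this for every [a]. *)
pose k := (Num.truncn `|r|).+1.
pose D := (C + 3 * (a + 2))%N.
have [u u0 uk] := exp2_dominates (C * D ^ k) k.
exists (2 ^ u)%N; first by rewrite expn_gt0.
pose n := ((2 ^ u + 2) ^ (a + 2))%N.
have n4 : (4 <= n)%N.
  apply: (@leq_trans (4 ^ (a + 2))); first by rewrite -{1}(expn1 4) leq_exp2l //; lia.
  by apply: leq_exp2rW; have := leq_exp2l 1 u (isT : (1 < 2)%N); rewrite u0; lia.
have n0 : (0 < n)%N by apply: leq_trans n4.
have [y yE Fy] := HC n n0.
suff Fn : (residual_growth R X n <= (2 ^ u)%N%:R%:E)%E.
  move=> g g1 lg; apply: ((residual_growth_le X n _).1 Fn) => //; first by rewrite expn_gt0.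
  by apply: lenleW lg; rewrite leq_exp2l; lia.
apply: (le_trans Fy).
have {yE} -> : y = ((ln ((C * n)%N%:R : R)) `^ r)%:E.
  by move: yE; rewrite /log_pow; case: ifP => // _ [].
have [l1 l2] := ln2_bounds.
set L := ln _.
have L1 : 1 <= L.
  apply: (@le_trans _ _ (ln ((2 ^ 2)%N%:R : R))).
    by rewrite natrX lnXn // mulr2n; lra.
  rewrite ler_ln ?posrE ?ltr0n ?muln_gt0 ?C0 ?n0 // ler_nat.
  by apply: leq_trans n4 _; rewrite leq_pmull.
have LD : L <= (D * u)%:R.
  apply: (@le_trans _ _ (ln ((2 ^ (C + (u + 2) * (a + 2)))%N%:R : R))).
    rewrite ler_ln ?posrE ?ltr0n ?muln_gt0 ?C0 ?n0 ?expn_gt0 // ler_nat expnD leq_mul //.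
      exact/ltnW/ltn_expl.
    rewrite expnM leq_exp2rW // expnD; have := expn_gt0 2 u; lia.
  rewrite natrX lnXn // -(mulr_natr (ln _)).
  apply: (@le_trans _ _ (C + (u + 2) * (a + 2))%:R).
    by rewrite ler_piMl.
  by rewrite ler_nat /D; nia.
rewrite -EFinM lee_fin.
apply: (@le_trans _ _ (C%:R * L ^+ k)).
  rewrite ler_pM2l ?ltr0n // -powR_mulrn ?(le_trans ler01) //.
  apply: ler_powR => //; apply: le_trans (ler_norm r) _.
  by rewrite ltW // truncnS_gt.
apply: le_trans (_ : (C * D ^ k * u ^ k)%N%:R <= _); last by rewrite ler_nat.
rewrite -mulnA -expnMn natrM natrX ler_pM2l ?ltr0n // lerXn2r ?nnegrE //.
exact: le_trans L1.
Qed.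
End RealGrowth.

(** * Relations with coefficients in {-1, 0, 1} *)

Section SmallRelations.
Import Order.TTheory GRing.Theory Num.Theory Pdiv.CommonRing Pdiv.RingMonic.
Local Open Scope ring_scope.

Lemma unity_root_of_finite_powers (K : fieldType) (x : K) (T : finType) (F : nat -> T) :
  x != 0 -> (forall n m, F n = F m -> x ^+ n = x ^+ m) -> exists2 n, (0 < n)%N & x ^+ n = 1.
Proof.
move=> x0 FP; pose f (i : 'I_#|T|.+1) := F i.
have /injectivePn[i [j ij E]] : ~~ injectiveb f.
  by apply/negP => /injectiveP/leq_card; rewrite card_ord ltnn.
wlog lij : i j ij E / (i < j)%N.
  move=> W; case: (ltngtP i j) => [lij|lji|/val_inj/eqP]; first exact: W E lij.
    by apply: (W j i) => //; rewrite eq_sym.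
  by rewrite (negPf ij).
exists (j - i)%N; first by rewrite subn_gt0.
by rewrite expfB // -(FP _ _ E) divff // expf_neq0.
Qed.

Lemma expr_rmodp_monic (K : fieldType) (x : K) (q : {poly int}) n : q \is monic ->
  (map_poly intr q).[x] = 0 ->
  x ^+ n = \sum_(i < (size q).-1) ((rmodp 'X^n q)`_i)%:~R * x ^+ i.
Proof.
move=> mq qx.
have -> : x ^+ n = (map_poly intr (rmodp 'X^n q)).[x].
  have /(congr1 (fun p => (map_poly intr p).[x])) := rdivp_eq mq 'X^n.
  by rewrite rmorphD rmorphM /= map_polyXn hornerD hornerM qx mulr0 add0r hornerXn.
rewrite (@horner_coef_wide _ (size q).-1).
  by apply: eq_bigr => i _; rewrite coef_map.
apply: leq_trans (size_poly _ _) _; rewrite -ltnS prednK ?ltn_rmodp ?monic_neq0 //.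
by rewrite lt0n size_poly_eq0 monic_neq0.
Qed.

(** [c] is a finite code of a coefficient that determines its image in [K]: a bounded integer itself
    in characteristic zero, a residue in positive characteristic. Two powers of [x] then have the
    same coded remainder and coincide. *)
Lemma unity_root_of_finite_coef (K : fieldType) (x : K) (q : {poly int})
    (T : finType) (c : int -> T) : x != 0 -> q \is monic -> (map_poly intr q).[x] = 0 ->
  (forall n m i, c (rmodp 'X^n q)`_i = c (rmodp 'X^m q)`_i ->
     ((rmodp 'X^n q)`_i)%:~R = ((rmodp 'X^m q)`_i)%:~R :> K) ->
  exists2 n, (0 < n)%N & x ^+ n = 1.
Proof.
move=> x0 mq qx cP.
apply: (@unity_root_of_finite_powers _ _ _
  (fun n => [ffun i : 'I_(size q).-1 => c (rmodp 'X^n q)`_i])) => // n m /ffunP E.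
rewrite !(expr_rmodp_monic _ mq qx); apply: eq_bigr => i _; congr (_ * _).
by apply: cP; have := E i; rewrite !ffunE.
Qed.

Definition small_poly (p : {poly int}) := p != 0 /\ forall i, `|p`_i| <= 1.

(** For [|w| >= 2] the sum of the lower powers of [|w|] is smaller than the top power, so the
    leading term cannot be cancelled. *)
Lemma small_poly_root (w : algC) p : small_poly p -> (map_poly intr p).[w] = 0 -> `|w| < 2.
Proof.
move=> [p0 pc] pw; case: (real_ltP (normr_real w) (ger0_real (ler0n algC 2))) => // w2.
have S d : \sum_(i < d) `|w| ^+ i < `|w| ^+ d.
  elim: d => [|d IH]; first by rewrite big_ord0 expr0 ltr01.
  rewrite big_ord_recr /= exprS; apply: lt_le_trans (_ : `|w| ^+ d * 2 <= _).
    by rewrite mulr_natr mulr2n ltrD2r.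
  by rewrite mulrC ler_wpM2r // exprn_ge0.
have sp : size (map_poly intr p : {poly algC}) = size p.
  by rewrite size_map_inj_poly //; exact: intr_inj.
move: pw; rewrite horner_coef sp -(prednK (_ : 0 < size p)%N); last by rewrite lt0n size_poly_eq0.
rewrite big_ord_recr /= coef_map /= -/(lead_coef p) => /eqP; rewrite addr_eq0 => /eqP E.
have : `|\sum_(i < (size p).-1) (map_poly intr p)`_i * w ^+ i| <= \sum_(i < (size p).-1) `|w| ^+ i.
  apply: le_trans (ler_norm_sum _ _ _) _; apply: ler_sum => i _.
  rewrite normrM normrX coef_map /= ler_piMl ?exprn_ge0 // -intr_norm.
  by rewrite -[1]/(1%:~R) ler_int.
rewrite E normrN normrM normrX -intr_norm => /le_lt_trans/(_ (S _)).
rewrite gtr_pMl ?exprn_gt0 ?(lt_le_trans _ w2) //.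
rewrite -[1]/(1%:~R) ltr_int; have : lead_coef p != 0 by rewrite lead_coef_eq0.
lia.
Qed.

(** Bernoulli's inequality makes the powers of a number above 1 unbounded. *)
Lemma le1_of_bounded_powers (x : algC) : 0 <= x -> (forall s, (0 < s)%N -> x ^+ s < 2) -> x <= 1.
Proof.
move=> x0 xs; case: real_leP => //; first exact: ger0_real.
rewrite -subr_gt0 => e0; set e := x - 1 in e0.
have B s : 1 + e *+ s <= x ^+ s.
  elim: s => [|s IH]; first by rewrite addr0.
  have xe : x = 1 + e by rewrite /e; ring.
  rewrite exprS mulrS {1}xe; apply: le_trans (ler_wpM2l _ IH); last by rewrite -xe.
  have -> : (1 + e) * (1 + e *+ s) = 1 + (e + e *+ s) + e * e *+ s by ring.
  by rewrite lerDl mulrn_wge0 // mulr_ge0 // ltW.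
have := archi_boundP (_ : 0 <= e^-1); rewrite invr_ge0 ltW // => /(_ isT).
set s := Num.bound _ => es.
have s0 : (0 < s)%N by rewrite -(ltr0n algC) (le_lt_trans _ es) // invr_ge0 ltW.
have := le_lt_trans (B s) (xs s s0).
rewrite -(mulr_natl e) (_ : 2 = 1 + 1) // ltrD2l.
move=> h; have := lt_trans (_ : 1 < s%:R * e) h; rewrite ltxx; apply.
by rewrite -ltr_pdivrMr // div1r.
Qed.

Lemma inord_absz_inj (B : nat) (u v : int) : `|u| <= B%:Z -> `|v| <= B%:Z ->
  inord (absz (u + B%:Z)) = inord (absz (v + B%:Z)) :> 'I_(B + B).+1 -> u = v.
Proof.
move=> uB vB /(congr1 val); rewrite /= !inordK; [|lia|lia].
lia.
Qed.

Section CharacteristicZero.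
Variables (K : fieldType) (x : K).
Hypothesis char0 : forall z : int, z%:~R = 0 :> K -> z = 0.
Let ev (q : {poly int}) : K := (map_poly intr q).[x].

Let evM p q : ev (p * q) = ev p * ev q.
Proof. by rewrite /ev rmorphM hornerM. Qed.

Let evZ z q : ev (z *: q) = z%:~R * ev q.
Proof. by rewrite /ev map_polyZ hornerZ. Qed.

Let ev0_scale z q : z != 0 -> ev (z *: q) = 0 -> ev q = 0.
Proof.
move=> z0 /eqP; rewrite evZ mulf_eq0 => /orP[/eqP/char0/eqP|/eqP//].
by rewrite (negPf z0).
Qed.

(** An integral substitute for the minimal polynomial of [x] over the rationals, determined only up
    to a rational factor. *)
Let min_vanishing f := [/\ f != 0, ev f = 0 & forall g, g != 0 -> ev g = 0 -> (size f <= size g)%N].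

Let min_vanishing_dvd f q : min_vanishing f -> ev q = 0 -> exists c g, c != 0 /\ c *: q = g * f.
Proof.
move=> [f0 ef fmin] eq.
exists (lead_coef f ^+ scalp q f), (q %/ f); split; first by rewrite expf_neq0 // lead_coef_eq0.
have E := Pdiv.Idomain.divp_eq q f.
have er : ev (q %% f) = 0.
  have := congr1 ev E; rewrite evZ eq mulr0 /ev rmorphD rmorphM hornerD hornerM.
  by rewrite -!/(ev _) ef mulr0 add0r.
rewrite E; case: (eqVneq (q %% f) 0) => [->|r0]; first by rewrite addr0.
by have := fmin _ r0 er; rewrite leqNgt ltn_modp f0.
Qed.

Let map_intr_inj (p q : {poly int}) : map_poly intr p = map_poly intr q :> {poly rat} -> p = q.
Proof. by apply: map_inj_poly => //; exact: intr_inj. Qed.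

(** Gauss's lemma: a minimal vanishing polynomial divides the monic [q] over the rationals, so an
    integral multiple of it by a rational divides [q] over the integers and has leading coefficient
    1 or -1. *)
Lemma monic_min_vanishing q : q \is monic -> ev q = 0 -> exists2 f, f \is monic & min_vanishing f.
Proof.
move=> mq eq; have q0 := monic_neq0 mq.
have [f [f0 ef fmin]] : exists f, min_vanishing f.
  pose P n := `[< exists f, [/\ f != 0, ev f = 0 & size f = n] >].
  have exP : exists n, P n by exists (size q); apply/asboolP; exists q.
  case: (ex_minnP exP) => n /asboolP[f [f0 ef <-]] nmin; exists f; split=> // g g0 eg.
  by apply: nmin; apply/asboolP; exists g.
have [c [g [c0 E]]] := min_vanishing_dvd (And3 f0 ef fmin) eq.
have : (map_poly intr f : {poly rat}) %| map_poly intr q.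
  rewrite -(@dvdpZr _ (c%:~R)) ?intr_eq0 // -map_polyZ E rmorphM.
  exact: dvdp_mull.
move=> /dvdpP_rat_int[p1 [a a0 Ea] [r Er]].
have Ef : denq a *: f = numq a *: p1.
  apply: map_intr_inj; rewrite !map_polyZ Ea scalerA; congr (_ *: _).
  by rewrite -[X in _ * X](divq_num_den a) mulrC divfK // intr_eq0 denq_neq0.
have sz : size p1 = size f.
  rewrite -(@size_scale _ (denq a) f) ?denq_neq0 // Ef size_scale // numq_eq0 //.
have ep1 : ev p1 = 0.
  apply: (@ev0_scale (numq a)); first by rewrite numq_eq0.
  by rewrite -Ef evZ ef mulr0.
have lc : lead_coef p1 * lead_coef r = 1 by rewrite -lead_coefM -Er (monicP mq).
have p10 : p1 != 0 by rewrite -size_poly_eq0 sz size_poly_eq0.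
have mv1 : min_vanishing p1 by split=> // h; rewrite sz; apply: fmin.
have [l1|lN1] : lead_coef p1 = 1 \/ lead_coef p1 = -1.
  have /eqP := congr1 absz lc; rewrite abszM muln_eq1 => /andP[/eqP]; lia.
  by exists p1 => //; apply/monicP.
exists (- p1); first by apply/monicP; rewrite lead_coefN lN1 opprK.
split; first by rewrite oppr_eq0.
  by rewrite -scaleN1r evZ ep1 mulr0.
by move=> h; rewrite size_polyN sz; apply: fmin.
Qed.

(** A nontrivial common factor with the derivative would, by Gauss's lemma, split [f] into two
    integral factors of smaller degree, one of which vanishes at [x]. *)
Lemma separable_min_vanishing f : min_vanishing f ->
  separable_poly (map_poly intr f : {poly algC}).
Proof.
move=> [f0 ef fmin].
have -> : map_poly intr f = map_poly (ratr : rat -> algC) (map_poly intr f).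
  by rewrite -map_poly_comp; apply: eq_map_poly => z /=; rewrite ratr_int.
rewrite separable_map separable_poly.unlock; set F := map_poly intr f.
have F0 : F != 0 by rewrite map_poly_eq0_id0 ?intr_eq0 ?lead_coef_eq0.
have sF : size F = size f by rewrite size_map_inj_poly //; exact: intr_inj.
have s2 : (1 < size f)%N.
  rewrite ltnNge; apply/negP => s1; move: ef; rewrite (size1_polyC s1) /ev map_polyC hornerC.
  move/char0 => f00; move: f0; rewrite (size1_polyC s1) f00 eqxx //.
have dF0 : F^`() != 0.
  apply/eqP => /(congr1 (fun p : {poly rat} => p`_(size F).-2)).
  rewrite coef_deriv coef0 -sF in s2 *; rewrite (_ : (size F).-2.+1 = (size F).-1); last by lia.
  by move/eqP; rewrite mulrn_eq0 -/(lead_coef F) lead_coef_eq0 (negPf F0); lia.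
rewrite /coprimep -dvdp1 dvdp1; apply/negPn/negP => nc.
have d0 : gcdp F F^`() != 0 by rewrite gcdp_eq0 negb_and F0.
have sd : (1 < size (gcdp F F^`()))%N.
  by move: nc d0; rewrite -size_poly_eq0; case: size => [|[]].
have := dvdp_gcdl F F^`() => /dvdpP_rat_int[p1 [a a0 Ea] [r Er]].
have sp1 : size p1 = size (gcdp F F^`()).
  by rewrite Ea size_scale // size_map_inj_poly //; exact: intr_inj.
have lt1 : (size p1 < size f)%N.
  rewrite sp1 -sF; apply: leq_ltn_trans (lt_size_deriv F0).
  by apply: dvdp_leq => //; exact: dvdp_gcdr.
have p10 : p1 != 0 by rewrite -size_poly_eq0 sp1 size_poly_eq0.
have r0 : r != 0 by apply: contraNneq f0 => r0; rewrite Er r0 mulr0.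
have ltr : (size r < size f)%N.
  by rewrite Er size_mul //; move: sd; rewrite -sp1; move: (size p1) (size r) => a' b' /=; lia.
move: ef; rewrite Er evM => /eqP; rewrite mulf_eq0 => /orP[]/eqP h.
- by have := fmin _ p10 h; rewrite leqNgt lt1.
- by have := fmin _ r0 h; rewrite leqNgt ltr.
Qed.

(* Kronecker: if all complex roots of [f] lie in the closed unit disc, the remainders of the
   powers of ['X] modulo [f] are determined by their values at the roots, hence bounded. *)
Lemma rmodp_expX_bounded f : f \is monic -> separable_poly (map_poly intr f : {poly algC}) ->
  (forall z : algC, (map_poly intr f).[z] = 0 -> `|z| <= 1) ->
  exists B : nat, forall n i, `|(rmodp 'X^n f)`_i| <= B%:Z.
Proof.
move=> mf sepf disc.
have [rs Ers] := closed_field_poly_normal (map_poly intr f : {poly algC}).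
have lf : lead_coef (map_poly intr f : {poly algC}) = 1.
  by rewrite lead_coef_map_inj ?(monicP mf) //; exact: intr_inj.
rewrite lf scale1r in Ers.
have urs : uniq rs by rewrite -separable_prod_XsubC -Ers.
have sf : size f = (size rs).+1.
  by rewrite -(size_prod_XsubC rs id) -Ers size_map_inj_poly //; exact: intr_inj.
have rt z : z \in rs -> (map_poly intr f).[z] = 0.
  by move=> zrs; apply/eqP; rewrite -rootE Ers root_prod_XsubC.
set d := size rs in sf.
pose a : 'rV[algC]_d := \row_k rs`_k.
pose V := Vandermonde d a.
have uV : V \in unitmx.
  rewrite unitmxE det_Vandermonde unitfE; apply/prodf_neq0 => i _; apply/prodf_neq0 => j ij.
  by rewrite !mxE subr_eq0 nth_uniq // gtn_eqF.
pose c n : 'rV[algC]_d := \row_i ((rmodp 'X^n f)`_i)%:~R.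
pose W := invmx V.
have cE n : c n = (\row_k (rs`_k) ^+ n) *m W.
  apply: (can_inj (mulmxK uV)); rewrite mulmxKV //; apply/rowP => k; rewrite !mxE.
  rewrite (expr_rmodp_monic n mf (rt _ (mem_nth 0 (ltn_ord k)))) sf /=.
  by apply: eq_bigr => i _; rewrite !mxE.
pose b := \sum_i \sum_k `|W k i|.
have b0 : 0 <= b by do 2!apply: sumr_ge0 => ? _.
exists (Num.bound b) => n i.
case: (ltnP i d) => [id|di]; last first.
  rewrite nth_default ?normr0 // (leq_trans _ di) // -ltnS -sf ltn_rmodp monic_neq0 //.
rewrite -(ler_int algC) intr_norm; apply: le_trans (ltW (archi_boundP b0)).
have -> : ((rmodp 'X^n f)`_i)%:~R = c n 0 (Ordinal id) by rewrite mxE.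
rewrite cE mxE; apply: le_trans (ler_norm_sum _ _ _) _.
apply: (@le_trans _ _ (\sum_k `|W k (Ordinal id)|)); last first.
  by rewrite /b [leRHS](bigD1 (Ordinal id)) //= lerDl; do 2!apply: sumr_ge0 => ? _.
apply: ler_sum => k _; rewrite normrM mxE normrX ler_piMl // exprn_ile1 //.
by apply: disc; apply: rt; exact: mem_nth.
Qed.

(** The relation for [s = 1] has leading coefficient 1 or -1 and makes [x] an algebraic integer. The
    relation for [x ^+ s] is shared by the conjugates [z] of [x], so [|z| ^+ s < 2] for every [s]
    and [|z| <= 1]; Kronecker's argument then applies. *)
Lemma unity_root_of_small_relations : x != 0 ->
  (forall s, (0 < s)%N -> exists2 p, small_poly p & (map_poly intr p).[x ^+ s] = 0) ->
  exists2 n, (0 < n)%N & x ^+ n = 1.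
Proof.
move=> x0 rel.
have [p [p0 pc] px] := rel 1%N isT; rewrite expr1 in px.
have [q mq eq] : exists2 q, q \is monic & ev q = 0.
  have lc : lead_coef p != 0 by rewrite lead_coef_eq0.
  have := pc (size p).-1; rewrite -/(lead_coef p) => lc1.
  have [l1|lN1] : lead_coef p = 1 \/ lead_coef p = -1 by lia.
    by exists p => //; apply/monicP.
  exists (- p); first by apply/monicP; rewrite lead_coefN lN1 opprK.
  by rewrite -scaleN1r evZ /ev px mulr0.
have [f mf mvf] := monic_min_vanishing mq eq.
have disc z : (map_poly intr f).[z] = 0 -> `|z : algC| <= 1.
  move=> fz; apply: le1_of_bounded_powers => // s s0.
  have [ps sps psx] := rel s s0; rewrite -normrX; apply: (small_poly_root sps).
  have h (L : fieldType) (y : L) : (map_poly intr ps).[y ^+ s] = (map_poly intr (ps \Po 'X^s)).[y].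
    by rewrite map_comp_poly horner_comp map_polyXn hornerXn.
  rewrite h in psx *; have [c [g [c0 E]]] := min_vanishing_dvd mvf psx.
  have := congr1 (fun p => (map_poly intr p).[z]) E.
  rewrite map_polyZ hornerZ rmorphM hornerM fz mulr0 => /eqP.
  by rewrite mulf_eq0 /= intr_eq0 (negPf c0) /= -h => /eqP.
have [B HB] := rmodp_expX_bounded mf (separable_min_vanishing mvf) disc.
have [_ ef _] := mvf.
apply: (@unity_root_of_finite_coef _ x f 'I_(B + B).+1 (fun z => inord (absz (z + B%:Z)))) => // n m i.
by move=> E; congr (_%:~R); apply: inord_absz_inj E.
Qed.
End CharacteristicZero.

(** In positive characteristic a single relation is already enough for the contradiction: it makes
    [x] integral over a finite ring, so [x] has finitely many powers. *)
Lemma no_small_relation (K : fieldType) (x : K) : x != 0 ->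
  (forall n, (0 < n)%N -> x ^+ n != 1) ->
  exists2 s, (0 < s)%N & forall p, small_poly p -> (map_poly intr p).[x ^+ s] != 0.
Proof.
move=> x0 nu; apply: contrapT => no.
have rel s : (0 < s)%N -> exists2 p, small_poly p & (map_poly intr p).[x ^+ s] = 0.
  move=> s0; apply: contrapT => nop; apply: no; exists s => // p sp.
  by apply/eqP => px; apply: nop; exists p.
suff [n n0 xn] : exists2 n, (0 < n)%N & x ^+ n = 1 by have := nu n n0; rewrite xn eqxx.
case: (pselect (forall z : int, z%:~R = 0 :> K -> z = 0)) => [c0|].
  exact: unity_root_of_small_relations c0 x0 rel.
move=> /existsNP[z /not_implyP[z0 zn0]].
have [N N0 EN] : exists2 N, (0 < N)%N & N%:R = 0 :> K.
  exists `|z|%N; first by rewrite absz_gt0; apply/eqP.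
  by case: z z0 {zn0} => n //=; rewrite NegzE mulrNz => /eqP; rewrite oppr_eq0 => /eqP.
have [p [p0 pc] px] := rel 1%N isT; rewrite expr1 in px.
have [q mq eq] : exists2 q, q \is monic & (map_poly intr q).[x] = 0.
  have lc : lead_coef p != 0 by rewrite lead_coef_eq0.
  have := pc (size p).-1; rewrite -/(lead_coef p) => lc1.
  have [l1|lN1] : lead_coef p = 1 \/ lead_coef p = -1 by lia.
    by exists p => //; apply/monicP.
  exists (- p); first by apply/monicP; rewrite lead_coefN lN1 opprK.
  by rewrite rmorphN hornerN px oppr0.
have red z' : z'%:~R = (z' %% N%:Z)%Z%:~R :> K.
  by rewrite {1}(divz_eq z' N%:Z) rmorphD rmorphM /= -[N%:Z%:~R]/(N%:R) EN mulr0 add0r.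
apply: (@unity_root_of_finite_coef _ x q 'I_N.-1.+1 (fun z => inord (absz (z %% N%:Z)%Z))) => // n m i.
move=> /(congr1 val).
have lt z' : (`|(z' %% N%:Z)%Z| < N)%N.
  by have := modz_ge0 z' (_ : N%:Z != 0); have := @ltz_pmod z' N%:Z; lia.
rewrite /= !inordK ?prednK // => E; rewrite red [RHS]red; congr (_%:~R).
by have := modz_ge0 (rmodp 'X^n q)`_i (_ : N%:Z != 0);
   have := modz_ge0 (rmodp 'X^m q)`_i (_ : N%:Z != 0); lia.
Qed.
End SmallRelations.

(** * Irreducible representations *)

Section LinearAlgebra.
Import GRing.Theory.
Local Open Scope ring_scope.

(** A divisor of the characteristic polynomial of least size above 1 is irreducible, and a root of
    it is adjoined. *)
Lemma exists_eigenvalue (K : fieldType) n (A : 'M[K]_n) : (0 < n)%N ->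
  exists (L : fieldType) (phi : {rmorphism K -> L}) (a : L), kermx (map_mx phi A - a%:M) != 0.
Proof.
move=> n0; pose p := char_poly A.
have sp : (1 < size p)%N by rewrite size_char_poly.
pose P k := `[< exists q : {poly K}, [/\ (1 < size q)%N, q %| p & size q = k] >].
have exP : exists k, P k by exists (size p); apply/asboolP; exists p.
case: (ex_minnP exP) => k /asboolP[q [sq qp <-]] qmin.
have irr : irreducible_poly q.
  split=> // r sr rq; have q0 : q != 0 by rewrite -size_poly_gt0 ltnW.
  have r0 : r != 0 by apply: contraTneq rq => ->; rewrite dvd0p.
  have : (size q <= size r)%N.
    apply: qmin; apply/asboolP; exists r; split=> //; last exact: dvdp_trans qp.
    by move: sr r0; rewrite -size_poly_eq0; case: size => [|[]].
  by rewrite -(dvdp_size_eqp rq) eqn_leq dvdp_leq.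
have [L _ [z rz _]] := irredp_FAdjoin irr.
exists L, (GRing.in_alg L), z.
have : root (char_poly (map_mx (GRing.in_alg L) A)) z.
  by rewrite -map_char_poly -/p; move: qp => /dvdpP[r ->]; rewrite rmorphM rootM rz orbT.
by rewrite -eigenvalue_root_char.
Qed.

(** [s] is a list whose images span a space of maximal rank. Its purpose is to replace a linear test
    over an infinite group by one over finitely many elements, which have bounded word length. *)
Lemma span_test (K : fieldType) (T : eqType) (P : T -> Prop) m (f : T -> 'rV[K]_m) :
  exists s : seq T, (forall t, t \in s -> P t) /\
    forall p (U : 'M[K]_(p, m)), (forall t, t \in s -> (f t <= U)%MS) ->
      forall x, P x -> (f x <= U)%MS.
Proof.
pose sp s : 'M[K]_m := (\sum_(t <- s) <<f t>>)%MS.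
pose Q k := `[< exists s, (forall t, t \in s -> P t) /\ \rank (sp s) = k >].
have exQ : exists k, Q k by exists (\rank (sp [::])); apply/asboolP; exists [::].
have Qm k : Q k -> (k <= m)%N by move=> /asboolP[s [_ <-]]; exact: rank_leq_row.
case: (ex_maxnP exQ Qm) => k /asboolP[s [sP <-]] smax.
exists s; split=> // p U sU x Px.
have spU : (sp s <= U)%MS.
  rewrite /sp; elim: (s) sU => [|t s' IH] sU; first by rewrite big_nil sub0mx.
  rewrite big_cons addsmx_sub genmxE sU ?mem_head // IH // => u us'.
  by apply: sU; rewrite inE us' orbT.
apply: submx_trans spU.
have : (\rank (sp (x :: s)) <= \rank (sp s))%N.
  apply: smax; apply/asboolP; exists (x :: s); split=> // t.
  by rewrite inE => /orP[/eqP->|/sP].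
rewrite /sp big_cons => rk.
have le : (\sum_(t <- s) <<f t>> <= <<f x>> + \sum_(t <- s) <<f t>>)%MS by exact: addsmxSr.
have /eqmxP e : (\sum_(t <- s) <<f t>> == <<f x>> + \sum_(t <- s) <<f t>>)%MS.
  by rewrite -(mxrank_leqif_eq le).2 eqn_leq rk mxrankS.
by rewrite e; apply: submx_trans (addsmxSl _ _); rewrite genmxE.
Qed.

Lemma span_exists (K : fieldType) (T : eqType) (P : T -> Prop) m (f : T -> 'rV[K]_m) :
  exists U : 'M[K]_m, (forall x, P x -> (f x <= U)%MS) /\
    forall p (W : 'M[K]_(p, m)), (forall x, P x -> (f x <= W)%MS) -> (U <= W)%MS.
Proof.
have [s [sP sT]] := span_test P f.
exists (\sum_(t <- s) <<f t>>)%MS; split=> [|p W PW].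
  apply: sT => t; elim: s {sP} => // t' s IH; rewrite inE big_cons => /orP[/eqP->|/IH le].
    by apply: submx_trans (addsmxSl _ _); rewrite genmxE.
  exact: submx_trans le (addsmxSr _ _).
elim: s sP {sT} => [|t s IH] sP; first by rewrite big_nil sub0mx.
rewrite big_cons addsmx_sub genmxE PW ?IH //; first by move=> u us; apply: sP; rewrite inE us orbT.
by apply: sP; rewrite mem_head.
Qed.

Definition linform (K : fieldType) (T : Type) m (v : T -> 'rV[K]_m) (f : T -> K) :=
  exists c : 'cV[K]_m, forall t, f t = (v t *m c) 0 0.

(** Products of linear forms in [v t] and [w t] are linear in this vector; matrix words in a
    representation thereby become linear functions of a single vector. *)
Definition tensor (K : fieldType) (T : Type) m p (v : T -> 'rV[K]_m) (w : T -> 'rV[K]_p) t :=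
  mxvec ((v t)^T *m w t).

Lemma linform_sum (K : fieldType) (T : Type) m (v : T -> 'rV[K]_m) (I : finType)
    (f : I -> T -> K) : (forall i, linform v (f i)) -> linform v (fun t => \sum_i f i t).
Proof.
move=> /choice[c Hc]; exists (\sum_i c i) => t.
by rewrite mulmx_sumr summxE; apply: eq_bigr => i _.
Qed.

Lemma linformZ (K : fieldType) (T : Type) m (v : T -> 'rV[K]_m) a f :
  linform v f -> linform v (fun t => a * f t).
Proof. by move=> [c Hc]; exists (a *: c) => t; rewrite -scalemxAr mxE Hc. Qed.

Lemma linformM (K : fieldType) (T : Type) m p (v : T -> 'rV[K]_m) (w : T -> 'rV[K]_p) f h :
  linform v f -> linform w h -> linform (tensor v w) (fun t => f t * h t).
Proof.
move=> [c Hc] [d Hd]; exists (mxvec (c *m d^T))^T => t.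
rewrite Hc Hd !mxE /tensor big_distrl /= (reindex _ (curry_mxvec_bij _ _)) /=.
rewrite [RHS](eq_bigr (fun ij => mxvec ((v t)^T *m w t) 0 (mxvec_index ij.1 ij.2) *
   (mxvec (c *m d^T))^T (mxvec_index ij.1 ij.2) 0)); last by case.
rewrite -(pair_bigA _ (fun i j => mxvec ((v t)^T *m w t) 0 (mxvec_index i j) *
   (mxvec (c *m d^T))^T (mxvec_index i j) 0)) /=.
apply: eq_bigr => i _; rewrite big_distrr /=; apply: eq_bigr => j _.
by rewrite [(_^T) (mxvec_index i j) _]mxE !mxvecE !mxE !big_ord1 !mxE mulrACA.
Qed.

Definition linform_mx (K : fieldType) (T : Type) m (v : T -> 'rV[K]_m) n p (A : T -> 'M[K]_(n, p)) :=
  forall i j, linform v (fun t => A t i j).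

Lemma linform_mxvec (K : fieldType) (T : Type) n p (A : T -> 'M[K]_(n, p)) :
  linform_mx (fun t => mxvec (A t)) A.
Proof.
move=> i j; exists (delta_mx (mxvec_index i j) 0) => t.
rewrite mxE (bigD1 (mxvec_index i j)) //= mxE !eqxx mulr1 mxvecE big1 ?addr0 // => k kij.
by rewrite mxE (negPf kij) mulr0.
Qed.

Lemma linform_mxMl (K : fieldType) (T : Type) m (v : T -> 'rV[K]_m) n p q
    (B : 'M[K]_(n, p)) (A : T -> 'M[K]_(p, q)) : linform_mx v A -> linform_mx v (fun t => B *m A t).
Proof.
move=> vA i j; have [c Hc] := linform_sum (fun k => linformZ (B i k) (vA k j)).
by exists c => t; rewrite mxE Hc.
Qed.

Lemma linform_mxMr (K : fieldType) (T : Type) m (v : T -> 'rV[K]_m) n p q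
    (B : 'M[K]_(p, q)) (A : T -> 'M[K]_(n, p)) : linform_mx v A -> linform_mx v (fun t => A t *m B).
Proof.
move=> vA i j; have [c Hc] := linform_sum (fun k => linformZ (B k j) (vA i k)).
by exists c => t; rewrite -Hc mxE; apply: eq_bigr => k _; rewrite mulrC.
Qed.

Lemma linform_mxM (K : fieldType) (T : Type) m1 m2 (v : T -> 'rV[K]_m1) (w : T -> 'rV[K]_m2)
    n p q (A : T -> 'M[K]_(n, p)) (B : T -> 'M[K]_(p, q)) :
  linform_mx v A -> linform_mx w B -> linform_mx (tensor v w) (fun t => A t *m B t).
Proof.
move=> vA wB i j; have [c Hc] := linform_sum (fun k => linformM (vA i k) (wB k j)).
by exists c => t; rewrite -Hc mxE.
Qed.

(** A matrix is scalar when its off-diagonal entries and the differences of its diagonal entries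
    vanish. These are linear in [v t], so one list spanning all [v t] serves every [A] at once. *)
Lemma scalar_test (K : fieldType) (T : eqType) (P : T -> Prop) m (v : T -> 'rV[K]_m) :
  exists s : seq T, (forall t, t \in s -> P t) /\
    forall n (A : T -> 'M[K]_n), linform_mx v A ->
      (forall t, t \in s -> is_scalar_mx (A t)) -> forall t, P t -> is_scalar_mx (A t).
Proof.
have [s [sP sT]] := span_test P v; exists s; split=> // n A vA As x Px.
have test f : linform v f -> (forall t, t \in s -> f t = 0) -> f x = 0.
  move=> [c Hc] fs; have : (v x <= kermx c)%MS.
    apply: (sT _ _ _ x Px) => t /fs ft; apply/sub_kermxP/matrixP => i j.
    by rewrite !ord1 -Hc ft mxE.
  by rewrite Hc => /sub_kermxP->; rewrite mxE.
case: n A vA As => [|n] A vA As; first by apply/is_scalar_mxP; exists 0; apply/matrixP; case.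
apply/is_scalar_mxP; exists (A x 0 0); apply/matrixP => i j; rewrite mxE.
case: (eqVneq i j) => [<-|ij]; rewrite ?mulr1n ?mulr0n.
  apply/eqP; rewrite -subr_eq0; apply/eqP; apply: (test (fun t => A t i i - A t 0 0)).
    have [c Hc] := vA i i; have [d Hd] := vA 0 0.
    by exists (c - d) => t; rewrite Hc Hd mulmxBr; set a := v t *m c; set b := v t *m d; rewrite !mxE.
  by move=> t /As/is_scalar_mxP[a ->]; rewrite !mxE !eqxx subrr.
apply: (test (fun t => A t i j)) => // t /As/is_scalar_mxP[a ->].
by rewrite mxE (negPf ij).
Qed.

Lemma roots_finite (K : fieldType) (p : {poly K}) : p != 0 ->
  exists s : seq K, forall x, root p x -> x \in s.
Proof.
move=> p0; pose P k := `[< exists s, [/\ uniq s, all (root p) s & size s = k] >].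
have exP : exists k, P k by exists 0%N; apply/asboolP; exists [::].
have Pb k : P k -> (k <= size p)%N.
  by move=> /asboolP[s [us rs <-]]; apply/ltnW/max_poly_roots.
case: (ex_maxnP exP Pb) => k /asboolP[s [us rs <-]] smax.
exists s => x px; apply: contraT => xs.
suff : ((size s).+1 <= size s)%N by rewrite ltnn.
by apply: smax; apply/asboolP; exists (x :: s); rewrite /= xs us px rs.
Qed.

Lemma unity_roots_finite (K : fieldType) n : (0 < n)%N ->
  exists s : seq K, forall x, x ^+ n = 1 -> x \in s.
Proof.
move=> n0; have [|s Hs] := @roots_finite K ('X^n - 1).
  by rewrite -size_poly_gt0 -(prednK n0) size_XnsubC.
by exists s => x xn; apply: Hs; rewrite rootE hornerD hornerN hornerXn hornerC xn subrr.
Qed.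
End LinearAlgebra.

(** * Strong irreducibility, Schur's lemma and a Clifford argument *)

Section Representations.
Import GRing.Theory.
Local Open Scope ring_scope.
Variable G : groupType.
Implicit Types (H N : set G) (g h x y u v w a : G).

Definition is_rep (K : fieldType) n H (rho : G -> 'M[K]_n) :=
  rho 1%g = 1%:M /\ forall g h, H g -> H h -> rho (g * h)%g = rho g *m rho h.

Definition strongly_irreducible (K : fieldType) n H (rho : G -> 'M[K]_n) :=
  forall (L : fieldType) (phi : {rmorphism K -> L}) H1,
    is_subgroup H1 -> H1 `<=` H -> finite_index H1 ->
    forall U : 'M[L]_n, (forall g, H1 g -> (U *m map_mx phi (rho g) <= U)%MS) ->
      U = 0 \/ row_full U.

Lemma is_rep_map (K L : fieldType) (phi : {rmorphism K -> L}) n H (rho : G -> 'M[K]_n) :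
  is_rep H rho -> is_rep H (fun g => map_mx phi (rho g)).
Proof.
move=> [r1 rM]; split; first by rewrite r1 map_mx1.
by move=> g h Hg Hh; rewrite rM // map_mxM.
Qed.

Lemma is_repS (K : fieldType) n H H1 (rho : G -> 'M[K]_n) :
  H1 `<=` H -> is_rep H rho -> is_rep H1 rho.
Proof. by move=> HH [r1 rM]; split=> // g h /HH Hg /HH Hh; exact: rM. Qed.

Section OneRep.
Variables (K : fieldType) (n : nat) (H : set G) (rho : G -> 'M[K]_n).
Hypotheses (sH : is_subgroup H) (rep : is_rep H rho).

Lemma repM g h : H g -> H h -> rho (g * h)%g = rho g *m rho h.
Proof. by case: rep => _; apply. Qed.

Lemma rep1 : rho 1%g = 1%:M. Proof. by case: rep. Qed.

Lemma repV g : H g -> rho g^-1%g = invmx (rho g) /\ rho g \in unitmx.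
Proof.
move=> Hg; have Hi := subgroupV sH Hg.
have E : rho g *m rho g^-1%g = 1%:M by rewrite -repM // mulgV rep1.
have [u _] := mulmx1_unit E; split=> //.
by rewrite -[LHS]mul1mx -(mulVmx u) -mulmxA E mulmx1.
Qed.

Lemma repVK g : H g -> rho g^-1%g *m rho g = 1%:M.
Proof. by move=> Hg; rewrite -repM ?mulVg ?rep1 //; exact: subgroupV. Qed.

Lemma repKV g : H g -> rho g *m rho g^-1%g = 1%:M.
Proof. by move=> Hg; rewrite -repM ?mulgV ?rep1 //; exact: subgroupV. Qed.

Lemma rep_det g : H g -> \det (rho g) != 0.
Proof. by move=> /repV[_]; rewrite unitmxE unitfE. Qed.

Lemma repJ x g : H x -> H g -> rho (x ^ g)%g = rho g^-1%g *m rho x *m rho g.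
Proof.
move=> Hx Hg; have Hi := subgroupV sH Hg.
by rewrite /conjg repM ?repM ?mulmxA //; exact: subgroupM.
Qed.

End OneRep.

Lemma is_scalar_of_map (K L : fieldType) (phi : {rmorphism K -> L}) n (c : 'M[K]_n) (a : L) :
  map_mx phi c = a%:M -> is_scalar_mx c.
Proof.
case: n c => [|n] c E; first by apply/is_scalar_mxP; exists 0; apply/matrixP; case.
apply/is_scalar_mxP; exists (c 0 0); apply/matrixP => i j; apply: (fmorph_inj phi).
have := congr1 (fun M : 'M[L]_n.+1 => M i j) E; rewrite !mxE => ->.
have := congr1 (fun M : 'M[L]_n.+1 => M 0 0) E; rewrite !mxE eqxx mulr1n => E0.
by case: (i == j); rewrite ?mulr1n ?mulr0n ?rmorph0.
Qed.

(** Over an extension field [c] has an eigenvalue; the eigenspace is stable under [H1], hence the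
    whole space by strong irreducibility. *)
Lemma schur (K : fieldType) n H (rho : G -> 'M[K]_n) (c : 'M[K]_n) H1 : (0 < n)%N ->
  strongly_irreducible H rho -> is_subgroup H1 -> H1 `<=` H -> finite_index H1 ->
  (forall g, H1 g -> c *m rho g = rho g *m c) -> is_scalar_mx c.
Proof.
move=> n0 irr s1 H1H f1 cc.
have [L [phi [a ka]]] := exists_eigenvalue c n0.
have [g H1g|k0|kf] := irr L phi H1 s1 H1H f1 (kermx (map_mx phi c - a%:M)).
- have E : map_mx phi (rho g) *m (map_mx phi c - a%:M) = (map_mx phi c - a%:M) *m map_mx phi (rho g).
    by rewrite mulmxBr mulmxBl -!map_mxM cc // scalar_mxC.
  by apply/sub_kermxP; rewrite -mulmxA E mulmxA mulmx_ker mul0mx.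
- by rewrite k0 eqxx in ka.
have E : map_mx phi c = a%:M.
  apply/eqP; rewrite -subr_eq0; apply/eqP; rewrite -[LHS]mul1mx.
  by apply/sub_kermxP; apply: submx_full.
exact: is_scalar_of_map E.
Qed.

Section Clifford.
Variables (L : fieldType) (n : nat) (H : set G) (r : G -> 'M[L]_n) (Z : G -> 'M[L]_n).
Hypotheses (sH : is_subgroup H) (rep : is_rep H r).
Hypotheses (ZJ : forall g h, H g -> H h -> r h *m Z (g * h)%g = Z g *m r h).
Hypotheses (ZC : forall g h, H g -> H h -> Z g *m Z h = Z h *m Z g).
Let E g := kermx (Z g).
Let W (s : seq G) := (\bigcap_(g <- s) E g)%MS.

Lemma sub_kernels s p (A : 'M[L]_(p, n)) : (A <= W s)%MS = all (fun g => (A <= E g)%MS) s.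
Proof.
rewrite /W; elim: s => [|g s IH]; first by rewrite big_nil submx1.
by rewrite big_cons sub_capmx IH.
Qed.

(* The translates of a minimal nonzero intersection of the kernels are linearly independent:
   a kernel that contains one translate and not another meets the latter trivially. *)
Lemma clifford_stable_subspace : kermx (Z 1%g) != 0 ->
  exists (U : 'M[L]_n) H1, [/\ U != 0, is_subgroup H1 /\ H1 `<=` H,
    finite_index H -> finite_index H1, forall g, H1 g -> (U *m r g <= U)%MS &
    exists2 g, H g & (U <= kermx (Z g))%MS].
Proof.
move=> k1.
pose P k := (0 < k)%N && `[< exists s : seq G, [/\ forall g, g \in s -> H g, s != [::] & \rank (W s) = k] >].
have exP : exists k, P k.
  exists (\rank (W [:: 1%g])); rewrite /P; apply/andP; split; last first.
    apply/asboolP; exists [:: 1%g]; split=> // g; rewrite inE => /eqP->; exact: subgroup1.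
  by rewrite /W big_seq1 lt0n mxrank_eq0.
case: (ex_minnP exP) => k /andP[k0 /asboolP[s [sHs s0 rs]]] kmin.
pose T h := map (fun g => g * h)%g s.
have TH h : H h -> forall g, g \in T h -> H g.
  by move=> Hh _ /mapP[g /sHs Hg ->]; exact: subgroupM.
have Er g h : H g -> H h -> (E g *m r h <= E (g * h)%g)%MS.
  move=> Hg Hh; apply/sub_kermxP.
  by rewrite -mulmxA ZJ // mulmxA mulmx_ker mul0mx.
have Wr h : H h -> (W s *m r h == W (T h))%MS.
  move=> Hh; have Hi := subgroupV sH Hh; apply/andP; split.
    rewrite sub_kernels; apply/allP => _ /mapP[g gs ->]; apply: submx_trans (Er _ _ (sHs _ gs) Hh).
    apply: submxMr; have : (W s <= W s)%MS by [].
    by rewrite {2}/W -/(W s) sub_kernels => /allP/(_ g gs).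
  have -> : W (T h) = W (T h) *m r h^-1%g *m r h by rewrite -mulmxA (repVK sH rep Hh) mulmx1.
  apply: submxMr; rewrite sub_kernels; apply/allP => g gs.
  have Hgh : H (g * h)%g by apply: subgroupM => //; exact: sHs.
  have := Er _ _ Hgh Hi; rewrite mulgK; apply: submx_trans; apply: submxMr.
  have : (W (T h) <= W (T h))%MS by [].
  by rewrite {2}/W -/(W (T h)) sub_kernels => /allP; apply; exact: map_f.
have rT h : H h -> \rank (W (T h)) = k.
  by move=> Hh; rewrite -(eqmxP (Wr h Hh)) mxrankMfree // row_free_unit; case: (repV sH rep Hh).
have ZW h g : H h -> H g -> (W (T h) *m Z g <= W (T h))%MS.
  move=> Hh Hg; rewrite sub_kernels; apply/allP => g' g's; apply/sub_kermxP.
  rewrite -mulmxA ZC //; last exact: TH g's.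
  have : (W (T h) <= W (T h))%MS by [].
  by rewrite {2}/W -/(W (T h)) sub_kernels => /allP/(_ g' g's)/sub_kermxP; rewrite mulmxA => ->; rewrite mul0mx.
have sepW h h' : H h -> H h' -> ~~ (W (T h) == W (T h'))%MS ->
    exists g, [/\ H g, (W (T h) <= E g)%MS & (W (T h') :&: E g)%MS = 0].
  move=> Hh Hh' ne; apply: contrapT => no; move/negP: ne; apply.
  suff le : (W (T h') <= W (T h))%MS.
    by rewrite andbC le; have := (mxrank_leqif_eq le).2; rewrite !rT // eqxx => /esym/andP[].
  rewrite sub_kernels; apply/allP => g gs; have Hg := TH h Hh g gs.
  have leg : (W (T h) <= E g)%MS.
    by have : (W (T h) <= W (T h))%MS by []; rewrite {2}/W -/(W (T h)) sub_kernels => /allP/(_ g gs).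
  have le2 : (W (T h') :&: E g <= W (T h'))%MS by exact: capmxSl.
  have nz : (W (T h') :&: E g)%MS != 0.
    by apply/eqP => z; apply: no; exists g.
  have rk : (k <= \rank (W (T h') :&: E g)%MS)%N.
    apply: kmin; rewrite /P lt0n mxrank_eq0 nz /=; apply/asboolP; exists (g :: T h').
    split=> //; last by rewrite /W big_cons capmxC.
    by move=> g'; rewrite inE => /orP[/eqP->//|/(TH h' Hh')].
  have : (W (T h') :&: E g == W (T h'))%MS.
    by rewrite -(mxrank_leqif_eq le2).2 rT // eqn_leq rk -(rT h' Hh') mxrankS.
  by move=> /eqmxP <-; exact: capmxSr.
(* [e] is a product of matrices [Z g], one for each translate in [hs]. Since the [Z g] commute and
   preserve every translate, it kills all translates in [hs] and is injective on [W (T h)]. *)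
have killer h (hs : seq G) : H h -> (forall h', h' \in hs -> H h' /\ ~~ (W (T h') == W (T h))%MS) ->
    exists e : 'M[L]_n, [/\ forall h', h' \in hs -> W (T h') *m e = 0,
      forall g, H g -> Z g *m e = e *m Z g &
      forall p (A : 'M[L]_(p, n)), (A <= W (T h))%MS -> A *m e = 0 -> A = 0].
  move=> Hh; elim: hs => [|h1 hs IH] Hhs.
    exists 1%:M; split=> // [g _|p A _]; first by rewrite mulmx1 mul1mx.
    by rewrite mulmx1.
  have [|e [e0 eC einj]] := IH; first by move=> h' h's; apply: Hhs; rewrite inE h's orbT.
  have [Hh1 ne] := Hhs h1 (mem_head _ _).
  have [g [Hg Wg cap0]] := sepW _ _ Hh1 Hh ne.
  exists (Z g *m e); split.
  - move=> h'; rewrite inE => /orP[/eqP->|h's].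
      by rewrite mulmxA (sub_kermxP Wg) mul0mx.
    by rewrite eC // mulmxA e0 // mul0mx.
  - by move=> g' Hg'; rewrite mulmxA ZC // -!mulmxA eC.
  - move=> p A AW; rewrite mulmxA => /einj; move=> /(_ (submx_trans (submxMr _ AW) (ZW h g Hh Hg))) AZ.
    by apply/eqP; rewrite -submx0 -cap0 sub_capmx AW; apply/sub_kermxP.
(* A largest independent family of translates, bounded by the dimension. By [killer] any translate
   missing from it could be added, so it contains them all. *)
pose Q m := `[< exists hs : seq G, [/\ forall h, h \in hs -> H h, size hs = m &
   \rank (\sum_(h <- hs) <<W (T h)>>)%MS = (m * k)%N] >].
have exQ : exists m, Q m.
  by exists 0%N; apply/asboolP; exists [::]; split=> //; rewrite big_nil mxrank0.
have Qb m : Q m -> (m <= n)%N.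
  move=> /asboolP[hs [_ _ rk]]; have := rank_leq_row (\sum_(h <- hs) <<W (T h)>>)%MS.
  by rewrite rk; apply: leq_trans; rewrite leq_pmulr.
case: (ex_maxnP exQ Qb) => m /asboolP[hs [hsH shs rk]] mmax.
have orbit h : H h -> has (fun h' => (W (T h') == W (T h))%MS) hs.
  move=> Hh; apply: contraT => /hasPn no.
  have [|e [e0 _ einj]] := killer h hs Hh.
    by move=> h' h's; split; [exact: hsH|exact: no].
  suff : (m.+1 <= m)%N by rewrite ltnn.
  apply: mmax; apply/asboolP; exists (h :: hs); split=> /=; last first.
  - rewrite big_cons mxrank_disjoint_sum ?genmxE ?rT ?rk //.
    apply: (einj _ _); first by apply: submx_trans (capmxSl _ _) _; rewrite genmxE.
    apply/sub_kermxP; apply: submx_trans (capmxSr _ _) _.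
    elim: (hs) e0 => [|h' hs' IH] e0; first by rewrite big_nil sub0mx.
    rewrite big_cons addsmx_sub genmxE IH ?andbT; last by move=> h2 h2s; apply: e0; rewrite inE h2s orbT.
    by apply/sub_kermxP; apply: e0; rewrite mem_head.
  - by rewrite shs.
  - by move=> h'; rewrite inE => /orP[/eqP->|/hsH].
have sS : is_subgroup [set h | H h /\ (W s *m r h == W s)%MS].
  split=> [|x y [Hx /eqmxP Wx] [Hy /eqmxP Wy]|x [Hx /eqmxP Wx]].
  - split; first exact: subgroup1.
    by rewrite (rep1 rep) mulmx1; apply/eqmxP.
  - split; first exact: subgroupM.
    rewrite (repM rep) // mulmxA; apply/eqmxP.
    exact: eqmx_trans (eqmxMr _ Wx) Wy.
  - split; first exact: subgroupV.
    apply/eqmxP/eqmx_sym; have := eqmxMr (r x^-1%g) Wx.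
    by rewrite -mulmxA (repKV sH rep Hx) mulmx1.
exists (W s), [set h | H h /\ (W s *m r h == W s)%MS]; split.
- by rewrite -mxrank_eq0 rs -lt0n.
- by split=> // x [].
- move=> fH.
  (* [F h] records which translate [W (T h^-1)] is; the inverse converts the right action on row
     spaces to left cosets. *)
  pose F h := index true [seq (W (T h') == W (T h^-1%g))%MS | h' <- hs].
  apply: (@finite_index_fiber _ _ F (iota 0 (size hs).+1) H) => //.
    move=> g Hg; rewrite mem_iota /= add0n ltnS.
    by rewrite -(size_map (fun h' => (W (T h') == W (T g^-1%g))%MS) hs) index_size.
  have FE g : H g -> (W (T (nth 1%g hs (F g))) == W (T g^-1%g))%MS.
    move=> Hg; have Hi := subgroupV sH Hg.
    have hasT : true \in [seq (W (T h') == W (T g^-1%g))%MS | h' <- hs].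
      by have /hasP[h' h's e] := orbit _ Hi; apply/mapP; exists h'.
    have sz : (F g < size hs)%N.
      by rewrite -(size_map (fun h' => (W (T h') == W (T g^-1%g))%MS) hs) index_mem.
    by have := nth_index false hasT; rewrite (nth_map 1%g).
  move=> g h Hg Hh Egh; have Hgi := subgroupV sH Hg; have Hhi := subgroupV sH Hh.
  have /eqmxP e1 := FE g Hg; have /eqmxP e2 := FE h Hh.
  rewrite Egh in e1; split; first exact: subgroupM.
  have e3 : (W s *m r g^-1%g :=: W s *m r h^-1%g)%MS.
    apply: eqmx_trans (eqmxP (Wr _ Hgi)) _; apply: eqmx_trans (eqmx_sym e1) _.
    by apply: eqmx_trans e2 _; apply: eqmx_sym; apply/eqmxP; exact: Wr.
  have e4 := eqmxMr (r h) e3.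
  rewrite (repM rep) // mulmxA; apply/eqmxP; apply: eqmx_trans e4 _.
  by rewrite -mulmxA (repVK sH rep Hh) mulmx1.
- by move=> g [_ /andP[]].
have [g gs] : exists g, g \in s by case: (s) s0 => // g s' _; exists g; rewrite mem_head.
exists g; first exact: sHs.
by have : (W s <= W s)%MS by []; rewrite {2}/W -/(W s) sub_kernels => /allP; apply.
Qed.
End Clifford.
End Representations.

(** * Nonscalar commutators in strongly irreducible groups *)

Section IrreducibleCommutators.
Import GRing.Theory.
Local Open Scope ring_scope.
Variables (G : groupType) (K : fieldType) (n : nat) (H : set G) (rho : G -> 'M[K]_n).
Hypotheses (n0 : (0 < n)%N) (sH : is_subgroup H) (fH : finite_index H).
Hypotheses (rep : is_rep H rho) (irr : strongly_irreducible H rho).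
Implicit Types (g h x y u v w a : G).

(** The conjugates of [z], shifted by an eigenvalue, form a commuting family with a nonzero kernel.
    The resulting subspace stable under a subgroup of finite index is everything, so a conjugate of
    [z], and with it [z], is scalar. *)
Lemma clifford_scalar (z : 'M[K]_n) :
  (forall g h, H g -> H h ->
     (rho g^-1%g *m z *m rho g) *m (rho h^-1%g *m z *m rho h) =
     (rho h^-1%g *m z *m rho h) *m (rho g^-1%g *m z *m rho g)) -> is_scalar_mx z.
Proof.
move=> zC; have [L [phi [a ka]]] := exists_eigenvalue z n0.
pose zz g := rho g^-1%g *m z *m rho g.
pose Z g := map_mx phi (zz g) - a%:M.
have repL := is_rep_map phi rep.
have [|||U [H1 [U0 [s1 H1H] f1 U1 [g Hg Ug]]]] := @clifford_stable_subspace G L n H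
  (fun g => map_mx phi (rho g)) Z sH repL.
- move=> g h Hg Hh; rewrite /Z mulmxBr mulmxBl scalar_mxC; congr (_ - _).
  rewrite -!map_mxM; congr (map_mx _ _); rewrite /zz invgM.
  rewrite (repM rep) ?(repM rep) //; do ?exact: (subgroupV sH).
  by rewrite !mulmxA (repKV sH rep Hh) mul1mx.
- move=> g h Hg Hh; rewrite /Z !mulmxBr !mulmxBl !scalar_mxC -!map_mxM zC //.
  by rewrite !opprB -!addrA; congr (_ + _); rewrite addrCA [RHS]addrCA; congr (_ + _); exact: addrC.
- by rewrite /Z /zz invg1 (rep1 rep) mul1mx mulmx1.
have [U00|Uf] := irr s1 H1H (f1 fH) U1; first by rewrite U00 eqxx in U0.
have Zg : Z g = 0.
  rewrite -[LHS]mul1mx; apply/sub_kermxP; apply: submx_trans Ug; exact: submx_full.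
have E : map_mx phi (zz g) = a%:M by apply/eqP; rewrite -subr_eq0 -/(Z g) Zg.
have zE : z = rho g *m zz g *m rho g^-1%g.
  by rewrite /zz !mulmxA (repKV sH rep Hg) mul1mx -mulmxA (repKV sH rep Hg) mulmx1.
have zA : map_mx phi z = a%:M.
  by rewrite zE (map_mxM _ (_ *m _)) (map_mxM _ (rho g)) E scalar_mxC -mulmxA -map_mxM (repKV sH rep Hg) map_mx1 mulmx1.
exact: is_scalar_of_map zA.
Qed.

(** This confines the multipliers in projective relations to a finite set. *)
Lemma unity_root_of_det (A B : 'M[K]_n) c : \det A != 0 -> \det A = \det B -> A = c *: B -> c ^+ n = 1.
Proof.
move=> dA dAB E; have := congr1 determinant E; rewrite detZ -dAB => h.
by apply: (mulIf dA); rewrite -h mul1r.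
Qed.

Lemma det_repJ u g : H u -> H g -> \det (rho (u ^ g)%g) = \det (rho u).
Proof.
move=> Hu Hg; rewrite (repJ sH rep) // !det_mulmx mulrC mulrA -det_mulmx.
by rewrite (repKV sH rep Hg) det1 mul1r.
Qed.

Lemma repJ_eqZ u v c g : H u -> H v -> H g -> rho u = c *: rho v -> rho (u ^ g)%g = c *: rho (v ^ g)%g.
Proof.
by move=> Hu Hv Hg E; rewrite !(repJ sH rep) // E -scalemxAr -scalemxAl.
Qed.

Definition projective_stabilizer u := [set g | H g /\ exists c, rho (u ^ g)%g = c *: rho u].

Lemma is_subgroup_projective_stabilizer u : H u -> is_subgroup (projective_stabilizer u).
Proof.
move=> Hu; split=> [|x y [Hx [c Ec]] [Hy [d Ed]]|x [Hx [c Ec]]].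
- by split; [exact: subgroup1|exists 1; rewrite conjg1 scale1r].
- split; [exact: subgroupM|exists (c * d)]; rewrite conjgM.
  by rewrite (repJ_eqZ _ _ Hy Ec) ?Ed ?scalerA //; exact: subgroupJ.
- have Hi := subgroupV sH Hx; split=> //; exists c^-1.
  have := repJ_eqZ (subgroupJ sH Hu Hx) Hu Hi Ec; rewrite conjgK => ->.
  rewrite scalerA mulVf ?scale1r //; apply/eqP => c0.
  have := rep_det sH rep (subgroupJ sH Hu Hx).
  by rewrite Ec c0 scale0r -(scale0r 1%:M) detZ expr0n gtn_eqF // mul0r eqxx.
Qed.

(** The multipliers on the projective stabilizer are [n]-th roots of unity, so the centralizer of
    [rho u] has finite index too, and Schur's lemma applies. *)
Lemma finite_projective_orbit_scalar u : H u ->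
  finite_index (projective_stabilizer u) -> is_scalar_mx (rho u).
Proof.
set S1 := projective_stabilizer u => Hu f1.
have [vals Hv] := unity_roots_finite K n0.
have S1root g c : H g -> rho (u ^ g)%g = c *: rho u -> c \in vals.
  move=> Hg E; apply: Hv; apply: unity_root_of_det (det_repJ Hu Hg) E.
  exact: (rep_det sH rep (subgroupJ sH Hu Hg)).
have sS1 := is_subgroup_projective_stabilizer Hu.
pose S2 := [set g | H g /\ rho (u ^ g)%g = rho u].
have sS2 : is_subgroup S2.
  split=> [|x y [Hx Ex] [Hy Ey]|x [Hx Ex]].
  - by split; [exact: subgroup1|rewrite conjg1].
  - split; first exact: subgroupM.
    by rewrite conjgM (repJ sH rep) ?Ex -?(repJ sH rep) //; exact: subgroupJ.
  - have Hi := subgroupV sH Hx; split=> //.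
    by rewrite (repJ sH rep) // -Ex -(repJ sH rep) ?conjgK //; exact: subgroupJ.
pose F g := xget 0 [set c | rho (u ^ g^-1)%g = c *: rho u].
have FP g : S1 g -> rho (u ^ g^-1)%g = F g *: rho u.
  move=> /(subgroupV sS1)[_ ex]; exact: (@xgetPex _ 0 [set c | rho (u ^ g^-1)%g = c *: rho u]).
have f2 : finite_index S2.
  apply: (@finite_index_fiber _ _ F vals S1) => //.
    by move=> g Sg; apply: S1root (FP g Sg); have [] := subgroupV sS1 Sg.
  move=> g h Sg Sh E; have [Hg _] := Sg; have [Hh _] := Sh.
  have Hgi := subgroupV sH Hg; have Hhi := subgroupV sH Hh.
  split; first exact: subgroupM.
  rewrite conjgM (repJ sH rep) ?FP ?E -?FP -?(repJ sH rep) ?conjgKV //; exact: subgroupJ.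
apply: (schur n0 irr sS2 _ f2); first by move=> g [].
move=> g [Hg E]; rewrite -{2}E (repJ sH rep) // !mulmxA (repKV sH rep Hg) mul1mx //.
Qed.

Definition normal_closure a := generated [set (a ^ g)%g | g in H].

Lemma normal_closure_self a : normal_closure a a.
Proof. by apply: sub_generated; exists 1%g; [exact: subgroup1|rewrite conjg1]. Qed.

Lemma is_subgroup_normal_closure a : is_subgroup (normal_closure a).
Proof. exact: is_subgroup_generated. Qed.

Lemma normal_closure_sub a : H a -> normal_closure a `<=` H.
Proof. by move=> Ha; apply: generated_min => // _ [g Hg <-]; exact: subgroupJ. Qed.

Lemma normal_closureJ a x g : normal_closure a x -> H g -> normal_closure a (x ^ g)%g.
Proof.
move=> Nx Hg; apply: generatedJ Nx; first exact: is_subgroup_normal_closure.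
move=> _ [h Hh <-]; rewrite -conjgM; apply: sub_generated.
by exists (h * g)%g => //; exact: subgroupM.
Qed.

Lemma normal_closureS a v : normal_closure a v -> normal_closure v `<=` normal_closure a.
Proof.
move=> Nv; apply: generated_min; first exact: is_subgroup_normal_closure.
by move=> _ [g Hg <-]; exact: normal_closureJ.
Qed.

Definition projectively_commute x y := exists c, rho x *m rho y = c *: (rho y *m rho x).

Lemma projectively_commuteP x y : H x -> H y -> is_scalar_mx (rho [~ x, y]%g) ->
  projectively_commute x y.
Proof.
move=> Hx Hy /is_scalar_mxP[c Ec]; exists c.
rewrite -!(repM rep) // commgC (repM rep) ?Ec ?(repM rep) // ?mul_mx_scalar //.
- exact: subgroupM.
- exact: subgroupR.
Qed.

Lemma projectively_commuteM x y z : H x -> H y -> H z ->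
  projectively_commute x y -> projectively_commute x z -> projectively_commute x (y * z)%g.
Proof.
move=> Hx Hy Hz [c Ec] [d Ed]; exists (c * d); rewrite !(repM rep) //.
rewrite mulmxA Ec -scalemxAl -mulmxA Ed -scalemxAr scalerA mulmxA //.
Qed.

Lemma projectively_commute_neq0 x y c : H x -> H y ->
  rho x *m rho y = c *: (rho y *m rho x) -> c != 0.
Proof.
move=> Hx Hy E; apply/eqP => c0; have := rep_det sH rep (subgroupM sH Hx Hy).
by rewrite (repM rep) // E c0 scale0r -(scale0r 1%:M) detZ expr0n gtn_eqF // mul0r eqxx.
Qed.

Lemma projectively_commuteV x y : H x -> H y ->
  projectively_commute x y -> projectively_commute x y^-1%g.
Proof.
move=> Hx Hy [c Ec]; have c0 := projectively_commute_neq0 Hx Hy Ec; exists c^-1.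
have := congr1 (fun M => rho y^-1%g *m M *m rho y^-1%g) Ec.
rewrite -scalemxAr -scalemxAl !mulmxA (repVK sH rep Hy) mul1mx.
rewrite -!mulmxA (repKV sH rep Hy) mulmx1 => ->.
by rewrite scalerA mulVf // scale1r.
Qed.

Lemma projectively_commute_sym x y : H x -> H y ->
  projectively_commute x y -> projectively_commute y x.
Proof.
move=> Hx Hy [c Ec]; have c0 := projectively_commute_neq0 Hx Hy Ec; exists c^-1.
by rewrite Ec scalerA mulVf // scale1r.
Qed.

Lemma projectively_commute_closure x v : H x -> H v ->
  (forall g, H g -> projectively_commute x (v ^ g)%g) ->
  forall y, normal_closure v y -> projectively_commute x y.
Proof.
move=> Hx Hv xv y Ny.
suff [] : [set y | H y /\ projectively_commute x y] y by [].
apply: generated_min Ny.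
  split=> [|y1 y2 [Hy1 C1] [Hy2 C2]|y1 [Hy1 C1]].
  - by split; [exact: subgroup1|exists 1; rewrite scale1r (rep1 rep) mulmx1 mul1mx].
  - by split; [exact: subgroupM|exact: projectively_commuteM].
  - by split; [exact: subgroupV|exact: projectively_commuteV].
by move=> _ [g Hg <-]; split; [exact: subgroupJ|exact: xv].
Qed.

Lemma projectively_commuteJ x y g : H x -> H y -> H g ->
  projectively_commute x y -> projectively_commute (x ^ g)%g (y ^ g)%g.
Proof.
move=> Hx Hy Hg [c Ec]; exists c.
have xy := repJ_eqZ (subgroupM sH Hx Hy) (subgroupM sH Hy Hx) Hg (c := c).
rewrite -!(repM rep) -?conjMg; do ?exact: subgroupJ.
by apply: xy; rewrite !(repM rep).
Qed.

Let f x : 'rV[K]_(n * n) := mxvec (rho x).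

Let centralizer (A : 'M[K]_n) := kermx (lin_mx (mulmx A \- mulmxr A)).

Let centralizerP A x : (f x <= centralizer A)%MS <-> A *m rho x = rho x *m A.
Proof.
split=> [/sub_kermxP|E]; last first.
  by apply/sub_kermxP; rewrite mul_vec_lin /= E subrr linear0.
by rewrite mul_vec_lin /= => /(congr1 vec_mx)/eqP; rewrite mxvecK linear0 subr_eq0 => /eqP.
Qed.

(* [a] is chosen such that the span of its normal closure has minimal dimension. If no
   commutator of [u] and a conjugate of [v] were nonscalar, the normal closures of [u] and [v]
   would commute projectively; elements of the former with the same multipliers on a spanning
   set of the latter differ by an element commuting with the whole normal closure of [a], which
   is scalar by Clifford. So the projective orbit of [u] is finite, and [u] scalar by Schur. *)
Lemma exists_nonscalar_commutators x0 : H x0 -> ~~ is_scalar_mx (rho x0) ->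
  exists a, [/\ H a, ~~ is_scalar_mx (rho a) & forall u v,
    normal_closure a u -> normal_closure a v ->
    ~~ is_scalar_mx (rho u) -> ~~ is_scalar_mx (rho v) ->
    exists2 g, H g & ~~ is_scalar_mx (rho [~ u, v ^ g]%g)].
Proof.
move=> Hx0 nx0.
have [U HU] := choice (fun a => span_exists (normal_closure a) f).
pose P k := `[< exists a, [/\ H a, ~~ is_scalar_mx (rho a) & \rank (U a) = k] >].
have exP : exists k, P k by exists (\rank (U x0)); apply/asboolP; exists x0.
case: (ex_minnP exP) => k /asboolP[a [Ha na <-]] kmin.
exists a; split=> // u v Nu Nv nu nv; apply: contrapT => no.
have Hu := normal_closure_sub Ha Nu; have Hv := normal_closure_sub Ha Nv.
have sc g : H g -> projectively_commute u (v ^ g)%g.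
  move=> Hg; apply: projectively_commuteP => //; first exact: subgroupJ.
  by apply: contrapT => /negP ns; apply: no; exists g.
have Huv y : normal_closure v y -> H y by exact: normal_closure_sub.
have Huu w : normal_closure u w -> H w by exact: normal_closure_sub.
have pc w y : normal_closure u w -> normal_closure v y -> projectively_commute w y.
  move=> Nw Ny; apply: projectively_commute_sym; do ?[exact: Huv|exact: Huu].
  apply: (@projectively_commute_closure _ u) => //; first exact: Huv.
  move=> g Hg; apply: projectively_commute_sym; [exact: subgroupJ|exact: Huv|].
  rewrite -[y](conjgKV g); have Hi := subgroupV sH Hg.
  apply: projectively_commuteJ => //; first by apply: subgroupJ => //; exact: Huv.
  apply: (projectively_commute_closure Hu Hv sc).
  exact: normal_closureJ.
(* The closure of [v] lies in that of [a], and the rank for [a] is minimal, so the two spans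
   coincide. *)
have Uav : (U a <= U v)%MS.
  have Uva : (U v <= U a)%MS.
    by apply: (HU v).2 => y Ny; apply: (HU a).1; exact: normal_closureS Ny.
  have := (mxrank_leqif_eq Uva).2.
  rewrite eqn_leq (mxrankS Uva) kmin; first by move/esym/andP=> [].
  by apply/asboolP; exists v.
have [s [sP sT]] := span_test (normal_closure v) f.
have cent w : (forall t, t \in s -> rho w *m rho t = rho t *m rho w) ->
    forall y, normal_closure a y -> rho w *m rho y = rho y *m rho w.
  move=> ws y Ny; apply/centralizerP; apply: submx_trans ((HU a).1 _ Ny) _.
  apply: submx_trans Uav _; apply: (HU v).2 => t Nt; apply: sT Nt.
  by move=> t' /ws ?; apply/centralizerP.
(* The conjugates of [w] stay in the closure of [a], with which [w] commutes, so they commute with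
   each other and [clifford_scalar] applies. *)
have centsc w : normal_closure a w -> (forall t, t \in s -> rho w *m rho t = rho t *m rho w) ->
    is_scalar_mx (rho w).
  move=> Nw /cent wa; have Hw := normal_closure_sub Ha Nw.
  apply: clifford_scalar => g h Hg Hh; rewrite -!(repJ sH rep) //.
  have Hi := subgroupV sH Hg; have Hgi := subgroupM sH Hh Hi.
  have Hwg := subgroupJ sH Hw Hg; have Hwh := subgroupJ sH Hw Hh.
  rewrite -!(repM rep) //.
  have -> : (w ^ h)%g = ((w ^ (h * g^-1)) ^ g)%g by rewrite -conjgM mulgVK.
  rewrite -!conjMg; have HwJ := subgroupJ sH Hw Hgi.
  rewrite !(repJ sH rep) //; do ?exact: subgroupM.
  congr (_ *m _ *m _); rewrite (repM rep) // [RHS](repM rep) // wa //; exact: normal_closureJ.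
move/negP: nu; apply; apply: finite_projective_orbit_scalar => //.
have [vals Hvals] := unity_roots_finite K n0.
pose mu w y := xget 0 [set c | rho w *m rho y = c *: (rho y *m rho w)].
have muP w y : normal_closure u w -> normal_closure v y ->
    rho w *m rho y = mu w y *: (rho y *m rho w).
  move=> Nw Ny; exact: (@xgetPex _ 0 [set c | rho w *m rho y = c *: (rho y *m rho w)]) (pc _ _ Nw Ny).
have mu_vals w y : normal_closure u w -> normal_closure v y -> mu w y \in vals.
  move=> Nw Ny; apply: Hvals; have Hw := Huu _ Nw; have Hy := Huv _ Ny.
  apply: unity_root_of_det (muP w y Nw Ny); last by rewrite !det_mulmx mulrC.
  by rewrite -(repM rep) //; apply: (rep_det sH rep); exact: subgroupM.
(* [F g] encodes the multipliers of [u ^ g^-1] against the spanning list [s]; being roots of unity,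
   they leave finitely many possibilities. *)
pose F g : {ffun 'I_(size s) -> 'I_(size vals).+1} :=
  [ffun i : 'I_(size s) => inord (index (mu (u ^ g^-1)%g (nth 1%g s i)) vals)].
have sS := is_subgroup_projective_stabilizer Hu.
apply: (@finite_index_fiber _ _ F (enum {ffun 'I_(size s) -> 'I_(size vals).+1}) H) => //.
  by move=> g _; rewrite mem_enum.
move=> g h Hg Hh /ffunP E; have Hgi := subgroupV sH Hg; have Hhi := subgroupV sH Hh.
set w1 := (u ^ g^-1)%g in E; set w2 := (u ^ h^-1)%g in E.
have N1 : normal_closure u w1 by apply: normal_closureJ => //; exact: normal_closure_self.
have N2 : normal_closure u w2 by apply: normal_closureJ => //; exact: normal_closure_self.
have H1 := Huu _ N1; have H2 := Huu _ N2; have H2i := subgroupV sH H2.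
have mu12 t : t \in s -> mu w1 t = mu w2 t.
  move=> ts; have st : (index t s < size s)%N by rewrite index_mem.
  have := E (Ordinal st); rewrite !ffunE /= nth_index // => /(congr1 val).
  have Nt := sP _ ts.
  rewrite /= !inordK ?ltnS ?index_size // => Ei.
  by rewrite -(nth_index 0 (mu_vals _ _ N1 Nt)) Ei nth_index // mu_vals.
have [||nu12 E12] := is_scalar_mxP (centsc (w2^-1 * w1)%g _ _).
- have sN := is_subgroup_normal_closure a.
  by apply: (subgroupM sN); [apply: (subgroupV sN)|]; apply: (normal_closureS Nu).
- move=> t ts; have Nt := sP _ ts; have Ht := Huv _ Nt.
  rewrite (repM rep) // -mulmxA (muP _ _ N1 Nt) (mu12 _ ts) -scalemxAr.
  have -> : mu w2 t *: (rho w2^-1%g *m (rho t *m rho w1)) =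
      rho w2^-1%g *m (mu w2 t *: (rho t *m rho w2)) *m rho w2^-1%g *m rho w1.
    by rewrite -scalemxAr -!scalemxAl -!mulmxA [rho w2 *m (_ *m _)]mulmxA (repKV sH rep H2) mul1mx.
  by rewrite -(muP _ _ N2 Nt) !mulmxA (repVK sH rep H2) mul1mx.
split; first exact: subgroupM.
exists nu12; rewrite conjgM -/w1.
have E1 : rho w1 = nu12 *: rho w2.
  by rewrite -mul_mx_scalar -E12 -(repM rep) ?mulVKg //; exact: subgroupM.
by rewrite (repJ_eqZ H1 H2 Hh E1) /w2 conjgKV.
Qed.
End IrreducibleCommutators.

(* [w] is a balanced tree of commutators with leaves in [s]. *)
Lemma commutator_tree (G : groupType) (X P : set G) c :
  (forall u v, P u -> P v -> exists2 g, lenle X c g & P [~ u, v ^ g]%g) ->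
  forall k l (s : seq G), 0 < size s <= 2 ^ k -> (forall x, x \in s -> P x /\ lenle X l x) ->
  exists w, [/\ P w, lenle X (4 ^ k * (l + k * c)) w &
    forall N, is_normal_subgroup N -> (exists2 x, x \in s & N x) -> N w].
Proof.
move=> Pc; elim=> [|k IH] l s /andP[s0 sk] sP.
  case: s s0 sk sP => [//|x [|//]] _ _ sP; exists x; have [Px lx] := sP x (mem_head _ _).
  split=> //; first by rewrite expn0 mul1n mul0n addn0.
  by move=> N _ [y]; rewrite inE => /eqP->.
case: (leqP (size s) (2 ^ k)) => [sk'|ks].
  have [|w [Pw lw Nw]] := IH l s _ sP; first by rewrite s0.
  exists w; split=> //; apply: lenleW lw; rewrite leq_mul ?leq_exp2l //; nia.
have s1 : 0 < size (take (2 ^ k) s) <= 2 ^ k.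
  by rewrite size_take ks expn_gt0 leqnn.
have s2 : 0 < size (drop (2 ^ k) s) <= 2 ^ k.
  by rewrite size_drop subn_gt0 ks leq_subLR addnn -mul2n -expnS.
have [|w1 [P1 l1 N1]] := IH l _ s1; first by move=> x /mem_take /sP.
have [|w2 [P2 l2 N2]] := IH l _ s2; first by move=> x /mem_drop /sP.
have [g lg Pg] := Pc _ _ P1 P2; exists [~ w1, w2 ^ g]%g; split=> //.
  (* One level costs twice the length of [w1], twice that of [w2], and [4 * c] for the conjugator,
     whence the factor 4 per level. *)
  apply: lenleW (lenleR l1 (lenleJ l2 lg)); rewrite expnS; have := expn_gt0 4 k; nia.
move=> N nN [x xs Nx]; have [sN JN] := nN.
rewrite -(cat_take_drop (2 ^ k) s) mem_cat in xs; case/orP: xs => xs.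
  have Nw1 : N w1 by apply: N1 => //; exists x.
  by apply: subgroupM => //; [exact: subgroupV|exact: JN].
have Nw2 : N (w2 ^ g)%g by apply: JN; apply: (N2 N nN); exists x.
rewrite commgEr; apply: (subgroupM sN _ Nw2); apply: JN; exact: subgroupV.
Qed.

(** * Slow growth makes strongly irreducible representations scalar *)

Section SlowIrreducible.
Import GRing.Theory.
Local Open Scope ring_scope.
Variables (G : groupType) (X : set G) (K : fieldType) (n : nat) (H : set G) (rho : G -> 'M[K]_n).
Hypotheses (genX : generated X = setT) (slowX : slow X).
Hypotheses (n0 : (0 < n)%N) (sH : is_subgroup H) (fH : finite_index H).
Hypotheses (rep : is_rep H rho) (irr : strongly_irreducible H rho).

(** For fixed [u] and [v] the matrix of [[~ u, v ^ g]] is multilinear in two copies each of [rho g]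
    and [rho g^-1]. So [scalar_test] finds conjugators in one finite list that does not depend on
    [u] and [v]. *)
Lemma commutator_conjugator_bound : exists c, forall u v, H u -> H v ->
  (exists2 g, H g & ~~ is_scalar_mx (rho [~ u, v ^ g]%g)) ->
  exists g, [/\ H g, lenle X c g & ~~ is_scalar_mx (rho [~ u, v ^ g]%g)].
Proof.
pose r g := rho g; pose ri g := rho g^-1%g.
pose t g := tensor (tensor (tensor (fun g => mxvec (ri g)) (fun g => mxvec (r g)))
   (fun g => mxvec (ri g))) (fun g => mxvec (r g)) g.
have [s [sH' sT]] := scalar_test H t.
have [c Hc] : exists c, forall x, x \in s -> lenle X c x.
  by apply: lenle_unif => x _; rewrite genX.
exists c => u v Hu Hv [g Hg ng]; apply: contrapT => no.
pose A g := (rho u^-1%g *m ri g *m rho v^-1%g) *m (r g *m rho u) *m (ri g *m rho v) *m r g.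
have AE x : H x -> A x = rho [~ u, v ^ x]%g.
  move=> Hx; rewrite /A /r /ri -!(repM rep);
    do ?by [do ?[apply: (subgroupM sH)|apply: (subgroupV sH)]].
  by congr rho; rewrite /commg /conjg !gnorm.
have lA : linform_mx t A.
  apply: linform_mxM; last exact: linform_mxvec.
  apply: linform_mxM; last by apply: linform_mxMr; exact: linform_mxvec.
  apply: linform_mxM; last by apply: linform_mxMr; exact: linform_mxvec.
  by apply: linform_mxMr; apply: linform_mxMl; exact: linform_mxvec.
move/negP: ng; apply; rewrite -AE //; apply: sT lA _ _ Hg => x xs.
rewrite AE; last exact: sH'.
by apply: contrapT => /negP nx; apply: no; exists x; split=> //; [exact: sH'|exact: Hc].
Qed.

Lemma slow_irreducible_scalar x : H x -> is_scalar_mx (rho x).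
Proof.
move=> Hx; apply: contrapT => /negP nx.
have [a [Ha na Hcomm]] := exists_nonscalar_commutators n0 sH fH rep irr Hx nx.
have [c Hc] := commutator_conjugator_bound.
pose P w := normal_closure H a w /\ ~~ is_scalar_mx (rho w).
have NH w : normal_closure H a w -> H w by exact: normal_closure_sub.
have sN : is_subgroup (normal_closure H a) by exact: is_subgroup_normal_closure.
have NJ w g : normal_closure H a w -> H g -> normal_closure H a (w ^ g)%g by exact: normal_closureJ.
have Na : normal_closure H a a by exact: normal_closure_self.
have PP u v : P u -> P v -> exists2 g, lenle X c g & P [~ u, v ^ g]%g.
  move=> [Nu nu] [Nv nv]; have [g [Hg lg ng]] := Hc _ _ (NH _ Nu) (NH _ Nv) (Hcomm _ _ Nu Nv nu nv).
  exists g => //; split=> //; apply: (subgroupR sN Nu); exact: NJ.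
pose S := projective_stabilizer H rho a.
have sS : is_subgroup S by exact: is_subgroup_projective_stabilizer.
have infS : ~ finite_index S.
  by move=> fS; move/negP: na; apply; exact: (finite_projective_orbit_scalar n0 sH rep irr Ha fS).
have [m Hm] := (finite_index_at_most H).1 fH.
have [la Hla] : exists la, lenle X la a by apply: generated_lenle; rewrite genX.
have Pleaf h : H h -> ~ S h -> P [~ a, h]%g.
  move=> Hh nS; split.
    by rewrite commgEl; exact: (subgroupM sN (subgroupV sN Na) (NJ _ _ Na Hh)).
  apply/negP => /is_scalar_mxP[d Ed]; apply: nS; split=> //; exists d.
  have -> : (a ^ h = a * [~ a, h])%g by rewrite commgEl mulVKg.
  by rewrite (repM rep) ?Ed ?mul_mx_scalar //; exact: subgroupR.
have [A HA] : exists A, forall Q, (0 < Q)%N -> exists k w,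
    [/\ P w, lenle X (4 ^ k * ((la.*2 + (m * Q).*2.*2) + k * c)) w,
      (2 ^ k <= (Q + 2) ^ A)%N &
      forall N, is_normal_subgroup N -> index_at_most N Q -> N w].
  exists (((m + 1) * 2) + 1)%N => Q Q0.
  (* [f] gives [m * Q + 1] elements in distinct cosets of the projective stabilizer, of length at
     most [m * Q]. As [H] meets a normal subgroup of index at most [Q] in index at most [m * Q],
     some leaf falls into that subgroup. *)
  have [f [fX fS]] := @infinite_index_ball G X S (m * Q) genX sS infS.
  have [M Mdef] : exists M, M = (m * Q).+1 by eexists.
  pose ok (ij : nat * nat) := (ij.1 < ij.2)%N && `[< H ((f ij.1)^-1 * f ij.2)%g >].
  pose s := [seq [~ a, (f ij.1)^-1 * f ij.2]%g | ij <- [seq ij <- [seq (i, j) | i <- iota 0 M, j <- iota 0 M] | ok ij]].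
  have hit N : is_normal_subgroup N -> index_at_most N Q -> exists2 y, y \in s & N y.
    move=> [sN' JN] iN.
    have [i [j [ij jM [Hij Nij]]]] := index_pigeonhole f (is_subgroupI sH sN') (index_at_mostI sH sN' Hm iN).
    exists [~ a, (f i)^-1 * f j]%g.
      apply/mapP; exists (i, j) => //; rewrite mem_filter /ok /= ij; apply/andP; split; first exact/asboolP.
      by apply: allpairs_f; rewrite mem_iota Mdef; lia.
    rewrite commgEr; apply: subgroupM => //; rewrite conjVg; apply: subgroupV => //; exact: JN.
  have sM : (size s <= M * M)%N.
    by rewrite size_map size_filter (leq_trans (count_size _ _)) // size_allpairs size_iota.
  (* [2 ^ k] exceeds the number [M * M] of pairs by a factor of at most 2, so the growth factor
     [4 ^ k] of the tree is polynomial in [Q]. *)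
  pose k := (trunc_log 2 (M * M)).+1.
  have MM : (0 < M * M)%N by rewrite muln_gt0 Mdef.
  have /andP[k1 k2] := trunc_log_bounds (isT : (1 < 2)%N) MM.
  have s0 : (0 < size s)%N.
    have iT : index_at_most [set: G] Q.
      apply: (@index_at_mostW _ _ 1 Q) => //; apply: (@covers_index _ _ [:: 1%g]) => // g.
      by exists 1%g; rewrite ?inE.
    have nT : is_normal_subgroup [set: G] by split.
    by have [y ys _] := hit _ nT iT; case: (s) ys.
  have [||w [Pw lw Nw]] := @commutator_tree G X P c PP k (la.*2 + (m * Q).*2.*2) s.
  - by rewrite s0 (leq_trans sM) // ltnW.
  - move=> y /mapP[[i j]]; rewrite mem_filter => /andP[/andP[/= ij /asboolP Hij]].
    move=> /allpairsP[[i' j'] /= [iM jM [ei ej]]] ->; rewrite {}ei {}ej in ij Hij *.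
    rewrite !mem_iota Mdef in iM jM.
    split; first by apply: Pleaf => //; apply: fS; lia.
    by apply: lenleW (lenleR Hla (lenleM (lenleV (fX i' _)) (fX j' _))); lia.
  exists k, w; split=> //; last by move=> N nN iN; apply: Nw => //; exact: hit.
  rewrite expnS expnD expn1 mulnC leq_mul //; last by lia.
  have MQ : (M <= (Q + 2) ^ (m + 1))%N.
    by rewrite Mdef addn1 expnS; have := expn_ge Q m; nia.
  by apply: leq_trans k1 _; rewrite expnM -mulnn leq_mul.
have [Q Q0 HQ] := slowX (A * 2 + (la.*2 + m * 4 + c) + 1 + A)%N.
have [k [w [[Nw nw] lw kA NwQ]]] := HA Q Q0.
have [||N [nN iN NNw]] := HQ w.
- by move=> w1; move: nw; rewrite w1 (rep1 rep) scalar_mx_is_scalar.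
- apply: lenleW lw.
  have k2 : (k <= (Q + 2) ^ A)%N by apply: leq_trans kA; apply/ltnW/ltn_expl.
  have P1 : (0 < (Q + 2) ^ A)%N by rewrite expn_gt0 addn2.
  rewrite (_ : 4 = 2 ^ 2)%N // -expnM mulnC [(2 * k)%N]mulnC expnM.
  rewrite -!addnA (expnD _ (A * 2)) mulnC leq_mul //.
    by rewrite (expnM _ A); apply: leq_exp2rW.
  rewrite !addnA (expnD _ _ A) (expnD _ _ 1) expn1 -mulnA.
  apply: leq_trans (leq_mul (ltnW (expn_ge Q _)) (leqnn _)).
  nia.
by apply: NNw; exact: NwQ.
Qed.
End SlowIrreducible.

(** * Triangularization *)

Section Triangularization.
Import GRing.Theory.
Local Open Scope ring_scope.
Variables (G : groupType) (X : set G).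
Hypotheses (genX : generated X = setT) (slowX : slow X).

Lemma invmx_mul (L : fieldType) n (A B : 'M[L]_n) : A \in unitmx -> B \in unitmx ->
  invmx (A *m B) = invmx B *m invmx A.
Proof.
move=> uA uB; have uAB : A *m B \in unitmx by rewrite unitmx_mul uA.
by rewrite -[RHS]mulmx1 -(mulmxV uAB) !mulmxA mulmxKV // mulVmx // mul1mx.
Qed.

(** The base change [row_ebase U] makes [U] the span of the first [r] basis vectors; the last
    equation says that the upper right block vanishes. *)
Lemma reducible_flag (L : fieldType) n (U : 'M[L]_n) :
  U <> 0 -> ~ row_full U -> exists r (P : 'M[L]_n), [/\ (0 < r < n)%N, P \in unitmx &
    forall A : 'M[L]_n, (U *m A <= U)%MS ->
      (pid_mx r : 'M[L]_n) *m (P *m A *m invmx P) *m copid_mx r = 0].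
Proof.
move=> U0 nU; exists (\rank U), (row_ebase U); split.
- rewrite lt0n mxrank_eq0; apply/andP; split; first exact/eqP.
  by rewrite ltn_neqAle rank_leq_col andbT; apply/negP.
- exact: row_ebase_unit.
- move=> A UA; have uP := row_ebase_unit U.
  have E : (U :=: (pid_mx (\rank U) : 'M[L]_n) *m row_ebase U)%MS.
    rewrite -{1}(mulmx_ebase U) -mulmxA; apply: eqmxMfull.
    by rewrite row_full_unit col_ebase_unit.
  have : ((pid_mx (\rank U) : 'M[L]_n) *m row_ebase U *m A <= (pid_mx (\rank U) : 'M[L]_n) *m row_ebase U)%MS.
    by rewrite -(eqmxMr A E) -E.
  move=> /submxP[D ED]; rewrite !mulmxA ED mulmxA -[D *m _ *m _ *m _]mulmxA mulmxV // mulmx1.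
  by rewrite -mulmxA mul_pid_mx_copid ?mulmx0 // rank_leq_row.
Qed.

(** Induction on the degree. A strongly irreducible representation is scalar; otherwise an extension
    field and a subgroup of finite index give two smaller diagonal blocks. The second block is
    treated over the field and subgroup obtained for the first, so that both become triangular
    together. *)
Lemma triangularizable n (K : fieldType) H (rho : G -> 'M[K]_n) :
  is_subgroup H -> finite_index H -> is_rep H rho ->
  exists (L : fieldType) (phi : {rmorphism K -> L}) H1 (P : 'M[L]_n),
    [/\ is_subgroup H1, H1 `<=` H, finite_index H1, P \in unitmx &
      forall g, H1 g -> is_trig_mx (P *m map_mx phi (rho g) *m invmx P)].
Proof.
have [m] := ubnP n; elim: m n K H rho => // m IH n K H rho nm sH fH rep.
have scal_trig (L : fieldType) (A : 'M[L]_n) : is_scalar_mx A -> is_trig_mx A.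
  by move=> /is_scalar_mxP[a ->]; exact: scalar_mx_is_trig.
case: (posnP n) => [nz|n0].
  exists K, idfun, H, 1%:M; split=> //; first exact: unitmx1.
  by move=> g _; apply/is_trig_mxP => i; have := ltn_ord i; rewrite {2}nz.
case: (pselect (strongly_irreducible H rho)) => [irr|nirr].
  exists K, idfun, H, 1%:M; split=> //; first exact: unitmx1.
  move=> g Hg; apply: scal_trig; rewrite mul1mx invmx1 mulmx1 map_mx_id //.
  exact: (slow_irreducible_scalar genX slowX n0 sH fH rep irr).
have [L [phi [H1 [s1 H1H f1 [U [U1 U0 Uf]]]]]] : exists (L : fieldType) (phi : {rmorphism K -> L}) H1,
    [/\ is_subgroup H1, H1 `<=` H, finite_index H1 & exists U : 'M[L]_n,
      [/\ forall g, H1 g -> (U *m map_mx phi (rho g) <= U)%MS, U <> 0 & ~ row_full U]].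
  apply: contrapT => no; apply: nirr => L phi H1 s1 H1H f1 U U1.
  apply: contrapT => /not_orP[U0 Uf]; apply: no.
  by exists L, phi, H1; split=> //; exists U.
have [r [P [/andP[r0 rn] uP Pflag]]] := reducible_flag U0 Uf.
have {}Pflag g (H1g : H1 g) := Pflag _ (U1 g H1g).
have {U U1 U0 Uf nirr scal_trig n0} repL := is_repS H1H (is_rep_map phi rep).
set R := fun g => map_mx phi (rho g) in repL.
have repB : is_rep H1 (fun g => P *m R g *m invmx P).
  split; first by rewrite (rep1 repL) mulmx1 mulmxV.
  by move=> g h Hg Hh; rewrite (repM repL) // !mulmxA mulmxKV.
have {}Pflag g : H1 g -> (pid_mx r : 'M[L]_n) *m (P *m R g *m invmx P) *m copid_mx r = 0 := Pflag g.
have [s En] : exists s, n = (r + s)%N by exists (n - r)%N; rewrite subnKC // ltnW.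
subst n; set B := fun g => P *m R g *m invmx P in repB Pflag.
have Bur g : H1 g -> ursubmx (B g) = 0.
  move=> H1g; have := Pflag g H1g; rewrite -/(B g) -[B g]submxK /copid_mx !pid_mx_block.
  rewrite (scalar_mx_block r s 1) opp_block_mx add_block_mx !mulmx_block.
  rewrite !(mul0mx, mul1mx, mulmx0, mulmx1, addr0, add0r, subrr, subr0, oppr0).
  by move=> /(congr1 ursubmx); rewrite !block_mxKur => ->; apply/matrixP => i j; rewrite !mxE.
pose B1 g := ulsubmx (B g); pose B2 g := drsubmx (B g).
have Bblock g : H1 g -> B g = block_mx (B1 g) 0 (dlsubmx (B g)) (B2 g).
  by move=> H1g; rewrite -{1}[B g]submxK Bur.
have B1M g h : H1 g -> H1 h -> B (g * h)%g =
    block_mx (B1 g *m B1 h) 0 (dlsubmx (B g) *m B1 h + B2 g *m dlsubmx (B h)) (B2 g *m B2 h).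
  move=> Hg Hh; rewrite (repM repB) // (Bblock g) // (Bblock h) // mulmx_block.
  by rewrite !(mul0mx, mulmx0, addr0, add0r) !block_mxKdl.
have rep1' : is_rep H1 B1.
  split; first by rewrite /B1 (rep1 repB) (scalar_mx_block r s 1) block_mxKul.
  by move=> g h Hg Hh; rewrite {1}/B1 B1M // block_mxKul.
have rep2' : is_rep H1 B2.
  split; first by rewrite /B2 (rep1 repB) (scalar_mx_block r s 1) block_mxKdr.
  by move=> g h Hg Hh; rewrite {1}/B2 B1M // block_mxKdr.
have [L2 [phi2 [H2 [P1 [s2 H2H1 f2 uP1 T1]]]]] := IH r L H1 B1 (leq_trans rn nm) s1 f1 rep1'.
have sm : (s < m)%N by clear -nm r0; lia.
have [L3 [phi3 [H3 [P2 [s3 H3H2 f3 uP2 T2]]]]] :=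
  IH s L2 H2 _ sm s2 f2 (is_repS H2H1 (is_rep_map phi2 rep2')).
pose psi : {rmorphism L -> L3} := phi3 \o phi2.
pose Q := block_mx (map_mx phi3 P1) 0 0 P2.
have uQ : Q \in unitmx by rewrite block_diag_mx_unit map_unitmx uP1.
have uPP : map_mx psi P \in unitmx by rewrite map_unitmx.
exists L3, (psi \o phi), H3, (Q *m map_mx psi P); split=> //.
- by move=> g /H3H2/H2H1/H1H.
- by rewrite unitmx_mul uQ.
move=> g H3g; have H2g := H3H2 _ H3g; have H1g := H2H1 _ H2g.
have -> : Q *m map_mx psi P *m map_mx (psi \o phi) (rho g) *m invmx (Q *m map_mx psi P) =
    Q *m map_mx psi (B g) *m invmx Q.
  rewrite invmx_mul // /B !map_mxM map_invmx /R -!map_mx_comp !mulmxA //.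
rewrite Bblock // map_block_mx invmx_block_diag // !mulmx_block.
rewrite !(mul0mx, mulmx0, addr0, add0r, map_mx0).
rewrite is_trig_block_mx //; apply/and3P; split=> //.
  have := T1 g H2g.
  have -> : map_mx phi3 P1 *m map_mx psi (B1 g) *m invmx (map_mx phi3 P1) =
      map_mx phi3 (P1 *m map_mx phi2 (B1 g) *m invmx P1).
    by rewrite !map_mxM map_invmx -map_mx_comp.
  by move=> /is_trig_mxP T; apply/is_trig_mxP => i j ij; rewrite mxE T // rmorph0.
by have := T2 g H3g; rewrite -map_mx_comp.
Qed.
End Triangularization.

(** * Triangular groups *)

Section CommutativeModulo.
Local Open Scope group_scope.
Variables (G : groupType) (W N : set G).
Hypotheses (sW : is_subgroup W) (sN : is_subgroup N).
Hypotheses (NJ : forall n w, N n -> W w -> N (n ^ w)).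
Hypotheses (NC : forall a b, W a -> W b -> N [~ a, b]).

Definition eqmod (a b : G) := N (a^-1 * b).

Lemma eqmod_refl a : eqmod a a.
Proof. by rewrite /eqmod mulVg; exact: subgroup1. Qed.

Lemma eqmod_sym a b : eqmod a b -> eqmod b a.
Proof. by rewrite /eqmod => /(subgroupV sN); rewrite invgM invgK. Qed.

Lemma eqmod_trans b a c : eqmod a b -> eqmod b c -> eqmod a c.
Proof.
rewrite /eqmod => ab bc; have -> : a^-1 * c = (a^-1 * b) * (b^-1 * c) by rewrite !mulgA mulgK.
exact: subgroupM.
Qed.

Lemma eqmodM a a' b b' : W b -> eqmod a a' -> eqmod b b' -> eqmod (a * b) (a' * b').
Proof.
rewrite /eqmod => Wb aa' bb'.
have -> : (a * b)^-1 * (a' * b') = (a^-1 * a') ^ b * (b^-1 * b') by rewrite /conjg !gnorm.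
by apply: subgroupM => //; exact: NJ.
Qed.

Lemma eqmodC a b : W a -> W b -> eqmod (a * b) (b * a).
Proof.
move=> Wa Wb; rewrite /eqmod; have -> : (a * b)^-1 * (b * a) = [~ b, a] by rewrite /commg /conjg !gnorm.
exact: NC.
Qed.

Variables (F : nat -> G) (k m : nat).
Hypotheses (k0 : (0 < k)%N) (WF : forall t, W (F t)).
Hypotheses (Fk : forall t, eqmod (F (t + k)) (F t)) (Fm : forall t, N (F t ^+ m)).

Lemma eqmod_modn t : eqmod (F t) (F (t %% k)).
Proof.
rewrite {1}(divn_eq t k); elim: (t %/ k) => [|q IH]; first by rewrite mul0n add0n; exact: eqmod_refl.
apply: eqmod_trans IH; rewrite (_ : q.+1 * k + t %% k = q * k + t %% k + k)%N; [exact: Fk|lia].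
Qed.

Let WP (l : seq nat) c : W (\prod_(r <- l) F r ^+ c r).
Proof. by apply: subgroup_prod => // r _; exact: subgroupX. Qed.

Lemma eqmod_insert r0 (l : seq nat) c : uniq l -> r0 \in l ->
  eqmod (F r0 * \prod_(r <- l) F r ^+ c r) (\prod_(r <- l) F r ^+ (c r + (r == r0))).
Proof.
elim: l => [//|a l IH] /= /andP[al ul]; rewrite inE !big_cons => /orP[/eqP->|r0l].
  rewrite eqxx addn1 expgS mulgA (eq_big_seq (fun r => F r ^+ (c r + (r == a)))); first exact: eqmod_refl.
  move=> r rl; rewrite (_ : (r == a) = false) ?addn0 //.
  by apply: contraNF al => /eqP <-.
rewrite (_ : (a == r0) = false) ?addn0; last by apply: contraNF al => /eqP->.
have Wa : W (F a ^+ c a) by exact: subgroupX.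
rewrite mulgA; apply: (@eqmod_trans (F a ^+ c a * F r0 * \prod_(r <- l) F r ^+ c r)).
  apply: eqmodM; [exact: WP|exact: eqmodC|exact: eqmod_refl].
rewrite -mulgA; apply: eqmodM; [by apply: subgroupM|exact: eqmod_refl|exact: IH].
Qed.

Let residues (s : seq nat) r := count (fun t => t %% k == r) s.

Lemma eqmod_prod_residues s :
  eqmod (\prod_(t <- s) F t) (\prod_(r <- iota 0 k) F r ^+ residues s r).
Proof.
elim: s => [|t s IH].
  by rewrite big_nil big1_seq ?eqmod_refl //; exact: eqmod_refl.
rewrite big_cons; apply: (@eqmod_trans (F (t %% k) * \prod_(r <- iota 0 k) F r ^+ residues s r)).
  by apply: eqmodM; [apply: subgroup_prod|exact: eqmod_modn|].
apply: eqmod_trans (eqmod_insert _ (iota_uniq 0 k) _) _; first by rewrite mem_iota /= add0n ltn_mod.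
rewrite (eq_bigr (fun r => F r ^+ residues (t :: s) r)); first exact: eqmod_refl.
by move=> r _; rewrite /residues /= addnC eq_sym.
Qed.

Lemma eqmod_expg_modn r c : eqmod (F r ^+ c) (F r ^+ (c %% m)).
Proof.
rewrite {1}(divn_eq c m) mulnC expgnDr expgnA.
have {2}-> : F r ^+ (c %% m) = 1 * F r ^+ (c %% m) by rewrite mul1g.
apply: eqmodM; [exact: subgroupX| |exact: eqmod_refl].
by apply: eqmod_sym; rewrite /eqmod invg1 mul1g; apply: subgroupX => //.
Qed.

(** Modulo [N] the factors commute, are periodic in [t] with period [k], and have order dividing
    [m]. The product thus depends only on how often each residue modulo [k] occurs, counted modulo
    [m]. *)
Lemma eqmod_prod_counts s s' : (forall r, (r < k)%N -> residues s r = residues s' r %[mod m]) ->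
  eqmod (\prod_(t <- s) F t) (\prod_(t <- s') F t).
Proof.
move=> Es; apply: eqmod_trans (eqmod_prod_residues s) _.
apply: eqmod_trans _ (eqmod_sym (eqmod_prod_residues s')).
have : forall r, r \in iota 0 k -> (r < k)%N by move=> r; rewrite mem_iota.
elim: (iota 0 k) => [|r l IH] lk; first by rewrite !big_nil; exact: eqmod_refl.
have Wr c : W (F r ^+ c) by exact: subgroupX.
rewrite !big_cons; apply: eqmodM; [exact: WP| |].
  apply: eqmod_trans (eqmod_expg_modn _ _) _.
  by rewrite Es ?lk ?mem_head //; apply/eqmod_sym/eqmod_expg_modn.
by apply: IH => u ul; apply: lk; rewrite inE ul orbT.
Qed.
End CommutativeModulo.

(** Pigeonhole: there are [2 ^ (Q ^ 4)] sets and [Q ^ (Q ^ 3)] tables of counts indexed by [k], [m]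
    and [r], and [Q < 2 ^ Q]. *)
Lemma residue_collision Q : 0 < Q -> exists S S' : {set 'I_(Q ^ 4)}, S != S' /\
  forall k m r, 0 < k <= Q -> 0 < m <= Q -> r < k ->
    count (fun t => t %% k == r) (map val (enum S)) =
    count (fun t => t %% k == r) (map val (enum S')) %[mod m].
Proof.
case: Q => // q _; set Q := q.+1.
pose cnt (S : {set 'I_(Q ^ 4)}) k r := count (fun t => t %% k == r) (map val (enum S)).
pose F (S : {set 'I_(Q ^ 4)}) : {ffun 'I_Q * 'I_Q * 'I_Q -> 'I_Q} :=
  [ffun kmr : 'I_Q * 'I_Q * 'I_Q => inord (cnt S kmr.1.1.+1 kmr.2 %% kmr.1.2.+1)].
have /injectivePn[S [S' SS' E]] : ~~ injectiveb F.
  apply/negP => /injectiveP/leq_card.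
  rewrite card_ffun !card_prod !card_ord -cardsT -powersetT card_powerset cardsT card_ord leqNgt.
  move=> /negP; apply.
  rewrite (_ : Q ^ 4 = Q * (Q * Q * Q)); last by rewrite !expnS expn0 muln1 !mulnA.
  by rewrite (expnM 2) ltn_exp2r ?muln_gt0 //; exact: ltn_expl.
exists S, S'; split=> // k m r /andP[k0 kQ] /andP[m0 mQ] rk.
have lk : k.-1 < Q by rewrite prednK.
have lm : m.-1 < Q by rewrite prednK.
have lr : r < Q by apply: leq_trans kQ.
have /ffunP/(_ (Ordinal lk, Ordinal lm, Ordinal lr)) := E; rewrite !ffunE /= !prednK //.
have b c : c %% m < Q by apply: leq_trans mQ; rewrite ltn_mod.
by move=> /(congr1 val); rewrite /= !inordK.
Qed.

(** * A weight filtration below the diagonal *)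

Section WeightFiltration.
Import GRing.Theory.
Local Open Scope ring_scope.
Variables (L : fieldType) (d : nat).
Implicit Types (A M N : 'M[L]_d) (i j : 'I_d).

(* Orders the positions below the diagonal by distance to the diagonal, then by column. *)
Definition weight (i j : nat) := ((i - j) * d + j)%N.

Definition lower k M := forall i j, (i <= j)%N || (weight i j < k)%N -> M i j = 0.

Lemma weight_lt i j : (weight i j < d * d)%N.
Proof. by rewrite /weight; have := ltn_ord i; have := ltn_ord j; nia. Qed.

(** At an entry of weight at most [k], every off-diagonal term of the product involves an entry of
    [M] in the same column but nearer to the diagonal, hence of smaller weight. *)
Lemma lower_mull k A M : is_trig_mx A -> lower k M ->
  lower k (A *m M) /\ forall i j, (j < i)%N -> (weight i j <= k)%N -> (A *m M) i j = A i i * M i j.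
Proof.
move=> /is_trig_mxP tA lM.
have E i j : (i <= j)%N || (weight i j <= k)%N -> (A *m M) i j = A i i * M i j.
  move=> ijk; rewrite mxE (bigD1 i) //= big1 ?addr0 // => l li.
  case: (ltngtP i l) => [il|il|/val_inj il]; last by rewrite il eqxx in li.
    by rewrite tA // mul0r.
  rewrite lM ?mulr0 //; case: (leqP l j) => //= jl.
  have := ltn_ord l; case/orP: ijk; rewrite /weight; nia.
split=> [i j ijk|i j _ w]; last by rewrite E // w orbT.
rewrite E ?lM ?mulr0 //; case/orP: ijk => [->//|/ltnW->]; exact: orbT.
Qed.

Lemma lower_mulr k A M : is_trig_mx A -> lower k M ->
  lower k (M *m A) /\ forall i j, (j < i)%N -> (weight i j <= k)%N -> (M *m A) i j = M i j * A j j.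
Proof.
move=> /is_trig_mxP tA lM.
have E i j : (i <= j)%N || (weight i j <= k)%N -> (M *m A) i j = M i j * A j j.
  move=> ijk; rewrite mxE (bigD1 j) //= big1 ?addr0 // => l lj.
  case: (ltngtP l j) => [jl|jl|/val_inj jl]; last by rewrite jl eqxx in lj.
    by rewrite tA // mulr0.
  rewrite lM ?mul0r //; case: (leqP i l) => //= il.
  have := ltn_ord l; case/orP: ijk; rewrite /weight; nia.
split=> [i j ijk|i j _ w]; last by rewrite E // w orbT.
rewrite E ?lM ?mul0r //; case/orP: ijk => [->//|/ltnW->]; exact: orbT.
Qed.

Lemma lower_trig k M : lower k M -> is_trig_mx M.
Proof. by move=> lM; apply/is_trig_mxP => i j ij; apply: lM; rewrite ltnW. Qed.

Lemma lower_diag k M i : lower k M -> M i i = 0.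
Proof. by apply; rewrite leqnn. Qed.

Lemma lowerD k M N : lower k M -> lower k N -> lower k (M + N).
Proof. by move=> lM lN i j ij; rewrite mxE lM ?lN ?addr0. Qed.

Lemma lowerN k M : lower k M -> lower k (- M).
Proof. by move=> lM i j ij; rewrite mxE lM ?oppr0. Qed.

Lemma lowerW k l M : (l <= k)%N -> lower k M -> lower l M.
Proof.
by move=> lk lM i j /orP[ij|w]; apply: lM; rewrite ?ij // (leq_trans w lk) orbT.
Qed.

Lemma lower_max M : lower (d * d) M -> M = 0.
Proof. by move=> lM; apply/matrixP => i j; rewrite mxE lM // weight_lt orbT. Qed.

Lemma lowerS k M : lower k M -> (forall i j, (j < i)%N -> weight i j = k -> M i j = 0) -> lower k.+1 M.
Proof.
move=> lM Mk i j; case: (leqP i j) => [ij _|ji /=]; first by apply: lM; rewrite ij.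
by rewrite ltnS leq_eqVlt => /orP[/eqP/Mk->//|w]; apply: lM; rewrite w orbT.
Qed.
End WeightFiltration.

(** * Characters of a triangular group on its unipotent filtration *)

Section Triangular.
Import GRing.Theory.
Local Open Scope ring_scope.
Variables (G : groupType) (L : fieldType) (d : nat) (H : set G) (f : G -> 'M[L]_d).
Hypotheses (sH : is_subgroup H) (rep : is_rep H f).
Hypothesis trig : forall g, H g -> is_trig_mx (f g).
Hypothesis faithful : forall g, H g -> f g = 1%:M -> g = 1%g.
Implicit Types (g h x y z : G) (i j : 'I_d).

(** [unip 0] consists of the unipotent elements of [H], and [unip (d * d)] is trivial by
    faithfulness. *)
Definition unip k := [set g | H g /\ lower k (f g - 1%:M)].

(** The character by which conjugation scales the entry of weight [k] at [i], [j] on [unip k]; see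
    [unip_entryJ]. *)
Definition psi i j g := f g^-1%g i i * f g j j.

Lemma trig_diagM A B i : is_trig_mx A -> is_trig_mx B -> (A *m B : 'M[L]_d) i i = A i i * B i i.
Proof.
move=> /is_trig_mxP tA /is_trig_mxP tB; rewrite mxE (bigD1 i) //= big1 ?addr0 // => l li.
case: (ltngtP i l) => [il|il|/val_inj il]; last by rewrite il eqxx in li.
- by rewrite tA // mul0r.
- by rewrite tB // mulr0.
Qed.

Lemma diagM g h i : H g -> H h -> f (g * h)%g i i = f g i i * f h i i.
Proof. by move=> Hg Hh; rewrite (repM rep) // trig_diagM //; exact: trig. Qed.

Lemma diag1 i : f 1%g i i = 1. Proof. by rewrite (rep1 rep) mxE eqxx. Qed.

Lemma diagVK g i : H g -> f g^-1%g i i * f g i i = 1.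
Proof. by move=> Hg; rewrite -diagM ?mulVg ?diag1 //; exact: subgroupV. Qed.

Lemma psi1 i j : psi i j 1%g = 1. Proof. by rewrite /psi invg1 !diag1 mulr1. Qed.

Lemma psiM i j g h : H g -> H h -> psi i j (g * h)%g = psi i j g * psi i j h.
Proof.
move=> Hg Hh; rewrite /psi invgM !diagM //; do ?exact: subgroupV.
ring.
Qed.

Lemma psiV i j g : H g -> psi i j g^-1%g * psi i j g = 1.
Proof. by move=> Hg; rewrite -psiM ?mulVg ?psi1 //; exact: subgroupV. Qed.

Lemma psiX i j g n : H g -> psi i j (g ^+ n)%g = psi i j g ^+ n.
Proof.
move=> Hg; elim: n => [|n IH]; first by rewrite psi1.
by rewrite expgS psiM ?IH ?exprS //; exact: subgroupX.
Qed.

Lemma offdiag1 g i j : (j < i)%N -> (f g - 1%:M) i j = f g i j.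
Proof.
move=> ji; rewrite !mxE (_ : (i == j) = false) ?subr0 //.
by apply/eqP => E; rewrite E ltnn in ji.
Qed.

(** In [f (x * y) - 1] the product of [f x - 1] and [f y - 1] only contributes in weight above [k],
    since [f x - 1] has zero diagonal. *)
Lemma unip_entryM k x y : unip k x -> unip k y -> unip k (x * y)%g /\
  forall i j, (j < i)%N -> (weight d i j <= k)%N -> f (x * y)%g i j = f x i j + f y i j.
Proof.
move=> [Hx lx] [Hy ly].
have E : f (x * y)%g - 1%:M = (f x - 1%:M) + (f y - 1%:M) + (f x - 1%:M) *m (f y - 1%:M).
  rewrite (repM rep) // mulmxBl !mulmxBr !mulmx1 !mul1mx.
  set a := f x *m f y; set b := f x; set c := f y; apply/matrixP => i j; rewrite !mxE.
  by ring.
have [lxy exy] := lower_mull (lower_trig lx) ly.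
split; first split; first exact: subgroupM.
  by rewrite E; exact: lowerD (lowerD lx ly) lxy.
move=> i j ji w; rewrite -offdiag1 // E mxE exy // (lower_diag i lx) mul0r addr0.
by rewrite mxE !offdiag1.
Qed.

Lemma unip_entryJ k x g : unip k x -> H g -> unip k (x ^ g)%g /\
  forall i j, (j < i)%N -> (weight d i j <= k)%N -> f (x ^ g)%g i j = psi i j g * f x i j.
Proof.
move=> [Hx lx] Hg; have Hi := subgroupV sH Hg.
have E : f (x ^ g)%g - 1%:M = f g^-1%g *m (f x - 1%:M) *m f g.
  by rewrite (repJ sH rep) // mulmxBr mulmxBl mulmx1 (repVK sH rep).
have [l1 e1] := lower_mull (trig Hi) lx.
have [l2 e2] := lower_mulr (trig Hg) l1.
split; first by split; [exact: subgroupJ|rewrite E].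
move=> i j ji w; rewrite -offdiag1 // E e2 // e1 // offdiag1 //.
by rewrite /psi mulrAC.
Qed.

Lemma unip1 k : unip k 1%g.
Proof.
by split; [exact: subgroup1|rewrite (rep1 rep) subrr => i j _; rewrite mxE].
Qed.

Lemma unip_entryV k x : unip k x -> unip k x^-1%g /\
  forall i j, (j < i)%N -> (weight d i j <= k)%N -> f x^-1%g i j = - f x i j.
Proof.
move=> [Hx lx]; have Hi := subgroupV sH Hx.
have E : f x^-1%g - 1%:M = - (f x^-1%g *m (f x - 1%:M)).
  by rewrite mulmxBr mulmx1 (repVK sH rep) // opprB.
have [l e] := lower_mull (trig Hi) lx.
have Ui : unip k x^-1%g by split=> //; rewrite E; exact: lowerN.
split=> // i j ji w; have [_ eM] := unip_entryM (conj Hx lx : unip k x) Ui.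
have := eM i j ji w; rewrite mulgV -offdiag1 // (rep1 rep) subrr mxE => /esym.
by move/eqP; rewrite addrC addr_eq0 => /eqP.
Qed.

Lemma is_subgroup_unip k : is_subgroup (unip k).
Proof.
split; [exact: unip1|by move=> x y Ux Uy; case: (unip_entryM Ux Uy)|].
by move=> x Ux; case: (unip_entryV Ux).
Qed.

Lemma unip_entryR k x g : unip k x -> H g -> unip k [~ x, g]%g /\
  forall i j, (j < i)%N -> (weight d i j <= k)%N -> f [~ x, g]%g i j = (psi i j g - 1) * f x i j.
Proof.
move=> Ux Hg; have [Ui ei] := unip_entryV Ux; have [UJ eJ] := unip_entryJ Ux Hg.
have [UM eM] := unip_entryM Ui UJ; rewrite commgEl; split=> // i j ji w.
by rewrite eM // ei // eJ // mulrBl mul1r addrC.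
Qed.

Lemma unipS k x : unip k x -> (forall i j, (j < i)%N -> weight d i j = k -> f x i j = 0) -> unip k.+1 x.
Proof.
move=> [Hx lx] e; split=> //; apply: lowerS => // i j ji w.
by rewrite offdiag1 // e.
Qed.

Lemma unipW k l x : (l <= k)%N -> unip k x -> unip l x.
Proof. by move=> lk [Hx lx]; split=> //; exact: lowerW lx. Qed.

Lemma unip_max x : unip (d * d) x -> x = 1%g.
Proof. by move=> [Hx /lower_max/eqP]; rewrite subr_eq0 => /eqP/(faithful Hx). Qed.

Lemma unip_comm x y : H x -> H y -> unip 0 [~ x, y]%g.
Proof.
move=> Hx Hy; have HR := subgroupR sH Hx Hy; split=> // i j; rewrite orbF leq_eqVlt => /orP[/eqP/val_inj<-|ij].
  have Hxi := subgroupV sH Hx; have Hyi := subgroupV sH Hy.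
  rewrite !mxE eqxx /commg /conjg !diagM //; do ?by [do ?[apply: (subgroupM sH)|apply: (subgroupV sH)]].
  rewrite (_ : _ * _ = (f x^-1%g i i * f x i i) * (f y^-1%g i i * f y i i)); last by ring.
  by rewrite !diagVK // mulr1 subrr.
by rewrite !mxE (is_trig_mxP (trig HR)) // (_ : (i == j) = false) ?subr0 //; apply/eqP => E; rewrite E ltnn in ij.
Qed.

(** Selects the positions at which the filtration really has a nontrivial entry; their characters
    are the ones occurring on it. *)
Definition active i j := (j < i)%N /\ exists2 x, unip (weight d i j) x & f x i j <> 0.

Lemma unip_comm_step k x g : unip k x -> H g ->
  (forall i j, active i j -> weight d i j = k -> psi i j g = 1) -> unip k.+1 [~ x, g]%g.
Proof.
move=> Ux Hg cg; have [UR eR] := unip_entryR Ux Hg; apply: unipS => // i j ji w.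
rewrite eR ?w //; case: (eqVneq (f x i j) 0) => [->|nz]; first by rewrite mulr0.
rewrite cg ?subrr ?mul0r //; split=> //; exists x; first by rewrite w.
exact/eqP.
Qed.

Lemma common_unity_exponent (T : eqType) (s : seq T) (u : T -> L) :
  (forall t, t \in s -> exists2 n, (0 < n)%N & u t ^+ n = 1) ->
  exists2 n, (0 < n)%N & forall t, t \in s -> u t ^+ n = 1.
Proof.
elim: s => [|t s IH] us; first by exists 1%N.
have [n n0 nt] := us t (mem_head _ _).
have [|m m0 ms] := IH; first by move=> v vs; apply: us; rewrite inE vs orbT.
exists (n * m)%N => [|v]; first by rewrite muln_gt0 n0.
rewrite inE => /orP[/eqP->|/ms vm]; first by rewrite exprM nt expr1n.
by rewrite mulnC exprM vm expr1n.
Qed.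

Definition torsion i j := forall y, H y -> exists2 n, (0 < n)%N & psi i j y ^+ n = 1.

Definition psi_kernel (s : seq ('I_d * 'I_d)) :=
  [set g | H g /\ forall p, p \in s -> active p.1 p.2 -> psi p.1 p.2 g = 1].

Lemma is_subgroup_psi_kernel s : is_subgroup (psi_kernel s).
Proof.
split; first by split; [exact: subgroup1|move=> p _ _; rewrite psi1].
  move=> g h [Hg pg] [Hh ph]; split; first exact: subgroupM.
  by move=> p ps ap; rewrite psiM // pg // ph // mulr1.
move=> g [Hg pg]; split; first exact: subgroupV.
by move=> p ps ap; have := psiV p.1 p.2 Hg; rewrite pg // mulr1.
Qed.

(** A first commutator is unipotent. Every further commutator with the kernel advances by one
    weight, as all active characters are trivial there. *)
Lemma psi_kernel_nilpotent : is_nilpotent (psi_kernel (enum {: 'I_d * 'I_d})).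
Proof.
set K := psi_kernel _; have sK : is_subgroup K := is_subgroup_psi_kernel _.
exists (d * d).+1; apply/seteqP; split; last first.
  by move=> _ ->; exact: subgroup1 (is_subgroup_lower_central _ sK).
suff U k : lower_central K k.+1 `<=` unip k by move=> g /U/unip_max.
elim: k => [|k IH]; apply: (generated_min (is_subgroup_unip _)) => _ [x Kx [y [Hy py] <-]].
  by case: Kx => Hx _; exact: unip_comm.
by apply: unip_comm_step => //; [exact: IH|move=> i j aij _; apply: (py (i, j)); rewrite ?mem_enum].
Qed.

(** [H] is finitely generated, so a torsion character has finite exponent and takes values in
    finitely many roots of unity. The kernels are intersected one position at a time. *)
Lemma torsion_virtually_nilpotent (X : set G) : finite_set X -> generated X = setT -> finite_index H ->
  (forall i j, active i j -> torsion i j) -> virtually_nilpotent G.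
Proof.
move=> finX genX fH tors; exists (psi_kernel (enum {: 'I_d * 'I_d})).
split; [exact: is_subgroup_psi_kernel| |exact: psi_kernel_nilpotent].
have [Y [YH schY]] := schreier finX sH fH.
have genY g : H g -> generated [set` Y] g.
  move=> Hg; have /generated_lenle[n lg] : generated X g by rewrite genX.
  exact: lenle_generated (schY _ _ Hg lg).
have one i j : active i j -> exists2 n, (0 < n)%N & forall g, H g -> psi i j g ^+ n = 1.
  move=> aij; have [t /YH/(tors i j aij)//|n n0 nY] := @common_unity_exponent _ Y (psi i j).
  exists n => // g Hg; suff [] : [set g | H g /\ psi i j g ^+ n = 1] g by [].
  apply: (generated_min _ _ (genY g Hg)) => [|y yY]; last by split; [exact: YH|exact: nY].
  split; first by split; [exact: subgroup1|rewrite psi1 expr1n].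
    move=> a b [Ha pa] [Hb pb]; split; first exact: subgroupM.
    by rewrite psiM // exprMn pa pb mulr1.
  move=> a [Ha pa]; split; first exact: subgroupV.
  by have := congr1 (fun c => c ^+ n) (psiV i j Ha); rewrite exprMn pa mulr1 expr1n.
elim: (enum _) => [|p s IH].
  by rewrite (_ : psi_kernel [::] = H) //; apply/seteqP; split=> g; [case|split].
case: (pselect (active p.1 p.2)) => ap; last first.
  apply: (finite_indexS (is_subgroup_psi_kernel s)) IH; first exact: is_subgroup_psi_kernel.
  move=> g [Hg pg]; split=> // q; rewrite inE => /orP[/eqP-> //|]; exact: pg.
have [n n0 pn] := one _ _ ap; have [vals vP] := unity_roots_finite L n0.
apply: (finite_index_fiber (F := psi p.1 p.2) (vals := vals) (is_subgroup_psi_kernel s) IH).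
- exact: is_subgroup_psi_kernel.
- by move=> g [Hg _]; apply: vP; exact: pn.
move=> g h [Hg pg] [Hh ph] E; split; first by apply: subgroupM => //; exact: subgroupV.
have Hi := subgroupV sH Hg.
move=> q; rewrite inE psiM // => /orP[/eqP-> _|qs aq]; first by rewrite -E psiV.
by have := psiV q.1 q.2 Hg; rewrite pg // ph // !mulr1.
Qed.

Lemma subgroup_mod_unip k N : is_normal_subgroup N ->
  is_subgroup [set g | exists2 u, unip k u & N (u^-1 * g)%g].
Proof.
move=> [sN NJ]; split.
- by exists 1%g; [exact: unip1|rewrite invg1 mulg1; exact: subgroup1].
- move=> g h [u Uu Nu] [v Uv Nv]; exists (u * v)%g.
    exact: (subgroupM (is_subgroup_unip k)).
  have -> : ((u * v)^-1 * (g * h) = (u^-1 * g) ^ v * (v^-1 * h))%g by rewrite /conjg !gnorm.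
  by apply: subgroupM => //; exact: NJ.
move=> g [u Uu Nu]; exists u^-1%g; first exact: (subgroupV (is_subgroup_unip k)).
have -> : (u^-1^-1 * g^-1 = ((u^-1 * g)^-1) ^ u^-1)%g by rewrite /conjg !gnorm.
by apply: NJ; exact: subgroupV.
Qed.

Lemma unip_psi1 k i j x : unip k x -> psi i j x = 1.
Proof.
move=> Ux; have [_ lVx] := subgroupV (is_subgroup_unip k) Ux; case: Ux => _ lx.
have D g : lower k (f g - 1%:M) -> f g i i = 1 /\ f g j j = 1.
  by move=> lg; have := lower_diag i lg; have := lower_diag j lg; rewrite !mxE !eqxx;
    move=> /eqP; rewrite subr_eq0 => /eqP-> /eqP; rewrite subr_eq0 => /eqP->.
by rewrite /psi (D _ lVx).1 (D _ lx).2 mulr1.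
Qed.

Lemma unip_comm_unip k x y : unip k x -> unip k y -> unip k.+1 [~ x, y]%g.
Proof.
move=> Ux Uy; apply: unip_comm_step => //; first by case: Uy.
by move=> i j _ _; exact: unip_psi1 Uy.
Qed.

(** * Products of conjugates over colliding exponent sets *)

Section SparseSums.
Variables (k : nat) (x y : G) (i j : 'I_d).
Hypotheses (Ux : unip k x) (Hy : H y) (ji : (j < i)%N) (wk : weight d i j = k).

Lemma conjX_unip t : unip k (x ^ (y ^+ t))%g.
Proof. by have [] := unip_entryJ Ux (subgroupX t sH Hy). Qed.

Lemma conjX_entry t : f (x ^ (y ^+ t))%g i j = psi i j y ^+ t * f x i j.
Proof.
have [_ e] := unip_entryJ Ux (subgroupX t sH Hy).
by rewrite e ?wk // psiX.
Qed.

Lemma prod_conjX_entry (s : seq nat) : unip k (\prod_(t <- s) x ^ (y ^+ t))%g /\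
  f (\prod_(t <- s) x ^ (y ^+ t))%g i j = \sum_(t <- s) psi i j y ^+ t * f x i j.
Proof.
elim: s => [|t s [Us es]].
  by rewrite !big_nil; split; [exact: unip1|rewrite -offdiag1 // (rep1 rep) subrr mxE].
rewrite !big_cons; have [U e] := unip_entryM (conjX_unip t) Us.
by split=> //; rewrite e ?wk // conjX_entry es.
Qed.

Lemma iter_comm_entry z m : unip k z ->
  unip k (iter m (fun w => [~ w, y]%g) z) /\
  f (iter m (fun w => [~ w, y]%g) z) i j = (psi i j y - 1) ^+ m * f z i j.
Proof.
move=> Uz; elim: m => [|m [Um em]] /=; first by rewrite expr0 mul1r.
have [U e] := unip_entryR Um Hy.
by split=> //; rewrite e ?wk // em mulrA exprS.
Qed.

Lemma iter_comm_unip u m : unip k.+1 u ->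
  (forall i' j', active i' j' -> (k < weight d i' j')%N -> psi i' j' y = 1) ->
  unip (k.+1 + m) (iter m (fun w => [~ w, y]%g) u).
Proof.
move=> Uu py; elim: m => [|m IH]; first by rewrite addn0.
rewrite addnS; apply: unip_comm_step => // i' j' aij w; apply: py => //.
by rewrite w ltnS leq_addr.
Qed.

Lemma iter_comm_mod N u z m : is_normal_subgroup N -> N (u^-1 * z)%g ->
  N ((iter m (fun w => [~ w, y]%g) u)^-1 * iter m (fun w => [~ w, y]%g) z)%g.
Proof.
move=> [sN NJ] Nuz; elim: m => [//|m] /=.
move: (iter _ _ u) (iter _ _ z) => a b Nab.
have -> : ([~ a, y]^-1 * [~ b, y] = ((a^-1 * b)^-1) ^ [~ a, y] * (a^-1 * b) ^ y)%g.
  by rewrite /commg /conjg !gnorm.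
by apply: subgroupM => //; apply: NJ => //; exact: subgroupV.
Qed.

(* Modulo [N] and the next filtration step the conjugates of [x] commute, have order at most [Q]
   and are periodic with period at most [Q], so sums over [S] and [S'] cannot be told apart. *)
Lemma collision_trivial Q N (s s' : seq nat) :
  (forall i' j', active i' j' -> (k < weight d i' j')%N -> psi i' j' y = 1) ->
  (forall k m r, (0 < k <= Q)%N -> (0 < m <= Q)%N -> (r < k)%N ->
    count (fun t => t %% k == r)%N s = count (fun t => t %% k == r)%N s' %[mod m]) ->
  is_normal_subgroup N -> index_at_most N Q ->
  N (iter (d * d) (fun w => [~ w, y]%g)
      ((\prod_(t <- s) x ^ (y ^+ t))^-1 * \prod_(t <- s') x ^ (y ^+ t)))%g.
Proof.
move=> py cs nN NQ; have [sN NJ] := nN.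
have period g : exists2 m, (0 < m <= Q)%N & N (g ^+ m)%g.
  have [a [b [ab bQ]]] := index_pigeonhole (fun n => g ^+ n)%g sN NQ.
  rewrite -(subnKC (ltnW ab)) expgnDr mulKg => Ng.
  by exists (b - a)%N => //; rewrite subn_gt0 ab (leq_trans (leq_subr _ _) bQ).
have [p p0 Np] := period y; have [m m0 Nm] := period x.
pose N' := [set g | exists2 u, unip k.+1 u & N (u^-1 * g)%g].
have sN' : is_subgroup N' by exact: subgroup_mod_unip.
have NN' g : N g -> N' g by exists 1%g; [exact: unip1|rewrite invg1 mul1g].
have UN' g : unip k.+1 g -> N' g by exists g => //; rewrite mulVg; exact: subgroup1.
have N'J g w : N' g -> unip k w -> N' (g ^ w)%g.
  move=> [u Uu Nu] [Hw _]; exists (u ^ w)%g; first by have [] := unip_entryJ Uu Hw.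
  by rewrite -conjVg -conjMg; exact: NJ.
have [u Uu Nu] : N' ((\prod_(t <- s) x ^ (y ^+ t))^-1 * \prod_(t <- s') x ^ (y ^+ t))%g.
  apply: (@eqmod_prod_counts G (unip k) N' _ sN' N'J _ (fun t => x ^ (y ^+ t))%g p m).
  - exact: is_subgroup_unip.
  - by move=> a b Ua Ub; apply: UN'; exact: unip_comm_unip.
  - by case/andP: p0.
  - exact: conjX_unip.
  - move=> t; apply: NN'; rewrite expgnDr conjgM.
    have -> (a b : G) : ((a ^ b)^-1 * a = b^-1 * b ^ a)%g by rewrite /conjg !gnorm.
    by apply: subgroupM => //; [exact: subgroupV|exact: NJ].
  - by move=> t; apply: NN'; rewrite -conjXg; exact: NJ.
  by move=> r; apply: cs.
(* On weights above [k] all active characters are trivial at [y], so [d * d] commutators with [y]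
   carry [u] into the trivial term of the filtration. Hence the commutator of the original quotient
   lies in [N]. *)
have := iter_comm_mod (d * d) nN Nu.
suff -> : iter (d * d) (fun w => [~ w, y]%g) u = 1%g by rewrite invg1 mul1g.
by apply: unip_max; apply: unipW (iter_comm_unip (d * d) Uu py); exact: leq_addl.
Qed.
End SparseSums.

Lemma small_poly_diff D (S S' : {set 'I_D}) : S != S' ->
  exists2 p, small_poly p & forall a : L, (map_poly intr p).[a] =
    \sum_(t <- map val (enum S')) a ^+ t - \sum_(t <- map val (enum S)) a ^+ t.
Proof.
move=> SS'; pose c (t : nat) : int := (t \in map val (enum S'))%:R - (t \in map val (enum S))%:R.
have memv (T : {set 'I_D}) (t : 'I_D) : (val t \in map val (enum T)) = (t \in T).
  by rewrite mem_map ?mem_enum //; exact: val_inj.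
exists (\poly_(t < D) c t).
  split; last first.
    by move=> t; rewrite coef_poly; case: ifP => // _; rewrite /c; do 2!case: (_ \in _).
  apply: contra SS' => /eqP/polyP p0; apply/eqP/setP => t.
  have := p0 (val t); rewrite coef_poly ltn_ord coef0 /c !memv.
  by do 2!case: (_ \in _).
move=> a; rewrite poly_def raddf_sum horner_sum.
have E (T : {set 'I_D}) : \sum_(t <- map val (enum T)) a ^+ t = \sum_(t < D) (t \in T)%:R * a ^+ t.
  rewrite big_map big_enum big_mkcond; apply: eq_bigr => t _.
  by case: (t \in T); rewrite ?mul1r ?mul0r.
rewrite !E -sumrB; apply: eq_bigr => t _.
rewrite /= map_polyZ map_polyXn hornerZ hornerXn /c !memv rmorphB !rmorph_nat mulrBl //.
Qed.

Lemma small_poly_XsubC1 : small_poly ('X - 1).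
Proof.
split; first by rewrite -size_poly_gt0 -['X - 1]/('X - 1%:P) size_XsubC.
by move=> t; rewrite coefB coefX coef1; case: t => [|[|t]].
Qed.

Lemma nontorsion_not_slow (X : set G) i j y : generated X = setT -> slow X -> H y -> active i j ->
  (forall n, (0 < n)%N -> psi i j y ^+ n <> 1) ->
  (forall i' j', active i' j' -> (weight d i j < weight d i' j')%N -> torsion i' j') -> False.
Proof.
move=> genX slowX Hy [ji [x Ux xe]] ny tors; set k := weight d i j in Ux tors.
pose later p := `[< active p.1 p.2 >] && (k < weight d p.1 p.2)%N.
(* Two powers are taken: [s0] makes all later characters trivial, and [s1] then frees the value at
   [i], [j] from small relations. *)
have [|s0 s00 s0P] := @common_unity_exponent _ [seq p <- enum {: 'I_d * 'I_d} | later p]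
  (fun p => psi p.1 p.2 y).
  by move=> p; rewrite mem_filter => /andP[/andP[/asboolP ap kp] _]; exact: tors.
have [||s1 s10 s1P] := @no_small_relation _ (psi i j y ^+ s0).
- apply: expf_neq0; apply/eqP => p0; have := psiV i j Hy.
  by rewrite p0 mulr0 => /esym/eqP; rewrite oner_eq0.
- by move=> n n0; rewrite -exprM; apply/eqP/ny; rewrite muln_gt0 s00.
pose z := (y ^+ (s0 * s1))%g.
have Hz : H z by exact: subgroupX.
have psiz : psi i j z = psi i j y ^+ s0 ^+ s1 by rewrite psiX // exprM.
have later1 i' j' : active i' j' -> (k < weight d i' j')%N -> psi i' j' z = 1.
  move=> aij w; rewrite psiX // exprM (s0P (i', j')) ?expr1n //.
  by rewrite mem_filter mem_enum andbT /later /= w andbT; apply/asboolP.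
have len g : exists n, lenle X n g by apply: generated_lenle; rewrite genX.
have [lx lenx] := len x; have [lz lenz] := len z.
(* The word below has length at most [C * Q ^ 8], coming from up to [Q ^ 4] factors with exponents
   up to [Q ^ 4]; this is at most [(Q + 2) ^ (C + 8)]. *)
pose C := (2 ^ (d * d) * (2 * (lx + 2 * lz) + 2 * (d * d * lz)))%N.
have [Q Q0 QP] := slowX (C + 8)%N.
have [S [S' [SS' cS]]] := residue_collision Q0.
pose s (T : {set 'I_(Q ^ 4)}) := map val (enum T).
pose P T := (\prod_(t <- s T) x ^ (z ^+ t))%g.
pose w m := iter m (fun w => [~ w, z]%g) ((P S)^-1 * P S')%g.
have wk : weight d i j = k by [].
have [US eS] := prod_conjX_entry Ux Hz ji wk (s S).
have [US' eS'] := prod_conjX_entry Ux Hz ji wk (s S').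
have [UV eV] := unip_entryV US.
have [U0 e0] := unip_entryM UV US'.
have [_ ew] := iter_comm_entry Hz ji wk (d * d) U0.
(* The entry at [i], [j] is [f x i j] times the value at [psi i j z] of a small polynomial times a
   power of [psi i j z - 1]. All factors are nonzero, ['X - 1] being a small polynomial as well. *)
have wneq : w (d * d)%N <> 1%g.
  have [p sp pE] := small_poly_diff SS'.
  move=> w1; move: ew; rewrite -/(w _) w1 -offdiag1 // (rep1 rep) subrr mxE => /esym/eqP.
  rewrite e0 ?wk // eV ?wk // eS eS' -!mulr_suml (addrC (- _)) -mulrBl -pE psiz.
  rewrite !mulf_eq0 (negPf (s1P _ sp)) (introF eqP xe) !orbF expf_eq0 => /andP[_].
  by have := s1P _ small_poly_XsubC1; rewrite rmorphB /= map_polyX rmorph1 hornerD hornerX hornerN hornerC => /negPf->.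
have lenP T : lenle X (Q ^ 4 * (lx + (Q ^ 4 * lz).*2)) (P T).
  apply: (@lenleW _ _ (size (s T) * (lx + (Q ^ 4 * lz).*2))).
    by rewrite leq_mul2r size_map -cardE orbC (leq_trans (max_card _)) // card_ord.
  apply: lenle_prod => t /mapP[t' _ ->]; apply: lenleJ => //.
  by apply: lenleW (lenleX (val t') lenz); rewrite leq_mul2r (ltnW (ltn_ord t')) orbT.
have lenw m : lenle X (2 ^ m * (2 * (Q ^ 4 * (lx + (Q ^ 4 * lz).*2)) + 2 * (m * lz))) (w m).
  elim: m => [|m IH].
    by rewrite mul1n mul0n muln0 addn0 mul2n -addnn; apply: lenleM => //; exact: lenleV.
  move: (2 * (Q ^ 4 * _))%N IH => A IH; apply: lenleW (lenleR IH lenz).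
  rewrite (expnS 2) (mulSn m); have := expn_gt0 2 m.
  by move: (2 ^ m)%N (m * lz)%N => p B /= p0; nia.
have [|N [nN NQ]] := QP _ wneq; last by apply; exact: collision_trivial later1 cS nN NQ.
apply: lenleW (lenw _).
apply: (@leq_trans (C * Q ^ 8)).
  rewrite /C -(mulnA (2 ^ _)%N) leq_mul2l; apply/orP; right.
  have : (0 < Q ^ 4)%N by rewrite expn_gt0 Q0.
  rewrite (expnD Q 4 4); move: (Q ^ 4)%N (d * d * lz)%N => q E q0.
  have : (q <= q * q)%N by rewrite leq_pmulr.
  by move: (q * q)%N (leq_mul q0 q0) (mulnA q q lz) => qq; nia.
rewrite expnD; apply: leq_mul; first exact: leq_trans (expn_ge Q C).
by apply: leq_exp2rW; exact: leq_addr.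
Qed.

(** Descending induction on the weight: once all later active characters are torsion, a non-torsion
    one is refuted by [nontorsion_not_slow]. *)
Lemma slow_triangular_virtually_nilpotent (X : set G) : finite_set X -> generated X = setT ->
  slow X -> finite_index H -> virtually_nilpotent G.
Proof.
move=> finX genX slowX fH; apply: (torsion_virtually_nilpotent finX genX fH).
suff step m i j : (d * d - weight d i j < m)%N -> active i j -> torsion i j.
  by move=> i j; exact: step (ltnSn _).
elim: m i j => [//|m IH] i j lt aij; apply: contrapT => /existsNP[y /not_implyP[Hy ny]].
apply: (nontorsion_not_slow genX slowX Hy aij).
  by move=> n n0 pn; apply: ny; exists n.
move=> i' j' a' w; apply: IH => //; have := weight_lt i j; have := weight_lt i' j'; lia.
Qed.
End Triangular.

Section LinearGroups.
Import GRing.Theory.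
Local Open Scope ring_scope.

Lemma slow_linear_virtually_nilpotent (G : groupType) (X : set G) : is_linear G -> finite_set X ->
  generated X = setT -> slow X -> virtually_nilpotent G.
Proof.
move=> [d [K [f [inj_f unit_f fM]]]] finX genX slowX.
have f1 : f 1%g = 1%:M by rewrite -(mulKmx (unit_f 1%g) (f 1%g)) -fM mulg1 mulVmx.
have rep : is_rep setT f by [].
have [L [phi [H [P [sH _ fH uP trig]]]]] := triangularizable genX slowX (is_subgroupT G) (finite_indexT G) rep.
pose r g := P *m map_mx phi (f g) *m invmx P.
apply: (@slow_triangular_virtually_nilpotent G L d H r sH _ trig _ X) => //.
  split=> [|g h _ _]; first by rewrite /r f1 map_mx1 mulmx1 mulmxV.
  by rewrite /r fM map_mxM !mulmxA mulmxKV.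
move=> g _ rg; apply: inj_f; rewrite f1; apply: (map_mx_inj (f := phi)); rewrite map_mx1.
have := congr1 (fun A => invmx P *m A *m P) rg.
by rewrite /r !mulmxA mulVmx // mul1mx mulmxKV // mulmx1 mulVmx.
Qed.
End LinearGroups.

Theorem theorem1p1 (R : realType) (G : groupType) (X : set G)
    (linG : is_linear G) (finX : finite_set X) (genX : generated X = setT) :
  (exists r : R, preceq (@residual_growth R G X) (log_pow r)) <->
  virtually_nilpotent G.
Proof.
split=> [/preceq_slow|vG]; first exact: slow_linear_virtually_nilpotent.
exact/detects_preceq/virtually_nilpotent_detects.
Qed.
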